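(* Let $\rho^*=\frac12+i\rho_y^*$ be a left edge zero associated to the parameter $\Delta^*$, and let $a,b,c,d$ be the quantities defined in the context evaluated at $(\rho_y^*,\Delta^* )$, with $c\neq0$ and $-a/c>0$. For $\Delta<\Delta^*$ let $\rho=\frac12+\delta\rho_x+i(\rho_y^*+\delta\rho_y)$, $\delta\rho_x\neq0$, be an off-critical zero associated to $\Delta$ with $\delta\rho_x\to0$ and $\delta\rho_y\to0$ as $\Delta\to\Delta^*$. Then, as $\Delta\to\Delta^*$ with $\Delta<\Delta^*$, $$\delta\rho_x=\pm\sqrt{-\frac ac}\,\sqrt{\Delta^*-\Delta}+o\left(\sqrt{\Delta^*-\Delta}\right)$$ and $$\delta\rho_y=-\frac1{2c}\left(b-\frac{ad}{c}\right)(\Delta^*-\Delta)+o(\Delta^*-\Delta).$$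
   Context: For $\Delta>0$, $\zeta^{(2)}(s,\Delta)=\frac12\sum_{(j,k)\in\mathbb{Z}^2\setminus\{(0,0)\}}(j^2+\Delta^2k^2)^{-s}$ for $\Re(s)>1$, extended analytically to $\mathbb{C}\setminus\{1\}$ (simple pole at $s=1$). A critical zero associated to $\Delta$ is $\rho=\frac12+i\rho_y$, $\rho_y\in\mathbb{R}$, with $\zeta^{(2)}(\rho,\Delta)=0$; an off-critical zero associated to $\Delta$ is $\rho=\rho_x+i\rho_y$ with $\rho_x,\rho_y\in\mathbb{R}$, $\rho_x\neq\frac12$ and $\zeta^{(2)}(\rho,\Delta)=0$. Edge zeros: the critical zeros form curves in the plane $(\Delta,\rho_y)$, written $\rho_y(\Delta)$. An edge zero associated to $\Delta^*$ is a critical zero $\frac12+i\rho_y^*$ associated to $\Delta^*$, $\rho_y^*=\rho_y(\Delta^* )$, at which $\frac{d}{d\Delta}\rho_y(\Delta)|_{\Delta=\Delta^*}=\pm\infty$; the curve being described near this point by a smooth inverse function $\Delta(\rho_y)$ with $\Delta(\rho_y^* )=\Delta^*$, this means $\frac{d}{d\rho_y}\Delta(\rho_y)|_{\rho_y=\rho_y^*}=0$. It is a left (resp. right) edge zero if $\frac{d^2}{d\rho_y^2}\Delta(\rho_y)|_{\rho_y=\rho_y^*}>0$ (resp. $<0$). Let $\theta_3(q)=\sum_{j\in\mathbb{Z}}q^{j^2}$, $\vartheta(q)=q\frac{d}{dq}\theta_3(q)=\sum_{j\in\mathbb{Z}}j^2q^{j^2}$. As functions of $(\rho_y,\Delta)$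 define $$a=\pi\int_0^1\sqrt t\cos(\rho_y\log t)\left[\theta_3(e^{-\pi t\Delta})\tfrac1{\Delta^2}\vartheta(e^{-\pi t/\Delta})-\theta_3(e^{-\pi t/\Delta})\vartheta(e^{-\pi t\Delta})\right]dt,$$ $$b=\pi\int_0^1\sqrt t\sin(\rho_y\log t)(\log t)\left[\theta_3(e^{-\pi t\Delta})\tfrac1{\Delta^2}\vartheta(e^{-\pi t/\Delta})-\theta_3(e^{-\pi t/\Delta})\vartheta(e^{-\pi t\Delta})\right]dt,$$ $$c=\frac{8(1-12\rho_y^2)}{(1+4\rho_y^2)^3}-\frac12\int_0^1\cos(\rho_y\log t)(\log t)^2\left[\theta_3(e^{-\pi t\Delta})\theta_3(e^{-\pi t/\Delta})-\frac1t\right]\frac{dt}{\sqrt t},$$ $$d=\frac{128\rho_y(1-4\rho_y^2)}{(1+4\rho_y^2)^4}-\frac16\int_0^1\sin(\rho_y\log t)(\log t)^3\left[\theta_3(e^{-\pi t\Delta})\theta_3(e^{-\pi t/\Delta})-\frac1t\right]\frac{dt}{\sqrt t}.$$ *)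

(* Defs.v *)
From Stdlib Require Import Reals ZArith List.
From Coquelicot Require Import Coquelicot.
Open Scope R_scope.

(** * The two-dimensional Epstein zeta function *)

(* [Rcpow x s = exp (s * ln x)], meant for [0 < x]. *)
Definition Rcpow (x : R) (s : C) : C :=
  (RtoC (Rpower x (Re s)) * (cos (Im s * ln x), sin (Im s * ln x)))%C.

(* Unconditional (unordered) summation of the family [f] over the index set
   [A]: the finite partial sums converge to [l] along the directed set of
   finite subsets of [A]. *)
Definition has_sum {I : Type} (A : I -> Prop) (f : I -> C) (l : C) : Prop :=
  forall eps : posreal, exists F0 : list I, List.Forall A F0 /\
    forall F : list I, NoDup F -> List.Forall A F -> incl F0 F ->
      Cmod (fold_right Cplus (RtoC 0) (map f F) - l)%C < eps.

Definition zeta2_term (Delta : R) (s : C) (p : Z * Z) : C :=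
  Rcpow ((IZR (fst p)) ^ 2 + Delta ^ 2 * (IZR (snd p)) ^ 2) (- s)%C.

Definition analytic_at (f : C -> C) (s0 : C) : Prop :=
  exists (a : nat -> C) (r : posreal), forall s : C, Cmod (s - s0)%C < r ->
    is_pseries (K := C_AbsRing) (V := C_NormedModule) a (s - s0)%C (f s).

(* [f] is the analytic continuation to [C \ {1}] of the Epstein series. As
   [C \ {1}] is connected, this determines [f s] for every [s <> 1]; the value
   [f 1] is irrelevant. *)
Definition is_zeta2 (Delta : R) (f : C -> C) : Prop :=
  (forall s : C, s <> RtoC 1 -> analytic_at f s) /\
  (forall s : C, 1 < Re s -> exists l : C,
     has_sum (fun p : Z * Z => p <> (0%Z, 0%Z)) (zeta2_term Delta s) l /\
     f s = (RtoC (1 / 2) * l)%C).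

(** * Critical, off-critical and edge zeros

    [zeta2 Delta s] stands for the function [zeta^(2) (s, Delta)]. *)

Definition critical_zero (zeta2 : R -> C -> C) (Delta rho_y : R) : Prop :=
  0 < Delta /\ zeta2 Delta (1 / 2, rho_y) = RtoC 0.

(* [s = 1] is the pole, so it is never a zero, whatever the value there. *)
Definition off_critical_zero (zeta2 : R -> C -> C) (Delta rho_x rho_y : R)
  : Prop :=
  0 < Delta /\ rho_x <> 1 / 2 /\ (rho_x, rho_y) <> RtoC 1 /\
  zeta2 Delta (rho_x, rho_y) = RtoC 0.

(* Near the point [(Delta_star, y_star)], [y |-> (D y, y)] is a smooth curve of
   critical zeros through that point. *)
Definition critical_curve (zeta2 : R -> C -> C) (Delta_star y_star : R)
  (D : R -> R) : Prop :=
  D y_star = Delta_star /\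
  locally y_star (fun y : R =>
    (forall n : nat, ex_derive_n D n y) /\ critical_zero zeta2 (D y) y).

Definition left_edge_zero (zeta2 : R -> C -> C) (Delta_star y_star : R)
  : Prop :=
  critical_zero zeta2 Delta_star y_star /\
  exists D : R -> R, critical_curve zeta2 Delta_star y_star D /\
    Derive D y_star = 0 /\ 0 < Derive_n D 2 y_star.

(** * Theta functions and the coefficients *)

(* Sum over [j >= 0] plus sum over [j < 0]. *)
Definition SeriesZ (f : Z -> R) : R :=
  Series (fun n : nat => f (Z.of_nat n)) +
  Series (fun n : nat => f (- Z.of_nat (S n))%Z).

Definition theta3 (q : R) : R := SeriesZ (fun j : Z => q ^ Z.to_nat (j * j)).

Definition vartheta (q : R) : R := q * Derive theta3 q.

(* The brackets in the integrands below, [a] and [b] sharing the first one. *)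
Definition bracket_ab (Delta t : R) : R :=
  theta3 (exp (- PI * t * Delta)) *
    (1 / Delta ^ 2 * vartheta (exp (- PI * t / Delta))) -
  theta3 (exp (- PI * t / Delta)) * vartheta (exp (- PI * t * Delta)).

Definition bracket_cd (Delta t : R) : R :=
  theta3 (exp (- PI * t * Delta)) * theta3 (exp (- PI * t / Delta)) - 1 / t.

(* All four integrands tend to [0] as [t -> 0+], and they take the value [0] at
   [t = 0] since [sqrt 0 = 0] and [ln 0 = 0] in Stdlib; hence these are proper
   Riemann integrals of continuous functions on [[0, 1]]. *)

Definition coef_a (rho_y Delta : R) : R :=
  PI * RInt (fun t : R =>
    sqrt t * cos (rho_y * ln t) * bracket_ab Delta t) 0 1.

Definition coef_b (rho_y Delta : R) : R :=
  PI * RInt (fun t : R =>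
    sqrt t * sin (rho_y * ln t) * ln t * bracket_ab Delta t) 0 1.

Definition coef_c (rho_y Delta : R) : R :=
  8 * (1 - 12 * rho_y ^ 2) / (1 + 4 * rho_y ^ 2) ^ 3 -
  1 / 2 * RInt (fun t : R =>
    cos (rho_y * ln t) * (ln t) ^ 2 * bracket_cd Delta t / sqrt t) 0 1.

Definition coef_d (rho_y Delta : R) : R :=
  128 * rho_y * (1 - 4 * rho_y ^ 2) / (1 + 4 * rho_y ^ 2) ^ 4 -
  1 / 6 * RInt (fun t : R =>
    sin (rho_y * ln t) * (ln t) ^ 3 * bracket_cd Delta t / sqrt t) 0 1.

(* Main.v *)
Require Import Defs.
From Stdlib Require Import Reals ZArith List FinFun Lra Lia.
From Coquelicot Require Import Coquelicot.
Open Scope R_scope.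

(* Riemann's theta integral gives, up to the factor [Gamma(s) (Delta / pi)^s],
   [zeta2 (1/2 + i z) = G(Delta, z)] with
   [G(Delta, z) = - 2 / (1 + 4 z^2)
      + int_0^1 cos (z ln t) (theta3 theta3 - 1 / t) dt / sqrt t],
   so that zeros of [zeta2] are zeros of [G], and [a], [- b], [2 c], [- 6 d] are
   its partial derivatives [G_Delta], [G_(Delta y)], [G_yy], [G_yyy]. At an edge
   zero [G = G_y = 0]. As [G] is real for real [z], at a zero [z = y - i x] with
   [x <> 0] the real part of [G = 0] and its imaginary part divided by [x] read
   [G - x^2 G_yy / 2 = O(x^4)] and [G_y - x^2 G_yyy / 6 = O(x^4)] at the real
   point [y]; to first order in [Delta_star - Delta] they are linear equations for
   [x^2] and [drho_y].

   The transformation law of theta is obtained by Polya's method, as the limit of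
   a finite Fourier identity for binomial coefficients. The identity between
   [zeta2] and [G] is proved for [Re s > 3] by termwise Mellin transforms and
   continued along horizontal lines, where both sides are real analytic. *)

(** All integrals are proper Riemann integrals over (0, 1]: the half line is folded by [t -> 1 / t],
    and every integrand vanishes at 0 like a positive power of [t]. This shapes the domains. Using
    [s Gamma(s)] instead of [Gamma(s)] gains a power of [t] and reaches the whole half plane
    [0 < Re s], while the Mellin transform of the lattice sum, of order [1 / t] at 0, is compared
    with the series only for [Re s > 3]. A complex integral is a pair of real ones, obtained from
    one real integrand with a phase.

    Horizontal lines off the real axis never meet the pole 1, so a real identity theorem suffices
    there; the real axis is then reached by continuity in [Im s].

    [G_y = 0] at an edge is the chain rule along the curve: [G (D y, y) = 0] and [D' = 0]. Then [G]
    is to leading order linear in [Delta] and quadratic in [z - y_star], so [x^2], not [x], is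
    comparable with [Delta_star - Delta]. The imaginary part, divided by [x], gives a second
    equation of that same order, in which [drho_y] appears linearly. *)

(** * Random walk identity *)

(* The sum over [- p <= k <= p] of an even function. *)
Fixpoint dsum (f : nat -> R) (p : nat) : R :=
  match p with O => f O | S q => dsum f q + 2 * f (S q) end.

Lemma dsum_ext (f g : nat -> R) (p : nat) :
  (forall k, (k <= p)%nat -> f k = g k) -> dsum f p = dsum g p.
Proof.
  induction p as [|p IH]; intros H; simpl.
  - apply H; lia.
  - rewrite IH, (H (S p)); auto.
Qed.

Lemma dsum_scal (c : R) (f : nat -> R) (p : nat) :
  dsum (fun k => c * f k) p = c * dsum f p.
Proof. induction p as [|p IH]; simpl; [|rewrite IH]; ring. Qed.

Lemma dsum_plus (f g : nat -> R) (p : nat) :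
  dsum (fun k => f k + g k) p = dsum f p + dsum g p.
Proof. induction p as [|p IH]; simpl; [|rewrite IH]; ring. Qed.

Lemma dsum_switch (F : nat -> nat -> R) (p q : nat) :
  dsum (fun i => dsum (fun j => F i j) q) p =
  dsum (fun j => dsum (fun i => F i j) p) q.
Proof.
  induction p as [|p IH]; simpl; [reflexivity|].
  rewrite IH, <- dsum_scal, <- dsum_plus. reflexivity.
Qed.

Lemma dsum_sum_n (f : nat -> R) (p : nat) :
  dsum f (S p) = f O + 2 * sum_n (fun k => f (S k)) p.
Proof.
  induction p as [|p IH].
  - simpl. rewrite sum_O. ring.
  - rewrite sum_Sn. change (dsum f (S (S p))) with (dsum f (S p) + 2 * f (S (S p))).
    rewrite IH. unfold plus; simpl. ring.
Qed.

(* [walk m v = 4^(-m) * binomial (2 m) (m + v)], the law after [2 m] steps of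
   the simple random walk. *)
Fixpoint walk (m v : nat) : R :=
  match m with
  | O => match v with O => 1 | S _ => 0 end
  | S m' => match v with
            | O => (walk m' 0 + walk m' 1) / 2
            | S v' => (walk m' v' + 2 * walk m' (S v') + walk m' (S (S v'))) / 4
            end
  end.

Lemma walk_ge0 (m v : nat) : 0 <= walk m v.
Proof.
  revert v; induction m as [|m IH]; intros [|v]; simpl; try lra.
  - generalize (IH 0%nat) (IH 1%nat); lra.
  - generalize (IH v) (IH (S v)) (IH (S (S v))); lra.
Qed.

Lemma walk_out (m v : nat) : (m < v)%nat -> walk m v = 0.
Proof.
  revert v; induction m as [|m IH]; intros [|v] H; simpl; try lia; try lra.
  rewrite !IH by lia. lra.
Qed.

(** The ratio of neighbouring binomial coefficients, in a form that also holds for [v >= m], where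
    both sides vanish. Every estimate of the walk below multiplies such ratios. *)
Lemma walk_ratio (m v : nat) :
  (INR m + INR v + 1) * walk m (S v) = (INR m - INR v) * walk m v.
Proof.
  revert v; induction m as [|m IH]; intros v.
  - destruct v; simpl; ring.
  - destruct v as [|v].
    + generalize (IH 0%nat) (IH 1%nat).
      rewrite !S_INR. simpl walk. simpl INR. intros H0 H1. lra.
    + generalize (IH v) (IH (S v)) (IH (S (S v))).
      rewrite !S_INR.
      change (walk (S m) (S (S v))) with
        ((walk m (S v) + 2 * walk m (S (S v)) + walk m (S (S (S v)))) / 4).
      change (walk (S m) (S v)) with
        ((walk m v + 2 * walk m (S v) + walk m (S (S v))) / 4).
      intros H0 H1 H2.
      lra.
Qed.

Lemma walk_0 (m : nat) :
  walk (S m) 0 = (2 * INR m + 1) / (2 * INR m + 2) * walk m 0.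
Proof.
  generalize (walk_ratio m 0); simpl. intros H.
  generalize (pos_INR m); intros Hm.
  replace (walk m 1) with (INR m / (INR m + 1) * walk m 0).
  - field. lra.
  - apply (Rmult_eq_reg_l (INR m + 1)); [|lra].
    replace ((INR m + 1) * (INR m / (INR m + 1) * walk m 0)) with (INR m * walk m 0)
      by (field; lra). lra.
Qed.

Lemma walk_0_pos (m : nat) : 0 < walk m 0.
Proof.
  induction m as [|m IH]; [simpl; lra|].
  rewrite walk_0. generalize (pos_INR m); intros Hm.
  apply Rmult_lt_0_compat; [|exact IH].
  apply Rdiv_lt_0_compat; lra.
Qed.

(** A double step averages the shifts -1, 0, 1 with weights 1/4, 1/2, 1/4, which multiplies the
    characteristic function by [cos x ^ 2 = (1 + cos (2 x)) / 2]. Cutting the sum at [N] leaves the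
    boundary terms. *)
Lemma walk_dsum_S (m N : nat) (x : R) :
  dsum (fun v => walk (S m) v * cos (INR v * (2 * x))) N =
  cos x ^ 2 * dsum (fun v => walk m v * cos (INR v * (2 * x))) N +
  (walk m (S N) * cos (INR N * (2 * x)) -
   walk m N * cos (INR (S N) * (2 * x))) / 2.
Proof.
  assert (H2 : cos x ^ 2 = (1 + cos (2 * x)) / 2).
  { rewrite cos_2a_cos. field. }
  rewrite H2.
  induction N as [|N IH].
  - simpl. rewrite !Rmult_0_l, cos_0, Rmult_1_l. field.
  - cbn [dsum]. rewrite IH.
    replace (INR N * (2 * x)) with (INR (S N) * (2 * x) - 2 * x)
      by (rewrite S_INR; ring).
    replace (INR (S (S N)) * (2 * x)) with (INR (S N) * (2 * x) + 2 * x)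
      by (rewrite !S_INR; ring).
    rewrite cos_plus, cos_minus.
    change (walk (S m) (S N)) with
        ((walk m N + 2 * walk m (S N) + walk m (S (S N))) / 4).
    field.
Qed.

Lemma walk_dsum (m N : nat) (x : R) : (m <= N)%nat ->
  dsum (fun v => walk m v * cos (INR v * (2 * x))) N = cos x ^ (2 * m).
Proof.
  revert N; induction m as [|m IH]; intros N HN.
  - simpl. clear HN. induction N as [|N IH]; simpl.
    + rewrite Rmult_0_l, cos_0. ring.
    + rewrite IH. ring.
  - rewrite walk_dsum_S, IH by lia.
    rewrite !(walk_out m (S N)), !(walk_out m N) by lia.
    replace (2 * S m)%nat with (2 + 2 * m)%nat by lia.
    rewrite (pow_add (cos x) 2). field.
Qed.

(** Each term times [2 sin (x / 2)] is a difference of sines at consecutive half-integer multiples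
    of [x], so the sum telescopes. Undivided, the formula also holds where [sin (x / 2)]
    vanishes. *)
Lemma dirichlet_kernel (x : R) (p : nat) :
  sin (x / 2) * dsum (fun k => cos (INR k * x)) p = sin (INR (2 * p + 1) * (x / 2)).
Proof.
  induction p as [|p IH].
  - simpl. rewrite Rmult_0_l, cos_0. replace (1 * (x / 2)) with (x / 2) by ring. ring.
  - cbn [dsum]. rewrite Rmult_plus_distr_l, IH.
    replace (INR (2 * S p + 1) * (x / 2)) with (INR (S p) * x + x / 2).
    2: { rewrite !plus_INR, !mult_INR, S_INR. simpl. field. }
    replace (INR (2 * p + 1) * (x / 2)) with (INR (S p) * x - x / 2).
    2: { rewrite !plus_INR, !mult_INR, S_INR. simpl. field. }
    rewrite sin_plus, sin_minus. ring.
Qed.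

Lemma cos_2PI_nat (x : R) (n : nat) : cos (x + INR n * (2 * PI)) = cos x.
Proof.
  replace (x + INR n * (2 * PI)) with (x + 2 * INR n * PI) by ring.
  apply cos_period.
Qed.

Lemma dsum_const1 (p : nat) : dsum (fun _ => 1) p = INR (2 * p + 1).
Proof.
  induction p as [|p IH]; [simpl; ring|].
  cbn [dsum]. rewrite IH.
  replace (2 * S p + 1)%nat with (S (S (2 * p + 1))) by lia.
  rewrite !S_INR. ring.
Qed.

Lemma dirichlet_multiple (p j : nat) :
  dsum (fun k => cos (INR k * (2 * (PI * INR (j * (2 * p + 1)) / INR (2 * p + 1))))) p =
  INR (2 * p + 1).
Proof.
  transitivity (dsum (fun _ => 1) p); [|apply dsum_const1].
  apply dsum_ext. intros k _. rewrite mult_INR.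
  assert (H : INR (2 * p + 1) <> 0) by (apply not_0_INR; lia).
  replace (INR k * (2 * (PI * (INR j * INR (2 * p + 1)) / INR (2 * p + 1))))
    with (0 + INR (k * j) * (2 * PI)) by (rewrite mult_INR; field; exact H).
  rewrite cos_2PI_nat. apply cos_0.
Qed.

(** Together with [dirichlet_multiple], the orthogonality of the characters of the cyclic group of
    order [2 p + 1]. *)
Lemma dirichlet_non_multiple (p j r : nat) : (0 < r < 2 * p + 1)%nat ->
  dsum (fun k => cos (INR k * (2 * (PI * INR (j * (2 * p + 1) + r) / INR (2 * p + 1))))) p = 0.
Proof.
  intros [Hr1 Hr2].
  assert (H : INR (2 * p + 1) <> 0) by (apply not_0_INR; lia).
  assert (H' : 0 < INR (2 * p + 1)) by (apply lt_0_INR; lia).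
  rewrite (dsum_ext _ (fun k => cos (INR k * (2 * (PI * INR r / INR (2 * p + 1)))))).
  2: { intros k _. rewrite plus_INR, mult_INR.
       replace (INR k * (2 * (PI * (INR j * INR (2 * p + 1) + INR r) / INR (2 * p + 1))))
         with (INR k * (2 * (PI * INR r / INR (2 * p + 1))) + INR (k * j) * (2 * PI))
         by (rewrite mult_INR; field; exact H).
       apply cos_2PI_nat. }
  (* The closed form is [sin (r PI) = 0], and the factor [sin (PI r / (2 p + 1))] to be cancelled is
     positive. *)
  apply (Rmult_eq_reg_l (sin ((2 * (PI * INR r / INR (2 * p + 1))) / 2))).
  - rewrite dirichlet_kernel, Rmult_0_r.
    replace (INR (2 * p + 1) * (2 * (PI * INR r / INR (2 * p + 1)) / 2))
      with (INR r * PI) by (field; exact H).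
    apply sin_eq_0_1. exists (Z.of_nat r). rewrite <- INR_IZR_INZ. reflexivity.
  - apply Rgt_not_eq. apply Rlt_gt.
    replace (2 * (PI * INR r / INR (2 * p + 1)) / 2) with (PI * (INR r / INR (2 * p + 1)))
      by (field; exact H).
    assert (0 < INR r) by (apply lt_0_INR; lia).
    assert (INR r / INR (2 * p + 1) < 1).
    { apply (Rmult_lt_reg_r (INR (2 * p + 1))); [exact H'|].
      unfold Rdiv. rewrite Rmult_assoc, Rinv_l, Rmult_1_l, Rmult_1_r by exact H.
      apply lt_INR; lia. }
    assert (0 < INR r / INR (2 * p + 1)) by (apply Rdiv_lt_0_compat; assumption).
    generalize PI_RGT_0; intros HPI.
    apply sin_gt_0; nra.
Qed.

Lemma dsum_multiples (n M : nat) (f : nat -> R) : (0 < n)%nat ->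
  (forall j r, (0 < r < n)%nat -> f (j * n + r)%nat = 0) ->
  dsum f (M * n) = dsum (fun j => f (j * n)%nat) M.
Proof.
  intros Hn Hf. induction M as [|M IH]; [reflexivity|].
  assert (Hblock : forall r, (r < n)%nat -> dsum f (M * n + r) = dsum f (M * n)).
  { induction r as [|r IHr]; intros Hr; [rewrite Nat.add_0_r; reflexivity|].
    replace (M * n + S r)%nat with (S (M * n + r)) by lia. cbn [dsum].
    rewrite IHr by lia.
    replace (S (M * n + r)) with (M * n + S r)%nat by lia.
    rewrite Hf by lia. ring. }
  cbn [dsum]. rewrite <- IH.
  rewrite <- (Hblock (n - 1)%nat) by lia.
  replace (S M * n)%nat with (S (M * n + (n - 1))) by lia.
  reflexivity.
Qed.

(** Finite Fourier inversion for the walk modulo [2 p + 1]: each power of the cosine is expanded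
    over the walk, the sums are exchanged, and by orthogonality only the positions divisible by
    [2 p + 1] survive. *)
Lemma polya_identity (m p : nat) :
  dsum (fun k => cos (PI * INR k / INR (2 * p + 1)) ^ (2 * m)) p =
  INR (2 * p + 1) * dsum (fun j => walk m (j * (2 * p + 1))) m.
Proof.
  set (n := (2 * p + 1)%nat).
  assert (Hn : INR n <> 0) by (apply not_0_INR; lia).
  (* The bound [m * n] is at least [m], so the whole walk is summed, and it is a multiple of [n], as
     [dsum_multiples] requires. *)
  rewrite (dsum_ext _ (fun k => dsum (fun v => walk m v *
     cos (INR k * (2 * (PI * INR v / INR n)))) (m * n))).
  2: { intros k _. rewrite <- (walk_dsum m (m * n)) by (unfold n; nia).
       apply dsum_ext. intros v _. f_equal. f_equal. field. exact Hn. }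
  rewrite dsum_switch.
  rewrite (dsum_ext _ (fun v => walk m v *
     dsum (fun k => cos (INR k * (2 * (PI * INR v / INR n)))) p)).
  2: { intros v _. apply dsum_scal. }
  rewrite dsum_multiples.
  - rewrite <- dsum_scal. apply dsum_ext. intros j _.
    unfold n. rewrite dirichlet_multiple. ring.
  - unfold n; lia.
  - intros j r Hr. unfold n in *. rewrite dirichlet_non_multiple by exact Hr. ring.
Qed.

(** * Even series over the integers and dominated convergence *)

Definition dseries (f : nat -> R) : R := f O + 2 * Series (fun k => f (S k)).

Lemma is_series_Rscal (c : R) (f : nat -> R) (l : R) :
  is_series f l -> is_series (fun n => c * f n) (c * l).
Proof. exact (is_series_scal_l c f l). Qed.

Lemma ex_series_Rscal (c : R) (f : nat -> R) :
  ex_series f -> ex_series (fun n => c * f n).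
Proof. exact (ex_series_scal_l c f). Qed.

Lemma ex_series_Rle (f h : nat -> R) :
  (forall n, Rabs (f n) <= h n) -> ex_series h -> ex_series f.
Proof. exact (ex_series_le f h). Qed.

Lemma ex_series_Rabs_le (f h : nat -> R) :
  (forall n, Rabs (f n) <= h n) -> ex_series h -> ex_series (fun n => Rabs (f n)).
Proof. intros H. apply ex_series_Rle. intros n. rewrite Rabs_Rabsolu. apply H. Qed.

Lemma Series_tail_le (f h : nat -> R) (N : nat) :
  (forall k, Rabs (f k) <= h k) -> ex_series h ->
  Rabs (Series f - sum_n f N) <= Series h - sum_n h N.
Proof.
  intros Hf Hh.
  assert (Ef : ex_series f).
  { apply (ex_series_Rle f h); [exact Hf | exact Hh]. }
  rewrite (Series_incr_n f (S N)), (Series_incr_n h (S N)) by (lia || assumption).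
  simpl pred. rewrite <- !sum_n_Reals.
  replace (sum_n f N + Series (fun k => f (S N + k)%nat) - sum_n f N)
    with (Series (fun k => f (S N + k)%nat)) by ring.
  replace (sum_n h N + Series (fun k => h (S N + k)%nat) - sum_n h N)
    with (Series (fun k => h (S N + k)%nat)) by ring.
  assert (Eh : ex_series (fun k => h (S N + k)%nat)) by (apply (ex_series_incr_n h); exact Hh).
  eapply Rle_trans; [apply Series_Rabs|].
  - apply (ex_series_Rabs_le _ (fun k => h (S N + k)%nat)); [|exact Eh].
    intros k. apply Hf.
  - apply Series_le; [|exact Eh]. intros k. split; [apply Rabs_pos | apply Hf].
Qed.

Lemma is_lim_seq_sum_n (f : nat -> nat -> R) (g : nat -> R) (N : nat) :
  (forall k, is_lim_seq (fun n => f n k) (g k)) ->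
  is_lim_seq (fun n => sum_n (f n) N) (sum_n g N).
Proof.
  intros H. induction N as [|N IH].
  - rewrite sum_O. apply is_lim_seq_ext with (2 := H O). intros n. rewrite sum_O. reflexivity.
  - rewrite sum_Sn.
    apply is_lim_seq_ext with (fun n => sum_n (f n) N + f n (S N)).
    + intros n. rewrite sum_Sn. reflexivity.
    + apply (is_lim_seq_plus' _ _ _ _ IH (H (S N))).
Qed.

(** Dominated convergence for series: the majorant makes both tails smaller than [eps / 4] from one
    index [N] on, and the finitely many terms up to [N] converge one by one. *)
Lemma tannery (f : nat -> nat -> R) (g h : nat -> R) :
  (forall k, is_lim_seq (fun n => f n k) (g k)) ->
  eventually (fun n => forall k, Rabs (f n k) <= h k) -> ex_series h ->
  is_lim_seq (fun n => Series (f n)) (Series g).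
Proof.
  intros Hlim [n0 Hf] Hh.
  assert (Hg : forall k, Rabs (g k) <= h k).
  { intros k. apply (is_lim_seq_le_loc (fun n => Rabs (f n k)) (fun _ => h k) (Rabs (g k)) (h k)).
    - exists n0. intros n Hn. apply Hf, Hn.
    - apply (is_lim_seq_abs _ (g k)), Hlim.
    - apply is_lim_seq_const. }
  apply is_lim_seq_spec. intros eps.
  destruct Hh as [H Hh].
  assert (Hs : is_lim_seq (sum_n h) H) by exact Hh. apply is_lim_seq_spec in Hs.
  assert (He : 0 < eps / 4) by (destruct eps; simpl; lra).
  destruct (Hs (mkposreal _ He)) as [N HN]. simpl in HN.
  specialize (HN N (Nat.le_refl N)).
  assert (Hx : ex_series h) by (exists H; exact Hh).
  rewrite <- (is_series_unique _ _ Hh) in HN. clear Hs.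
  assert (Hl := is_lim_seq_sum_n f g N Hlim). apply is_lim_seq_spec in Hl.
  destruct (Hl (mkposreal _ He)) as [n1 Hn1]. simpl in Hn1.
  exists (max n0 n1). intros n Hn.
  specialize (Hn1 n ltac:(lia)).
  generalize (Series_tail_le (f n) h N (Hf n ltac:(lia)) Hx).
  generalize (Series_tail_le g h N Hg Hx).
  revert HN Hn1. unfold Rabs.
  repeat destruct Rcase_abs; intros; lra.
Qed.

Lemma tannery_dseries (f : nat -> nat -> R) (g h : nat -> R) :
  (forall k, is_lim_seq (fun n => f n k) (g k)) ->
  eventually (fun n => forall k, Rabs (f n k) <= h k) -> ex_series h ->
  is_lim_seq (fun n => dseries (f n)) (dseries g).
Proof.
  intros Hlim [n0 Hf] Hh. unfold dseries.
  apply is_lim_seq_plus'; [apply Hlim|].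
  apply (is_lim_seq_scal_l _ 2 (Series (fun k => g (S k)))).
  apply tannery with (h := fun k => h (S k)).
  - intros k. apply Hlim.
  - exists n0. intros n Hn k. apply Hf, Hn.
  - apply (ex_series_incr_1 h), Hh.
Qed.

Lemma dseries_finite (f : nat -> R) (p : nat) :
  (forall k, (p < k)%nat -> f k = 0) -> dseries f = dsum f p.
Proof.
  intros H.
  assert (E : dsum f (S p) = dsum f p) by (simpl; rewrite H by lia; ring).
  rewrite <- E, dsum_sum_n. unfold dseries. f_equal. f_equal.
  apply is_series_unique.
  change (is_lim_seq (sum_n (fun k => f (S k))) (sum_n (fun k => f (S k)) p)).
  apply is_lim_seq_spec. intros eps. exists p. intros n Hn.
  replace (sum_n (fun k => f (S k)) n) with (sum_n (fun k => f (S k)) p).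
  - rewrite Rminus_diag, Rabs_R0. apply cond_pos.
  - induction Hn as [|n Hn IH]; [reflexivity|].
    rewrite sum_Sn, <- IH. rewrite (H (S (S n))) by lia. symmetry. apply Rplus_0_r.
Qed.

(** * Gaussian bounds for the walk *)

Lemma exp_le (x y : R) : x <= y -> exp x <= exp y.
Proof.
  intros [H|H]; [left; apply exp_increasing, H | rewrite H; apply Rle_refl].
Qed.

Lemma exp_pow (c : R) (k : nat) : exp (c * INR k) = exp c ^ k.
Proof.
  induction k as [|k IH]; [simpl; rewrite Rmult_0_r; apply exp_0|].
  rewrite S_INR, Rmult_plus_distr_l, exp_plus, IH, Rmult_1_r. simpl. ring.
Qed.

Lemma ex_series_exp (c : R) : 0 < c -> ex_series (fun k => exp (- c * INR k)).
Proof.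
  intros Hc.
  apply ex_series_ext with (fun k => exp (- c) ^ k).
  - intros n. symmetry. apply exp_pow.
  - apply ex_series_geom. rewrite Rabs_pos_eq by (left; apply exp_pos).
    rewrite <- exp_0. apply exp_increasing. lra.
Qed.

Lemma INR_le_sqr (k : nat) : INR k <= INR k ^ 2.
Proof.
  destruct k; [simpl; lra|]. rewrite S_INR. generalize (pos_INR k). intros; nra.
Qed.

Lemma exp_sqr_le (c : R) (k : nat) : 0 < c -> exp (- c * INR k ^ 2) <= exp (- c * INR k).
Proof.
  intros Hc. apply exp_le. generalize (INR_le_sqr k). intros; nra.
Qed.

Lemma one_minus_le_exp (x : R) : 1 - x <= exp (- x).
Proof. generalize (exp_ineq1_le (- x)). lra. Qed.

(** This is [1 + y <= exp y] at [y = x / (1 - x)], where [1 + y = 1 / (1 - x)], inverted. *)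
Lemma exp_le_one_minus (x : R) : x < 1 -> exp (- (x / (1 - x))) <= 1 - x.
Proof.
  intros Hx. rewrite exp_Ropp.
  assert (H : / (1 - x) <= exp (x / (1 - x))).
  { generalize (exp_ineq1_le (x / (1 - x))).
    replace (1 + x / (1 - x)) with (/ (1 - x)) by (field; lra). auto. }
  apply Rinv_le_contravar in H; [|apply Rinv_0_lt_compat; lra].
  rewrite Rinv_inv in H. exact H.
Qed.

Lemma pow_one_minus_bounds (x : R) (m : nat) : 0 <= x < 1 ->
  exp (- (INR m * x / (1 - x))) <= (1 - x) ^ m <= exp (- (INR m * x)).
Proof.
  intros [Hx0 Hx1]. split.
  - replace (- (INR m * x / (1 - x))) with ((- (x / (1 - x))) * INR m) by (field; lra).
    rewrite exp_pow. apply pow_incr. split; [left; apply exp_pos|].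
    apply exp_le_one_minus, Hx1.
  - replace (- (INR m * x)) with ((- x) * INR m) by ring.
    rewrite exp_pow. apply pow_incr. split; [lra|].
    apply one_minus_le_exp.
Qed.

Lemma is_lim_seq_exp (u : nat -> R) (l : R) :
  is_lim_seq u l -> is_lim_seq (fun n => exp (u n)) (exp l).
Proof.
  intros H. apply (is_lim_seq_continuous exp u l); [|exact H].
  apply derivable_continuous_pt, derivable_pt_exp.
Qed.

Lemma is_lim_seq_pow_exp (x : nat -> R) (m : nat -> nat) (L : R) :
  (forall n, 0 <= x n) -> is_lim_seq x 0 ->
  is_lim_seq (fun n => INR (m n) * x n) L ->
  is_lim_seq (fun n => (1 - x n) ^ m n) (exp (- L)).
Proof.
  intros Hx Hx0 HL.
  apply is_lim_seq_le_le_loc with (u := fun n => exp (- (INR (m n) * x n / (1 - x n))))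
    (w := fun n => exp (- (INR (m n) * x n))).
  - assert (H1 := Hx0). apply is_lim_seq_spec in H1.
    destruct (H1 (mkposreal 1 Rlt_0_1)) as [N HN]. exists N. intros n Hn.
    specialize (HN n Hn). simpl in HN. apply Rabs_def2 in HN.
    apply pow_one_minus_bounds. split; [apply Hx|lra].
  - apply is_lim_seq_exp.
    replace (- L) with (- (L / (1 - 0))) by field.
    apply (is_lim_seq_opp _ (L / (1 - 0))).
    apply is_lim_seq_div'; [exact HL| |lra].
    apply is_lim_seq_minus'; [apply is_lim_seq_const|exact Hx0].
  - apply is_lim_seq_exp. apply (is_lim_seq_opp _ L), HL.
Qed.

(** [walk m r / walk m 0] is the product over [i < r] of [1 - (2 i + 1) / (m + i + 1)]. Each factor
    is at most [exp (- (2 i + 1) / (m + R0))], and the odd numbers [2 i + 1] add up to [r^2]. The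
    fixed bound [R0] keeps the denominator constant through the induction. *)
Lemma walk_upper (m R0 r : nat) : (r <= R0)%nat -> (0 < m)%nat ->
  walk m r <= walk m 0 * exp (- (INR r ^ 2 / (INR m + INR R0))).
Proof.
  intros Hr Hm. assert (Hm' : 0 < INR m) by (apply lt_0_INR; exact Hm).
  induction r as [|r IH].
  - simpl. replace (- (0 * (0 * 1) / (INR m + INR R0))) with 0
      by (field; generalize (pos_INR R0); lra).
    rewrite exp_0. lra.
  - assert (Hr' : INR (S r) <= INR R0) by (apply le_INR; exact Hr).
    rewrite S_INR in *. generalize (pos_INR r). intros Hr0.
    set (a := (2 * INR r + 1) / (INR m + INR r + 1)).
    assert (E : walk m (S r) = (1 - a) * walk m r).
    { apply (Rmult_eq_reg_l (INR m + INR r + 1)); [|lra].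
      rewrite walk_ratio. unfold a. field. lra. }
    rewrite E.
    replace (- ((INR r + 1) ^ 2 / (INR m + INR R0))) with
      (- ((2 * INR r + 1) / (INR m + INR R0)) + - (INR r ^ 2 / (INR m + INR R0)))
      by (field; lra).
    rewrite exp_plus.
    specialize (IH ltac:(lia)).
    assert (Ha : 1 - a <= exp (- ((2 * INR r + 1) / (INR m + INR R0)))).
    { eapply Rle_trans; [apply one_minus_le_exp|]. apply exp_le.
      apply Ropp_le_contravar. unfold a. apply Rmult_le_compat_l; [lra|].
      apply Rinv_le_contravar; lra. }
    generalize (walk_ge0 m r) (exp_pos (- ((2 * INR r + 1) / (INR m + INR R0)))).
    intros. nra.
Qed.

(** The same product from below: by [exp_le_one_minus], a factor [1 - a = (m - i) / (m + i + 1)] is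
    at least [exp (- (2 i + 1) / (m - i))]. *)
Lemma walk_lower (m R0 r : nat) : (r <= R0)%nat -> (R0 < m)%nat ->
  walk m 0 * exp (- (INR r ^ 2 / (INR m - INR R0))) <= walk m r.
Proof.
  intros Hr Hm. assert (Hm' : INR R0 < INR m) by (apply lt_INR; exact Hm).
  generalize (pos_INR R0). intros HR0.
  induction r as [|r IH].
  - simpl. replace (- (0 * (0 * 1) / (INR m - INR R0))) with 0
      by (field; lra).
    rewrite exp_0. lra.
  - assert (Hr' : INR (S r) <= INR R0) by (apply le_INR; exact Hr).
    rewrite S_INR in *. generalize (pos_INR r). intros Hr0.
    set (a := (2 * INR r + 1) / (INR m + INR r + 1)).
    assert (E : walk m (S r) = (1 - a) * walk m r).
    { apply (Rmult_eq_reg_l (INR m + INR r + 1)); [|lra].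
      rewrite walk_ratio. unfold a. field. lra. }
    rewrite E.
    replace (- ((INR r + 1) ^ 2 / (INR m - INR R0))) with
      (- ((2 * INR r + 1) / (INR m - INR R0)) + - (INR r ^ 2 / (INR m - INR R0)))
      by (field; lra).
    rewrite exp_plus.
    specialize (IH ltac:(lia)).
    assert (E1 : 1 - a = (INR m - INR r) / (INR m + INR r + 1)) by (unfold a; field; lra).
    assert (P1 : 0 < 1 - a) by (rewrite E1; apply Rdiv_lt_0_compat; lra).
    assert (Ha : exp (- ((2 * INR r + 1) / (INR m - INR R0))) <= 1 - a).
    { eapply Rle_trans; [|apply exp_le_one_minus; lra]. apply exp_le.
      apply Ropp_le_contravar. rewrite E1. unfold a.
      replace ((2 * INR r + 1) / (INR m + INR r + 1) /
        ((INR m - INR r) / (INR m + INR r + 1))) with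
        ((2 * INR r + 1) / (INR m - INR r)) by (field; lra).
      apply Rmult_le_compat_l; [lra|].
      apply Rinv_le_contravar; lra. }
    generalize (walk_0_pos m) (exp_pos (- ((2 * INR r + 1) / (INR m - INR R0))))
      (exp_pos (- (INR r ^ 2 / (INR m - INR R0)))).
    intros. set (e1 := exp (- ((2 * INR r + 1) / (INR m - INR R0)))) in *.
    set (e2 := exp (- (INR r ^ 2 / (INR m - INR R0)))) in *.
    apply Rle_trans with ((1 - a) * (walk m 0 * e2)); [|apply Rmult_le_compat_l; lra].
    rewrite <- (Rmult_assoc (1 - a)), (Rmult_comm (1 - a)), (Rmult_comm e1), <- Rmult_assoc.
    rewrite (Rmult_assoc (walk m 0) (1 - a) e2), (Rmult_comm (1 - a) e2), <- Rmult_assoc.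
    apply Rmult_le_compat_l; [|exact Ha]. apply Rmult_le_pos; lra.
Qed.

(** The sequence increases, and it is bounded because [(2 m + 1) * walk m 0 ^ 2] decreases from 1.
    The value of the limit is found later, from the functional equation of [theta] at 1. *)
Lemma central_walk_cvg :
  exists K : R, is_lim_seq (fun m => INR m * walk m 0 ^ 2) K.
Proof.
  assert (H : ex_finite_lim_seq (fun m => INR m * walk m 0 ^ 2)).
  { apply ex_finite_lim_seq_incr with 1.
    - intros n. rewrite walk_0, S_INR. generalize (pos_INR n). intros Hn.
      replace ((INR n + 1) * ((2 * INR n + 1) / (2 * INR n + 2) * walk n 0) ^ 2)
        with ((INR n + / (4 * (INR n + 1))) * walk n 0 ^ 2) by (field; lra).
      apply Rmult_le_compat_r; [apply pow2_ge_0|].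
      assert (0 < / (4 * (INR n + 1))) by (apply Rinv_0_lt_compat; lra). lra.
    - intros n.
      assert (B : (2 * INR n + 1) * walk n 0 ^ 2 <= 1).
      { induction n as [|n IH]; [simpl; lra|].
        rewrite walk_0, S_INR. generalize (pos_INR n). intros Hn.
        eapply Rle_trans; [|exact IH].
        replace ((2 * (INR n + 1) + 1) * ((2 * INR n + 1) / (2 * INR n + 2) * walk n 0) ^ 2)
          with ((2 * INR n + 1) * walk n 0 ^ 2 * (1 - / (2 * INR n + 2) ^ 2)) by (field; lra).
        rewrite <- (Rmult_1_r ((2 * INR n + 1) * walk n 0 ^ 2)) at 2.
        apply Rmult_le_compat_l.
        - apply Rmult_le_pos; [lra|apply pow2_ge_0].
        - assert (0 < / (2 * INR n + 2) ^ 2) by (apply Rinv_0_lt_compat; nra). lra. }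
      generalize (pow2_ge_0 (walk n 0)) (pos_INR n). intros. nra. }
  destruct H as [K HK]. exists K. exact HK.
Qed.

(** * Transformation law of theta *)

Lemma dseries_ext (f g : nat -> R) : (forall k, f k = g k) -> dseries f = dseries g.
Proof.
  intros H. unfold dseries. rewrite H. f_equal. f_equal. apply Series_ext.
  intros k. apply H.
Qed.

Lemma is_lim_seq_inv_odd : is_lim_seq (fun p => / INR (2 * p + 1)) 0.
Proof.
  replace (Finite 0) with (Rbar_inv p_infty) by reflexivity.
  apply is_lim_seq_inv; [|discriminate].
  apply is_lim_seq_le_p_loc with INR; [|apply is_lim_seq_INR].
  exists 0%nat. intros n _. apply le_INR. lia.
Qed.

(** Diffusive scaling: with [n = 2 p + 1] and [m] about [beta n^2], the walk spreads over distances
    of order [n], and both sides of [polya_identity] have theta series as limits. *)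
Definition polya_m (beta : R) (p : nat) : nat :=
  Z.to_nat (up (beta * INR (2 * p + 1) ^ 2)).

Lemma polya_m_bounds (beta : R) (p : nat) : 0 < beta ->
  beta * INR (2 * p + 1) ^ 2 <= INR (polya_m beta p) <= beta * INR (2 * p + 1) ^ 2 + 1.
Proof.
  intros Hb. unfold polya_m.
  assert (H : 0 < INR (2 * p + 1)) by (apply lt_0_INR; lia).
  set (x := beta * INR (2 * p + 1) ^ 2).
  assert (Hx : 0 < x) by (unfold x; apply Rmult_lt_0_compat; [exact Hb | nra]).
  destruct (archimed x) as [H1 H2].
  rewrite INR_IZR_INZ, Z2Nat.id; [lra|].
  apply le_IZR. lra.
Qed.

Lemma polya_m_ratio (beta : R) : 0 < beta ->
  is_lim_seq (fun p => INR (polya_m beta p) / INR (2 * p + 1) ^ 2) beta.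
Proof.
  intros Hb.
  apply is_lim_seq_le_le with (u := fun _ => beta)
    (w := fun p => beta + / INR (2 * p + 1) * / INR (2 * p + 1)).
  - intros p. assert (H : 0 < INR (2 * p + 1)) by (apply lt_0_INR; lia).
    destruct (polya_m_bounds beta p Hb) as [H1 H2].
    assert (H3 : 0 < INR (2 * p + 1) ^ 2) by nra.
    split.
    + apply Rle_div_r; assumption.
    + apply Rle_div_l; [assumption|].
      replace ((beta + / INR (2 * p + 1) * / INR (2 * p + 1)) * INR (2 * p + 1) ^ 2)
        with (beta * INR (2 * p + 1) ^ 2 + 1) by (field; lra).
      exact H2.
  - apply is_lim_seq_const.
  - replace (Finite beta) with (Finite (beta + 0 * 0)) by (f_equal; ring).
    apply is_lim_seq_plus'; [apply is_lim_seq_const|].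
    apply is_lim_seq_mult'; apply is_lim_seq_inv_odd.
Qed.

Lemma filterlim_polya_m (beta : R) : 0 < beta ->
  filterlim (polya_m beta) eventually eventually.
Proof.
  intros Hb.
  assert (H : is_lim_seq (fun p => INR (polya_m beta p)) p_infty).
  { apply is_lim_seq_le_p_loc with (fun p => beta * INR p).
    - exists 0%nat. intros p _. eapply Rle_trans; [|apply polya_m_bounds, Hb].
      apply Rmult_le_compat_l; [lra|].
      eapply Rle_trans; [|apply INR_le_sqr]. apply le_INR; lia.
    - replace p_infty with (Rbar_mult beta p_infty).
      + apply is_lim_seq_scal_l. apply is_lim_seq_INR.
      + simpl. destruct Rle_dec; [|lra]. destruct Rle_lt_or_eq_dec; [reflexivity|lra]. }
  intros P [N HN].
  apply is_lim_seq_spec in H. destruct (H (INR N)) as [n0 Hn0].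
  exists n0. intros p Hp. apply HN. apply INR_le. left. apply Hn0, Hp.
Qed.

Lemma is_lim_sin_over : is_lim (fun x => sin x / x) 0 1.
Proof.
  apply is_lim_spec. intros eps.
  destruct (derivable_pt_lim_sin_0 eps (cond_pos eps)) as [d Hd].
  exists d. intros x Hx Hx0. simpl in Hx.
  specialize (Hd x Hx0).
  rewrite Rplus_0_l, sin_0, Rminus_0_r in Hd. apply Hd.
  revert Hx. unfold ball; simpl; unfold AbsRing_ball, abs, minus, plus, opp; simpl.
  rewrite Ropp_0, Rplus_0_r. auto.
Qed.

(** A weak Jordan inequality, from [x - x^3 / 6 <= sin x] and [x <= 2]. The slope 1/3 is enough for
    [sin (PI k / n) >= k / n] below, since [PI > 3]. *)
Lemma sin_ge_third (x : R) : 0 <= x <= PI / 2 -> x / 3 <= sin x.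
Proof.
  intros [H0 H1].
  assert (H2 : x <= 2) by (generalize PI_4; lra).
  assert (H3 : x <= PI) by (generalize PI_RGT_0; lra).
  generalize (proj1 (pre_sin_bound x 0 H0 ltac:(generalize PI_4; lra))).
  unfold sin_approx, sin_term; simpl. intros H. nra.
Qed.

Lemma cos_pow_even (x : R) (m : nat) : cos x ^ (2 * m) = (1 - sin x ^ 2) ^ m.
Proof.
  rewrite pow_mult. f_equal. generalize (sin2_cos2 x). unfold Rsqr. intros; simpl; lra.
Qed.

Lemma polya_cos_lim (beta : R) (k : nat) : 0 < beta ->
  is_lim_seq (fun p => cos (PI * INR k / INR (2 * p + 1)) ^ (2 * polya_m beta p))
    (exp (- (beta * (PI * INR k) ^ 2))).
Proof.
  intros Hb.
  (* At [k = 0] the quotient [sin y / y] used below would be 0 / 0. *)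
  destruct (Nat.eq_dec k 0) as [->|Hk].
  { change (INR 0) with 0. replace (- (beta * (PI * 0) ^ 2)) with 0 by ring. rewrite exp_0.
    apply is_lim_seq_ext with (fun _ => 1); [|apply is_lim_seq_const].
    intros n. replace (PI * 0 / INR (2 * n + 1)) with 0 by (unfold Rdiv; ring).
    rewrite cos_0, pow1. reflexivity. }
  assert (Hk' : 0 < INR k) by (apply lt_0_INR; lia).
  assert (Hpk : 0 < PI * INR k) by (generalize PI_RGT_0; intros; nra).
  set (y := fun p => PI * INR k / INR (2 * p + 1)).
  assert (Hn : forall p, 0 < INR (2 * p + 1)) by (intros; apply lt_0_INR; lia).
  assert (Hy : forall p, 0 < y p) by (intros; apply Rdiv_lt_0_compat; auto).
  assert (Ly : is_lim_seq y 0).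
  { replace (Finite 0) with (Rbar_mult (PI * INR k) 0) by (simpl; f_equal; ring).
    apply is_lim_seq_scal_l, is_lim_seq_inv_odd. }
  assert (Ls : is_lim_seq (fun p => sin (y p) / y p) 1).
  { apply (is_lim_comp_seq (fun x => sin x / x) y 0 1); [apply is_lim_sin_over| |exact Ly].
    exists 0%nat. intros p _ E. injection E. generalize (Hy p). lra. }
  assert (Lsin : is_lim_seq (fun p => sin (y p) ^ 2) 0).
  { apply is_lim_seq_ext with (fun p => (sin (y p) / y p * y p) ^ 2).
    - intros p. f_equal. field. generalize (Hy p); lra.
    - replace (Finite 0) with (Finite ((1 * 0) ^ 2)) by (f_equal; ring).
      apply (is_lim_seq_continuous (fun x => x ^ 2) _ (1 * 0)).
      + apply derivable_continuous_pt, derivable_pt_pow.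
      + apply is_lim_seq_mult'; assumption. }
  apply is_lim_seq_ext with (fun p => (1 - sin (y p) ^ 2) ^ polya_m beta p).
  { intros p. symmetry. apply cos_pow_even. }
  apply is_lim_seq_pow_exp; [intros; apply pow2_ge_0|exact Lsin|].
  apply is_lim_seq_ext with (fun p => INR (polya_m beta p) / INR (2 * p + 1) ^ 2 *
    (sin (y p) / y p * (PI * INR k)) ^ 2).
  { intros p. unfold y. field. generalize (Hn p). intros. repeat split; try lra.
    generalize PI_RGT_0; lra. }
  replace (beta * (PI * INR k) ^ 2) with (beta * (1 * (PI * INR k)) ^ 2) by ring.
  apply is_lim_seq_mult'; [apply polya_m_ratio, Hb|].
  apply (is_lim_seq_continuous (fun x => x ^ 2) _ (1 * (PI * INR k))).
  - apply derivable_continuous_pt, derivable_pt_pow.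
  - apply is_lim_seq_mult'; [exact Ls|apply is_lim_seq_const].
Qed.

(** The majorant, independent of [p]: [1 - sin^2] is at most [exp (- (k / n)^2)], and the power is
    at least [beta n^2]. *)
Lemma polya_cos_bound (beta : R) (p k : nat) : 0 < beta -> (k <= p)%nat ->
  cos (PI * INR k / INR (2 * p + 1)) ^ (2 * polya_m beta p) <= exp (- beta * INR k).
Proof.
  intros Hb Hk. rewrite cos_pow_even.
  assert (Hn : 0 < INR (2 * p + 1)) by (apply lt_0_INR; lia).
  assert (Hk2 : 2 * INR k <= INR (2 * p + 1)).
  { replace 2 with (INR 2) by reflexivity.
    rewrite <- mult_INR. apply le_INR; lia. }
  assert (HPI := PI_RGT_0). assert (Hk0 := pos_INR k). assert (HPI3 := PI2_3_2).
  set (n := INR (2 * p + 1)) in *.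
  set (y := PI * INR k / n).
  assert (Hy : 0 <= y <= PI / 2).
  { unfold y. split; [apply Rdiv_le_0_compat; nra|].
    apply Rle_div_l; [exact Hn|].
    assert (0 <= PI * (n - 2 * INR k)) by (apply Rmult_le_pos; lra). lra. }
  assert (Hs := sin_ge_third y Hy).
  assert (Hs1 := SIN_bound y).
  assert (H1 : INR k / n <= sin y).
  { eapply Rle_trans; [|exact Hs]. unfold y.
    replace (PI * INR k / n / 3) with (PI / 3 * (INR k / n)) by (field; lra).
    assert (0 <= INR k / n) by (apply Rdiv_le_0_compat; lra). nra. }
  assert (H0 : 0 <= INR k / n) by (apply Rdiv_le_0_compat; lra).
  eapply Rle_trans.
  { apply pow_incr with (y := exp (- (INR k / n) ^ 2)).
    split; [nra|]. eapply Rle_trans; [apply one_minus_le_exp|]. apply exp_le. nra. }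
  rewrite <- exp_pow. eapply Rle_trans; [|apply exp_sqr_le, Hb]. apply exp_le.
  destruct (polya_m_bounds beta p Hb) as [Hm _]. fold n in Hm.
  replace (- (INR k / n) ^ 2 * INR (polya_m beta p)) with
    (- (INR (polya_m beta p) * (INR k / n) ^ 2)) by ring.
  replace (- beta * INR k ^ 2) with (- (beta * n ^ 2 * (INR k / n) ^ 2)) by (field; lra).
  apply Ropp_le_contravar. apply Rmult_le_compat_r; [apply pow2_ge_0|exact Hm].
Qed.

Lemma polya_walk_lim (beta : R) (j : nat) : 0 < beta ->
  is_lim_seq (fun p => walk (polya_m beta p) (j * (2 * p + 1)) / walk (polya_m beta p) 0)
    (exp (- (INR j ^ 2 / beta))).
Proof.
  intros Hb.
  assert (Hn : forall p, 0 < INR (2 * p + 1)) by (intros; apply lt_0_INR; lia).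
  assert (L0 : is_lim_seq (fun p => INR j * / INR (2 * p + 1)) 0).
  { replace (Finite 0) with (Rbar_mult (INR j) 0) by (simpl; f_equal; ring).
    apply is_lim_seq_scal_l, is_lim_seq_inv_odd. }
  assert (Lm := polya_m_ratio beta Hb).
  assert (Lsub := is_lim_seq_minus' _ _ _ _ Lm L0).
  assert (Ladd := is_lim_seq_plus' _ _ _ _ Lm L0).
  apply is_lim_seq_le_le_loc with
    (u := fun p => exp (- (INR j ^ 2 /
       (INR (polya_m beta p) / INR (2 * p + 1) ^ 2 - INR j * / INR (2 * p + 1)))))
    (w := fun p => exp (- (INR j ^ 2 /
       (INR (polya_m beta p) / INR (2 * p + 1) ^ 2 + INR j * / INR (2 * p + 1))))).
  - assert (Lsub' := Lsub). apply is_lim_seq_spec in Lsub'.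
    assert (Hb2 : 0 < beta / 2) by lra.
    destruct (Lsub' (mkposreal _ Hb2)) as [N HN]. exists N. intros p Hp.
    specialize (HN p Hp). cbn [pos] in HN. apply Rabs_def2 in HN.
    specialize (Hn p).
    set (m := polya_m beta p) in *.
    set (r := (j * (2 * p + 1))%nat).
    set (n := INR (2 * p + 1)) in *.
    assert (Er : INR r = INR j * n) by (unfold r, n; rewrite mult_INR; reflexivity).
    assert (Hd : 0 < INR m / n ^ 2 - INR j * / n) by lra.
    assert (Hrm : INR r < INR m).
    { rewrite Er. assert (0 < (INR m / n ^ 2 - INR j * / n) * n ^ 2)
        by (apply Rmult_lt_0_compat; [exact Hd|apply pow_lt, Hn]).
      replace ((INR m / n ^ 2 - INR j * / n) * n ^ 2) with (INR m - INR j * n) in H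
        by (field; lra). lra. }
    assert (Hw := walk_0_pos m).
    assert (Hrm' : (r < m)%nat) by (apply INR_lt, Hrm).
    generalize (pos_INR r) (pos_INR j). intros Hr0 Hj0.
    split.
    + replace (INR j ^ 2 / (INR m / n ^ 2 - INR j * / n)) with
        (INR r ^ 2 / (INR m - INR r)).
      2: { rewrite Er. field. repeat split; first [lra | rewrite <- Er; lra]. }
      apply Rle_div_r; [exact Hw|]. rewrite Rmult_comm. apply walk_lower; [lia|exact Hrm'].
    + replace (INR j ^ 2 / (INR m / n ^ 2 + INR j * / n)) with
        (INR r ^ 2 / (INR m + INR r)).
      2: { rewrite Er. field. repeat split; first [lra | rewrite <- Er; lra]. }
      apply Rle_div_l; [exact Hw|]. rewrite Rmult_comm. apply walk_upper; lia.
  - apply is_lim_seq_exp. apply (is_lim_seq_opp _ (INR j ^ 2 / beta)).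
    replace (INR j ^ 2 / beta) with (INR j ^ 2 / (beta - 0)) by (f_equal; ring).
    apply is_lim_seq_div'; [apply is_lim_seq_const|exact Lsub|lra].
  - apply is_lim_seq_exp. apply (is_lim_seq_opp _ (INR j ^ 2 / beta)).
    replace (INR j ^ 2 / beta) with (INR j ^ 2 / (beta + 0)) by (f_equal; ring).
    apply is_lim_seq_div'; [apply is_lim_seq_const|exact Ladd|lra].
Qed.

(** Within the range of the walk, [walk_upper] with [R0 = m] gives [exp (- r^2 / (2 m))], and
    [m <= (beta + 1) n^2] yields the constant; beyond that range the walk vanishes. *)
Lemma polya_walk_bound (beta : R) (p j : nat) : 0 < beta ->
  Rabs (walk (polya_m beta p) (j * (2 * p + 1)) / walk (polya_m beta p) 0) <=
  exp (- (/ (2 * (beta + 1))) * INR j).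
Proof.
  intros Hb. set (m := polya_m beta p). set (r := (j * (2 * p + 1))%nat).
  assert (Hw := walk_0_pos m).
  assert (Hn : 1 <= INR (2 * p + 1)) by (apply (le_INR 1); lia).
  rewrite Rabs_pos_eq by (apply Rdiv_le_0_compat; [apply walk_ge0|exact Hw]).
  apply Rle_div_l; [exact Hw|].
  destruct (Nat.le_gt_cases r m) as [Hr|Hr].
  2: { rewrite walk_out by exact Hr. apply Rmult_le_pos; [left; apply exp_pos|lra]. }
  destruct (polya_m_bounds beta p Hb) as [Hm1 Hm2]. fold m in Hm1, Hm2.
  assert (Hc : 0 < / (2 * (beta + 1))) by (apply Rinv_0_lt_compat; lra).
  assert (Hm : 0 < INR m).
  { eapply Rlt_le_trans; [|exact Hm1]. apply Rmult_lt_0_compat; [exact Hb|apply pow_lt; lra]. }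
  eapply Rle_trans; [apply (walk_upper m m r Hr); apply INR_lt, Hm|].
  rewrite Rmult_comm. apply Rmult_le_compat_r; [lra|].
  eapply Rle_trans; [|apply exp_sqr_le, Hc]. apply exp_le.
  unfold r. rewrite mult_INR.
  replace (- / (2 * (beta + 1)) * INR j ^ 2) with (- (INR j ^ 2 * / (2 * (beta + 1)))) by ring.
  apply Ropp_le_contravar.
  replace ((INR j * INR (2 * p + 1)) ^ 2 / (INR m + INR m)) with
    (INR j ^ 2 * (INR (2 * p + 1) ^ 2 / (2 * INR m))) by (field; lra).
  apply Rmult_le_compat_l; [apply pow2_ge_0|].
  apply Rle_div_r; [lra|].
  replace (/ (2 * (beta + 1)) * (2 * INR m)) with (INR m / (beta + 1)) by (field; lra).
  apply Rle_div_l; [lra|]. nra.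
Qed.

(** Both sides of [polya_identity] are taken to the limit. On the right the factor [n * walk m 0] is
    split off: its square is [m * walk m 0 ^ 2] divided by [m / n^2], hence tends to [K / beta]. *)
Lemma polya_limit : exists K : R, forall beta : R, 0 < beta ->
  dseries (fun k => exp (- (beta * (PI * INR k) ^ 2))) =
  sqrt (K / beta) * dseries (fun j => exp (- (INR j ^ 2 / beta))).
Proof.
  destruct central_walk_cvg as [K HK]. exists K. intros beta Hb.
  set (F := fun p k => if le_dec k p then
     cos (PI * INR k / INR (2 * p + 1)) ^ (2 * polya_m beta p) else 0).
  set (G := fun p j => walk (polya_m beta p) (j * (2 * p + 1)) / walk (polya_m beta p) 0).
  assert (HF : is_lim_seq (fun p => dseries (F p))
    (dseries (fun k => exp (- (beta * (PI * INR k) ^ 2))))).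
  { apply tannery_dseries with (h := fun k => exp (- beta * INR k)).
    - intros k. apply is_lim_seq_ext_loc with (2 := polya_cos_lim beta k Hb).
      exists k. intros p Hp. unfold F. destruct le_dec; [reflexivity|lia].
    - exists 0%nat. intros p _ k. unfold F. destruct le_dec as [Hk|Hk].
      + rewrite Rabs_pos_eq; [apply polya_cos_bound; assumption|].
        rewrite pow_mult. apply pow_le, pow2_ge_0.
      + rewrite Rabs_R0. left; apply exp_pos.
    - apply ex_series_exp, Hb. }
  assert (HG : is_lim_seq (fun p => dseries (G p)) (dseries (fun j => exp (- (INR j ^ 2 / beta))))).
  { apply tannery_dseries with (h := fun j => exp (- (/ (2 * (beta + 1))) * INR j)).
    - intros j. apply polya_walk_lim, Hb.
    - exists 0%nat. intros p _ j. apply polya_walk_bound, Hb.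
    - apply ex_series_exp. apply Rinv_0_lt_compat; lra. }
  assert (HC : is_lim_seq (fun p => INR (2 * p + 1) * walk (polya_m beta p) 0) (sqrt (K / beta))).
  { apply is_lim_seq_ext with (fun p => sqrt ((INR (polya_m beta p) * walk (polya_m beta p) 0 ^ 2) /
      (INR (polya_m beta p) / INR (2 * p + 1) ^ 2))).
    - intros p. assert (Hn : 0 < INR (2 * p + 1)) by (apply lt_0_INR; lia).
      destruct (polya_m_bounds beta p Hb) as [Hm _].
      assert (Hm' : 0 < INR (polya_m beta p)) by (eapply Rlt_le_trans; [|exact Hm]; apply Rmult_lt_0_compat; [lra|apply pow_lt; lra]).
      replace (INR (polya_m beta p) * walk (polya_m beta p) 0 ^ 2 /
        (INR (polya_m beta p) / INR (2 * p + 1) ^ 2)) with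
        ((INR (2 * p + 1) * walk (polya_m beta p) 0) ^ 2) by (field; lra).
      apply sqrt_pow2. generalize (walk_0_pos (polya_m beta p)). intros; nra.
    - apply (is_lim_seq_continuous sqrt _ (K / beta)).
      + apply continuity_pt_filterlim, continuous_sqrt.
      + apply is_lim_seq_div'; [|apply polya_m_ratio, Hb|lra].
        apply (is_lim_seq_subseq (fun m => INR m * walk m 0 ^ 2)); [|exact HK].
        apply filterlim_polya_m, Hb. }
  assert (HE : is_lim_seq (fun p => dseries (F p))
    (sqrt (K / beta) * dseries (fun j => exp (- (INR j ^ 2 / beta))))).
  { apply is_lim_seq_ext with (2 := is_lim_seq_mult' _ _ _ _ HC HG).
    intros p. rewrite (dseries_finite (F p) p).
    2: { intros k Hk. unfold F. destruct le_dec; [lia|reflexivity]. }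
    rewrite (dseries_finite (G p) (polya_m beta p)).
    2: { intros k Hk. unfold G. rewrite walk_out by nia. unfold Rdiv; ring. }
    rewrite (dsum_ext (F p) (fun k => cos (PI * INR k / INR (2 * p + 1)) ^ (2 * polya_m beta p))).
    2: { intros k Hk. unfold F. destruct le_dec; [reflexivity|lia]. }
    rewrite polya_identity, Rmult_assoc, <- dsum_scal. f_equal. apply dsum_ext.
    intros j _. unfold G. field. apply Rgt_not_eq, walk_0_pos. }
  apply is_lim_seq_unique in HF. apply is_lim_seq_unique in HE.
  rewrite HF in HE. injection HE. auto.
Qed.

(** Equal to [theta3 (exp (- PI * x))] (see [theta3_exp]), in the variable for which the modular
    inversion is [x -> / x]. *)
Definition theta (x : R) : R := dseries (fun k => exp (- (PI * x * INR k ^ 2))).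

Lemma Series_ge0 (f : nat -> R) : (forall k, 0 <= f k) -> ex_series f -> 0 <= Series f.
Proof.
  intros H E. rewrite <- (Rmult_0_l (Series f)), <- Series_scal_l.
  apply Series_le; [|exact E]. intros n. generalize (H n). lra.
Qed.

Lemma dseries_pos (f : nat -> R) : 0 < f O -> (forall k, 0 <= f k) ->
  ex_series (fun k => f (S k)) -> 0 < dseries f.
Proof.
  intros H0 H E. unfold dseries.
  assert (0 <= Series (fun k => f (S k))).
  { apply Series_ge0; [intros; apply H|exact E]. }
  lra.
Qed.

Lemma ex_series_theta (x : R) : 0 < x ->
  ex_series (fun k => exp (- (PI * x * INR (S k) ^ 2))).
Proof.
  intros Hx. apply (ex_series_incr_1 (fun k => exp (- (PI * x * INR k ^ 2)))).
  assert (Hp : 0 < PI * x) by (generalize PI_RGT_0; intros; nra).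
  apply (ex_series_Rle _ (fun k => exp (- (PI * x) * INR k)));
    [|apply (ex_series_exp (PI * x) Hp)].
  intros k. rewrite Rabs_pos_eq by (left; apply exp_pos).
  eapply Rle_trans; [|apply exp_sqr_le, Hp]. apply exp_le.
  apply Req_le. simpl. ring.
Qed.

Lemma theta_pos (x : R) : 0 < x -> 0 < theta x.
Proof.
  intros Hx. apply dseries_pos; [apply exp_pos|left; apply exp_pos|].
  apply ex_series_theta, Hx.
Qed.

Theorem theta_functional (x : R) : 0 < x -> theta x = / sqrt x * theta (/ x).
Proof.
  destruct polya_limit as [K HK].
  assert (HPI := PI_RGT_0).
  assert (H : forall x, 0 < x -> theta x = sqrt (PI * K / x) * theta (/ x)).
  { clear x. intros x Hx.
    assert (Hb : 0 < x / PI) by (apply Rdiv_lt_0_compat; assumption).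
    generalize (HK (x / PI) Hb).
    replace (K / (x / PI)) with (PI * K / x) by (field; lra).
    unfold theta. intros E.
    rewrite (dseries_ext _ (fun k => exp (- (x / PI * (PI * INR k) ^ 2)))).
    2: { intros k. f_equal. field. lra. }
    rewrite E. f_equal. apply dseries_ext. intros k. f_equal. field. lra. }
  (* At the fixed point [x = 1] of the inversion both sides contain the same positive number, which
     determines the constant. *)
  assert (H1 : sqrt (PI * K) = 1).
  { generalize (H 1 Rlt_0_1). rewrite Rinv_1, Rdiv_1_r. intros E.
    generalize (theta_pos 1 Rlt_0_1). intros. nra. }
  intros Hx. rewrite (H x Hx) at 1.
  assert (HPK : 0 <= PI * K).
  { destruct (Rle_dec 0 (PI * K)) as [?|n]; [assumption|].
    rewrite sqrt_neg_0 in H1; lra. }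
  rewrite sqrt_div by assumption. rewrite H1. unfold Rdiv. ring.
Qed.

(** * Derivatives of theta *)

Definition exp_taylor (N : nat) (v : R) : R := sum_n (fun j => v ^ j / INR (fact j)) N.

Lemma is_series_exp (v : R) : is_series (fun j => v ^ j / INR (fact j)) (exp v).
Proof.
  generalize (is_exp_Reals v). intros H. apply is_pseries_R in H.
  eapply is_series_ext; [|exact H]. intros n. simpl. unfold Rdiv. ring.
Qed.

Lemma exp_taylor_tail (N : nat) (v : R) :
  Rabs (exp v - exp_taylor N v) <= exp (Rabs v) - exp_taylor N (Rabs v).
Proof.
  rewrite <- (is_series_unique _ _ (is_series_exp v)).
  rewrite <- (is_series_unique _ _ (is_series_exp (Rabs v))).
  apply Series_tail_le.
  - intros k. unfold Rdiv. rewrite Rabs_mult, <- RPow_abs, (Rabs_pos_eq (/ INR (fact k))).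
    + apply Rle_refl.
    + left. apply Rinv_0_lt_compat, INR_fact_lt_0.
  - exists (exp (Rabs v)). apply is_series_exp.
Qed.

Lemma exp_tail_series (N : nat) (v : R) :
  exp v - exp_taylor N v = Series (fun j => v ^ (S N + j) / INR (fact (S N + j))).
Proof.
  rewrite <- (is_series_unique _ _ (is_series_exp v)).
  rewrite (Series_incr_n _ (S N)); [|lia|exists (exp v); apply is_series_exp].
  unfold exp_taylor. rewrite sum_n_Reals. simpl pred. ring.
Qed.

Lemma exp_tail_le_series (N : nat) (a : R) (g : nat -> R) (l : R) : 0 <= a ->
  (forall j, a ^ (S N + j) / INR (fact (S N + j)) <= g j) -> is_series g l ->
  exp a - exp_taylor N a <= l.
Proof.
  intros Ha Hg Hl. rewrite exp_tail_series, <- (is_series_unique _ _ Hl).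
  apply Series_le; [|exists l; exact Hl]. intros j. split; [|apply Hg].
  apply Rdiv_le_0_compat; [apply pow_le, Ha|apply INR_fact_lt_0].
Qed.

Lemma exp_remainder (N : nat) (v : R) :
  Rabs (exp v - exp_taylor N v) <= Rabs v ^ S N * exp (Rabs v).
Proof.
  eapply Rle_trans; [apply exp_taylor_tail|].
  apply exp_tail_le_series with (g := fun j => Rabs v ^ S N * (Rabs v ^ j / INR (fact j))).
  - apply Rabs_pos.
  - intros j. rewrite pow_add. unfold Rdiv. rewrite Rmult_assoc.
    apply Rmult_le_compat_l; [apply pow_le, Rabs_pos|].
    apply Rmult_le_compat_l; [apply pow_le, Rabs_pos|].
    apply Rinv_le_contravar; [apply INR_fact_lt_0|].
    apply le_INR, fact_le. lia.
  - apply is_series_Rscal, is_series_exp.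
Qed.

(** The tail at [|v|] is at most [2^-(N + 1)] times the tail at [2 |v|]. The factor depending on [N]
    is thus free of [v], which makes termwise integration possible although [v] will be a multiple
    of [ln t]. *)
Lemma exp_remainder_geom (N : nat) (v : R) :
  Rabs (exp v - exp_taylor N v) <= (/ 2) ^ N * exp (2 * Rabs v).
Proof.
  eapply Rle_trans; [apply exp_taylor_tail|].
  eapply Rle_trans.
  - apply exp_tail_le_series with (N := N) (a := Rabs v)
      (g := fun j => (/ 2) ^ S N * ((2 * Rabs v) ^ (S N + j) / INR (fact (S N + j)))).
    + apply Rabs_pos.
    + intros j. rewrite Rpow_mult_distr, (pow_add 2).
      replace ((/ 2) ^ S N * (2 ^ S N * 2 ^ j * Rabs v ^ (S N + j) / INR (fact (S N + j))))
        with (2 ^ j * (Rabs v ^ (S N + j) / INR (fact (S N + j)))).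
      * rewrite <- (Rmult_1_l (_ / _)) at 1. apply Rmult_le_compat_r.
        -- apply Rdiv_le_0_compat; [apply pow_le, Rabs_pos|apply INR_fact_lt_0].
        -- apply pow_R1_Rle. lra.
      * rewrite pow_inv. field. split; [apply INR_fact_neq_0|apply pow_nonzero; lra].
    + apply is_series_Rscal. apply Series_correct.
      apply (ex_series_incr_n (fun j => (2 * Rabs v) ^ j / INR (fact j))).
      exists (exp (2 * Rabs v)). apply is_series_exp.
  - rewrite <- exp_tail_series.
    assert (H : 0 <= exp_taylor N (2 * Rabs v)).
    { unfold exp_taylor. rewrite sum_n_Reals. apply cond_pos_sum. intros k.
      apply Rdiv_le_0_compat; [apply pow_le|apply INR_fact_lt_0].
      generalize (Rabs_pos v); lra. }
    assert (H2 : 0 < (/ 2) ^ N) by (apply pow_lt; lra).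
    assert (H3 := exp_pos (2 * Rabs v)).
    simpl. nra.
Qed.

Lemma is_derive_Rplus (f g : R -> R) (x df dg : R) : is_derive f x df ->
  is_derive g x dg -> is_derive (fun x => f x + g x) x (df + dg).
Proof. exact (is_derive_plus f g x df dg). Qed.

Lemma is_derive_Rminus (f g : R -> R) (x df dg : R) : is_derive f x df ->
  is_derive g x dg -> is_derive (fun x => f x - g x) x (df - dg).
Proof. exact (is_derive_minus f g x df dg). Qed.

Lemma is_derive_Rmult (f g : R -> R) (x df dg : R) : is_derive f x df ->
  is_derive g x dg -> is_derive (fun x => f x * g x) x (df * g x + f x * dg).
Proof. intros Hf Hg. exact (is_derive_mult f g x df dg Hf Hg Rmult_comm). Qed.

Lemma is_derive_Rscal (c : R) (f : R -> R) (x df : R) : is_derive f x df ->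
  is_derive (fun x => c * f x) x (c * df).
Proof. exact (is_derive_scal f x c df). Qed.

(** Termwise Taylor estimates produce a quadratic error; the lemma serves for series, for integrals
    with a parameter and at the end point 0. *)
Lemma is_derive_quadratic (f : R -> R) (x l M r : R) : 0 < r ->
  (forall h, Rabs h < r -> Rabs (f (x + h) - f x - h * l) <= M * h ^ 2) ->
  is_derive f x l.
Proof.
  intros Hr H. apply is_derive_Reals. intros eps Heps.
  assert (HM : 0 < Rabs M + 1) by (generalize (Rabs_pos M); lra).
  assert (Hd : 0 < Rmin r (eps / (Rabs M + 1))).
  { apply Rmin_pos; [exact Hr|apply Rdiv_lt_0_compat; assumption]. }
  exists (mkposreal _ Hd). intros h Hh0 Hh. simpl in Hh.
  specialize (H h (Rlt_le_trans _ _ _ Hh (Rmin_l _ _))).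
  assert (Hh2 : Rabs h < eps / (Rabs M + 1)) by (eapply Rlt_le_trans; [exact Hh|apply Rmin_r]).
  replace ((f (x + h) - f x) / h - l) with ((f (x + h) - f x - h * l) / h) by (field; exact Hh0).
  assert (Hah : 0 < Rabs h) by (apply Rabs_pos_lt, Hh0).
  unfold Rdiv. rewrite Rabs_mult, Rabs_inv. apply Rlt_div_l; [exact Hah|].
  eapply Rle_lt_trans; [exact H|].
  apply Rlt_div_r in Hh2; [|exact HM].
  rewrite <- (pow2_abs h). generalize (Rle_abs M). intros. nra.
Qed.

(** From [v / p <= exp (v / p)] raised to the power [p]; the convention [0 ^ 0 = 1] includes
    [p = 0]. *)
Lemma exp_neg_le (v : R) (p : nat) : 0 < v -> exp (- v) <= INR p ^ p / v ^ p.
Proof.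
  intros Hv. destruct p as [|p].
  - simpl. rewrite Rdiv_1_r, <- exp_0. apply exp_le. lra.
  - assert (Hp : 0 < INR (S p)) by (apply lt_0_INR; lia).
    assert (H : v ^ S p / INR (S p) ^ S p <= exp v).
    { replace (exp v) with (exp (v / INR (S p) * INR (S p))) by (f_equal; field; lra).
      rewrite exp_pow.
      replace (v ^ S p / INR (S p) ^ S p) with ((v / INR (S p)) ^ S p)
        by (unfold Rdiv; rewrite Rpow_mult_distr, pow_inv; reflexivity).
      apply pow_incr. split; [apply Rdiv_le_0_compat; lra|].
      generalize (exp_ineq1_le (v / INR (S p))). lra. }
    rewrite exp_Ropp.
    replace (INR (S p) ^ S p / v ^ S p) with (/ (v ^ S p / INR (S p) ^ S p)).
    + apply Rinv_le_contravar; [|exact H]. apply Rdiv_lt_0_compat; apply pow_lt; lra.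
    + field. split; apply pow_nonzero; lra.
Qed.

Lemma ex_series_inv_sqr : ex_series (fun n => / INR (S n) ^ 2).
Proof.
  apply ex_series_Rle with (fun n => 2 * (/ INR (S n) - / INR (S (S n)))).
  - intros n. generalize (pos_INR n). intros Hn. rewrite !S_INR.
    rewrite Rabs_pos_eq by (left; apply Rinv_0_lt_compat; nra).
    apply (Rmult_le_reg_r ((INR n + 1) ^ 2 * (INR n + 1 + 1))); [nra|].
    field_simplify; nra.
  - apply ex_series_Rscal.
    exists 1.
    assert (H : forall n, sum_n (fun n => / INR (S n) - / INR (S (S n))) n = 1 - / INR (S (S n))).
    { induction n as [|n IH]; [rewrite sum_O; simpl; lra|].
      rewrite sum_Sn, IH.
      change (1 - / INR (S (S n)) + (/ INR (S (S n)) - / INR (S (S (S n)))) = 1 - / INR (S (S (S n)))).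
      lra. }
    change (is_lim_seq (sum_n (fun n => / INR (S n) - / INR (S (S n)))) 1).
    apply is_lim_seq_ext with (fun n => 1 - / INR (S (S n))); [intros n; symmetry; apply H|].
    replace (Finite 1) with (Finite (1 - 0)) by (f_equal; ring).
    apply is_lim_seq_minus'; [apply is_lim_seq_const|].
    apply (is_lim_seq_incr_1 (fun n => / INR (S n))), (is_lim_seq_incr_1 (fun n => / INR n)).
    replace (Finite 0) with (Rbar_inv p_infty) by reflexivity.
    apply is_lim_seq_inv; [apply is_lim_seq_INR|discriminate].
Qed.

Definition theta_term (k : nat) (x : R) (n : nat) : R :=
  (- (PI * INR (S n) ^ 2)) ^ k * exp (- (PI * x * INR (S n) ^ 2)).

(* [theta_der k] is the [k]-th derivative of [(theta - 1) / 2]. *)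
Definition theta_der (k : nat) (x : R) : R := Series (theta_term k x).

Lemma theta_theta_der (x : R) : theta x = 1 + 2 * theta_der 0 x.
Proof.
  unfold theta, dseries, theta_der, theta_term. f_equal.
  - change (INR 0) with 0. rewrite <- exp_0. f_equal. ring.
  - f_equal. apply Series_ext. intros n. simpl pow at 2. ring.
Qed.

(** With [l = PI (n + 1)^2], the factor [l^k] is paid by [exp (- x l) <= p^p / (x l)^p], and
    [p >= k + 1] leaves at least one [1 / l] for summability in [n]. As [p] is otherwise free, decay
    in [x] of any order is available. *)
Lemma theta_term_bound (k p n : nat) (x : R) : 0 < x -> (k + 1 <= p)%nat ->
  Rabs (theta_term k x n) <= INR p ^ p / x ^ p * / INR (S n) ^ 2.
Proof.
  intros Hx Hp. unfold theta_term.
  assert (HN : 1 <= INR (S n)) by (apply (le_INR 1); lia).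
  assert (HPI := PI2_3_2).
  set (l := PI * INR (S n) ^ 2).
  assert (Hl : 1 <= l) by (unfold l; nra).
  assert (HlN : INR (S n) ^ 2 <= l) by (unfold l; nra).
  rewrite Rabs_mult, <- RPow_abs, Rabs_Ropp, (Rabs_pos_eq l) by lra.
  rewrite Rabs_pos_eq by (left; apply exp_pos).
  replace (PI * x * INR (S n) ^ 2) with (x * l) by (unfold l; ring).
  assert (Hlk : 0 < l ^ k) by (apply pow_lt; lra).
  assert (Hxp : 0 < x ^ p) by (apply pow_lt; lra).
  assert (HC : 0 <= INR p ^ p) by (apply pow_le, pos_INR).
  eapply Rle_trans.
  { apply Rmult_le_compat_l; [lra|]. apply (exp_neg_le _ p). nra. }
  set (q := (p - k - 1)%nat).
  assert (Elp : l ^ p = l ^ k * (l * l ^ q)).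
  { replace p with (k + S q)%nat by (unfold q; lia). rewrite pow_add. reflexivity. }
  assert (Hlq : 1 <= l ^ q) by (apply pow_R1_Rle; lra).
  rewrite Rpow_mult_distr, Elp.
  replace (l ^ k * (INR p ^ p / (x ^ p * (l ^ k * (l * l ^ q))))) with
    (INR p ^ p / x ^ p * / (l * l ^ q)) by (field; lra).
  apply Rmult_le_compat_l; [apply Rdiv_le_0_compat; assumption|].
  apply Rinv_le_contravar; nra.
Qed.

Lemma ex_series_theta_term (k : nat) (x : R) : 0 < x -> ex_series (theta_term k x).
Proof.
  intros Hx.
  eapply ex_series_Rle.
  - intros n. apply (theta_term_bound k (k + 1) n x Hx). lia.
  - apply ex_series_Rscal, ex_series_inv_sqr.
Qed.

Lemma theta_der_bound (k p : nat) : (k + 1 <= p)%nat ->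
  exists C, 0 < C /\ forall x, 0 < x -> Rabs (theta_der k x) <= C / x ^ p.
Proof.
  intros Hp. set (Z := Series (fun n => / INR (S n) ^ 2)).
  assert (HZ : 0 <= Z).
  { apply Series_ge0; [|apply ex_series_inv_sqr]. intros n.
    left. apply Rinv_0_lt_compat, pow_lt, lt_0_INR. lia. }
  assert (HC : 0 <= INR p ^ p) by (apply pow_le, pos_INR).
  exists (INR p ^ p * Z + 1). split; [nra|].
  intros x Hx. assert (Hxp : 0 < x ^ p) by (apply pow_lt; lra).
  apply Rle_trans with (INR p ^ p / x ^ p * Z).
  - unfold Z. rewrite <- Series_scal_l. unfold theta_der.
    assert (E : ex_series (fun n => INR p ^ p / x ^ p * / INR (S n) ^ 2)).
    { apply ex_series_Rscal, ex_series_inv_sqr. }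
    eapply Rle_trans; [apply Series_Rabs|].
    + eapply ex_series_Rabs_le; [|exact E].
      intros n. apply (theta_term_bound k p n x Hx Hp).
    + apply Series_le; [|exact E]. intros n. split; [apply Rabs_pos|].
      apply theta_term_bound; assumption.
  - replace (INR p ^ p / x ^ p * Z) with (INR p ^ p * Z / x ^ p) by (field; lra).
    apply Rmult_le_compat_r; [left; apply Rinv_0_lt_compat, Hxp|lra].
Qed.

(** First order Taylor formula for [exp]; the factor [exp (|h| l)] in the remainder is absorbed by
    giving up half of [x], whence the evaluation at [x / 2]. *)
Lemma theta_term_diff (k n : nat) (x h : R) : 0 < x -> Rabs h < x / 2 ->
  Rabs (theta_term k (x + h) n - theta_term k x n - h * theta_term (S k) x n) <=
  h ^ 2 * Rabs (theta_term (S (S k)) (x / 2) n).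
Proof.
  intros Hx Hh. unfold theta_term.
  set (l := PI * INR (S n) ^ 2).
  assert (HN : 1 <= INR (S n)) by (apply (le_INR 1); lia).
  assert (Hl : 0 < l).
  { unfold l. apply Rmult_lt_0_compat; [apply PI_RGT_0|apply pow_lt; lra]. }
  replace (PI * (x + h) * INR (S n) ^ 2) with (x * l + h * l) by (unfold l; ring).
  replace (PI * x * INR (S n) ^ 2) with (x * l) by (unfold l; ring).
  replace (PI * (x / 2) * INR (S n) ^ 2) with (x / 2 * l) by (unfold l; field).
  replace (- (x * l + h * l)) with (- (x * l) + - (h * l)) by ring.
  rewrite exp_plus.
  replace ((- l) ^ k * (exp (- (x * l)) * exp (- (h * l))) - (- l) ^ k * exp (- (x * l)) -
     h * ((- l) ^ S k * exp (- (x * l)))) with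
    ((- l) ^ k * exp (- (x * l)) * (exp (- (h * l)) - exp_taylor 1 (- (h * l)))).
  2: { unfold exp_taylor. rewrite sum_Sn, sum_O. unfold plus; simpl. field. }
  rewrite !Rabs_mult, <- !RPow_abs, !Rabs_Ropp, !(Rabs_pos_eq l) by lra.
  rewrite !(Rabs_pos_eq (exp _)) by (left; apply exp_pos).
  assert (R1 := exp_remainder 1 (- (h * l))).
  rewrite Rabs_Ropp, Rabs_mult, (Rabs_pos_eq l) in R1 by lra.
  assert (Hlk : 0 < l ^ k) by (apply pow_lt; lra).
  eapply Rle_trans.
  { apply Rmult_le_compat_l; [|exact R1]. generalize (exp_pos (- (x * l))). intros; nra. }
  replace (l ^ k * exp (- (x * l)) * ((Rabs h * l) ^ 2 * exp (Rabs h * l))) with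
    (h ^ 2 * (l ^ S (S k) * exp (- (x * l) + Rabs h * l))).
  2: { rewrite exp_plus, <- (pow2_abs h). simpl. ring. }
  apply Rmult_le_compat_l; [apply pow2_ge_0|].
  apply Rmult_le_compat_l; [apply pow_le; lra|].
  apply exp_le. nra.
Qed.

Lemma is_derive_theta_der (k : nat) (x : R) : 0 < x -> is_derive (theta_der k) x (theta_der (S k) x).
Proof.
  intros Hx.
  apply is_derive_quadratic with (r := x / 2)
    (M := Series (fun n => Rabs (theta_term (S (S k)) (x / 2) n))); [lra|].
  intros h Hh. assert (Hxh : 0 < x + h) by (apply Rabs_def2 in Hh; lra).
  unfold theta_der. rewrite <- Series_scal_l.
  assert (E1 := ex_series_theta_term k (x + h) Hxh).
  assert (E2 := ex_series_theta_term k x Hx).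
  assert (E3 := ex_series_Rscal h _ (ex_series_theta_term (S k) x Hx)).
  assert (E12 : ex_series (fun n => theta_term k (x + h) n - theta_term k x n))
    by exact (ex_series_minus _ _ E1 E2).
  rewrite <- !Series_minus by assumption.
  rewrite Rmult_comm, <- Series_scal_l.
  assert (E : ex_series (fun n => h ^ 2 * Rabs (theta_term (S (S k)) (x / 2) n))).
  { apply ex_series_Rscal. eapply ex_series_Rabs_le.
    - intros n. apply (theta_term_bound (S (S k)) (S (S k) + 1) n (x / 2)); [lra|lia].
    - apply ex_series_Rscal, ex_series_inv_sqr. }
  eapply Rle_trans; [apply Series_Rabs|].
  - eapply ex_series_Rabs_le; [|exact E].
    intros n. apply theta_term_diff; assumption.
  - apply Series_le; [|exact E]. intros n. split; [apply Rabs_pos|].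
    apply theta_term_diff; assumption.
Qed.

Lemma theta3_exp (u : R) : u < 0 -> theta3 (exp u) = theta (- u / PI).
Proof.
  intros Hu. assert (HPI := PI_RGT_0).
  assert (Hx : 0 < - u / PI) by (apply Rdiv_lt_0_compat; lra).
  assert (T : forall n, exp u ^ n = exp (- (PI * (- u / PI) * INR n))).
  { intros n. rewrite <- exp_pow. f_equal. field. lra. }
  unfold theta3, SeriesZ.
  rewrite (Series_ext (fun n => exp u ^ Z.to_nat (Z.of_nat n * Z.of_nat n))
    (fun n => exp (- (PI * (- u / PI) * INR n ^ 2)))).
  2: { intros n. rewrite T. do 2 f_equal.
       replace (Z.to_nat (Z.of_nat n * Z.of_nat n)) with (n * n)%nat by lia.
       rewrite mult_INR. ring. }
  rewrite (Series_ext (fun n => exp u ^ Z.to_nat (- Z.of_nat (S n) * - Z.of_nat (S n)))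
    (fun n => exp (- (PI * (- u / PI) * INR (S n) ^ 2)))).
  2: { intros n. rewrite T. do 2 f_equal.
       replace (Z.to_nat (- Z.of_nat (S n) * - Z.of_nat (S n))) with (S n * S n)%nat by lia.
       rewrite mult_INR. ring. }
  rewrite Series_incr_1.
  2: { apply (ex_series_incr_1 (fun k => exp (- (PI * (- u / PI) * INR k ^ 2)))).
       apply ex_series_theta, Hx. }
  unfold theta, dseries. ring.
Qed.

Lemma is_derive_theta (x : R) : 0 < x -> is_derive theta x (2 * theta_der 1 x).
Proof.
  intros Hx. apply is_derive_ext with (fun x => 1 + 2 * theta_der 0 x).
  - intros t. symmetry. apply theta_theta_der.
  - auto_derive.
    + exists (theta_der 1 x). exact (is_derive_theta_der 0 x Hx).
    + change (2 * (1 * Derive (theta_der 0) x) = 2 * theta_der 1 x).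
      rewrite (is_derive_unique _ _ _ (is_derive_theta_der 0 x Hx)). ring.
Qed.

Lemma vartheta_exp (u : R) : u < 0 -> vartheta (exp u) = - 2 / PI * theta_der 1 (- u / PI).
Proof.
  intros Hu. assert (HPI := PI_RGT_0).
  assert (Hx : 0 < - u / PI) by (apply Rdiv_lt_0_compat; lra).
  unfold vartheta.
  assert (D : is_derive theta3 (exp u) (- / (PI * exp u) * (2 * theta_der 1 (- u / PI)))).
  { apply is_derive_ext_loc with (fun q => theta (- ln q / PI)).
    (* Within this radius [0 < q < 1], where [theta3 q] is [theta (- ln q / PI)]. *)
    - assert (He : 0 < Rmin (exp u) (1 - exp u)).
      { apply Rmin_pos; [apply exp_pos|]. rewrite <- exp_0. generalize (exp_increasing _ _ Hu). lra. }
      exists (mkposreal _ He). intros q Hq. unfold ball in Hq; simpl in Hq.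
      unfold AbsRing_ball, abs, minus, plus, opp in Hq; simpl in Hq.
      apply Rabs_def2 in Hq.
      generalize (Rmin_l (exp u) (1 - exp u)) (Rmin_r (exp u) (1 - exp u)). intros.
      assert (Hq0 : 0 < q) by lra.
      rewrite <- (exp_ln q Hq0) at 2. rewrite theta3_exp; [reflexivity|].
      rewrite <- ln_1. apply ln_increasing; lra.
    - apply (is_derive_comp theta (fun q => - ln q / PI)).
      + rewrite ln_exp. apply is_derive_theta, Hx.
      + auto_derive; [apply exp_pos|]. field. split; [apply Rgt_not_eq, exp_pos|lra]. }
  rewrite (is_derive_unique _ _ _ D). field. split; apply Rgt_not_eq; [apply PI_RGT_0|apply exp_pos].
Qed.

(** * The kernel and differentiation under the integral sign *)

(** The arguments [D / t] and [/ (D * t)] are those of the two thetas after inversion, large as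
    [t -> 0]. Differentiation in [D] raises both indices (for [thB] with a factor [- / D ^ 2]), so
    these families express all derivatives of the kernel. *)
Definition thA (i k : nat) (D t : R) : R := / t ^ i * theta_der k (D / t).
Definition thB (i k : nat) (D t : R) : R := / t ^ i * theta_der k (/ (D * t)).

Definition Kern (D t : R) : R := theta (t * D) * theta (t / D) - 1 / t.
(* The derivatives of [Kern] in [Delta] come from its expression after inversion of
   both theta functions, in which the decay as [t] tends to [0] is visible. *)
Definition Kern1 (D t : R) : R :=
  2 * thA 2 1 D t - 2 / D ^ 2 * thB 2 1 D t + 4 * thA 2 1 D t * thB 0 0 D t
  - 4 / D ^ 2 * thA 1 0 D t * thB 1 1 D t.
Definition Kern2 (D t : R) : R :=
  2 * thA 3 2 D t + 4 / D ^ 3 * thB 2 1 D t + 2 / D ^ 4 * thB 3 2 D t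
  + 4 * thA 3 2 D t * thB 0 0 D t - 8 / D ^ 2 * thA 2 1 D t * thB 1 1 D t
  + 8 / D ^ 3 * thA 1 0 D t * thB 1 1 D t + 4 / D ^ 4 * thA 1 0 D t * thB 2 2 D t.

(** The inversion factors multiply to [/ t] because [sqrt (t D) * sqrt (t / D) = t]; subtracting
    [1 / t] removes the product of the constant terms of the thetas, and every remaining term
    decays. *)
Lemma Kern_dual (D t : R) : 0 < D -> 0 < t ->
  Kern D t = 2 * thA 1 0 D t + 2 * thB 1 0 D t + 4 * thA 1 0 D t * thB 0 0 D t.
Proof.
  intros HD Ht. unfold Kern.
  assert (H1 : 0 < t * D) by nra.
  assert (H2 : 0 < t / D) by (apply Rdiv_lt_0_compat; assumption).
  rewrite (theta_functional (t * D)), (theta_functional (t / D)) by assumption.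
  replace (/ sqrt (t * D) * theta (/ (t * D)) * (/ sqrt (t / D) * theta (/ (t / D))))
    with (/ (sqrt (t * D) * sqrt (t / D)) * (theta (/ (t * D)) * theta (/ (t / D)))).
  2: { field. split; apply Rgt_not_eq, sqrt_lt_R0; assumption. }
  rewrite <- sqrt_mult by lra.
  replace (t * D * (t / D)) with (t * t) by (field; lra).
  rewrite sqrt_square by lra.
  replace (/ (t / D)) with (D / t) by (field; lra).
  replace (/ (t * D)) with (/ (D * t)) by (f_equal; ring).
  rewrite !theta_theta_der. unfold thA, thB. field. lra.
Qed.

Lemma is_derive_thA (i k : nat) (D t : R) : 0 < D -> 0 < t ->
  is_derive (fun D => thA i k D t) D (thA (S i) (S k) D t).
Proof.
  intros HD Ht. unfold thA.
  assert (Hx : 0 < D / t) by (apply Rdiv_lt_0_compat; assumption).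
  assert (E := is_derive_theta_der k (D / t) Hx).
  auto_derive.
  - eexists. exact E.
  - match goal with |- context [Derive ?f ?x] =>
      replace (Derive f x) with (theta_der (S k) x) by (symmetry; apply is_derive_unique; exact E)
    end.
    simpl. unfold Rdiv. field.
    split; [apply pow_nonzero|]; lra.
Qed.

Lemma is_derive_thB (i k : nat) (D t : R) : 0 < D -> 0 < t ->
  is_derive (fun D => thB i k D t) D (- / D ^ 2 * thB (S i) (S k) D t).
Proof.
  intros HD Ht. unfold thB.
  assert (Hx : 0 < / (D * t)) by (apply Rinv_0_lt_compat; nra).
  assert (E := is_derive_theta_der k (/ (D * t)) Hx).
  auto_derive.
  - split; [eexists; exact E|]. split; [apply Rgt_not_eq, Rmult_lt_0_compat; assumption|exact I].
  - match goal with |- context [Derive ?f ?x] =>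
      replace (Derive f x) with (theta_der (S k) x) by (symmetry; apply is_derive_unique; exact E)
    end.
    simpl. field.
    repeat split; try apply pow_nonzero; lra.
Qed.

Lemma is_derive_Kern (D t : R) : 0 < D -> 0 < t ->
  is_derive (fun D => Kern D t) D (Kern1 D t).
Proof.
  intros HD Ht.
  apply is_derive_ext_loc with
    (fun D => 2 * thA 1 0 D t + 2 * thB 1 0 D t + 4 * thA 1 0 D t * thB 0 0 D t).
  { exists (mkposreal _ HD). intros D' HD'. symmetry. apply Kern_dual; [|exact Ht].
    unfold ball in HD'; simpl in HD'. unfold AbsRing_ball, abs, minus, plus, opp in HD'; simpl in HD'.
    apply Rabs_def2 in HD'. lra. }
  assert (EA := is_derive_thA 1 0 D t HD Ht).
  assert (EB := is_derive_thB 1 0 D t HD Ht).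
  assert (EC := is_derive_thB 0 0 D t HD Ht).
  unfold Kern1.
  evar_last.
  - apply is_derive_Rplus; [apply is_derive_Rplus|].
    + apply is_derive_Rscal, EA.
    + apply is_derive_Rscal, EB.
    + apply is_derive_Rmult; [apply is_derive_Rscal, EA|exact EC].
  - cbv beta; field. lra.
Qed.

Lemma is_derive_Kern1 (D t : R) : 0 < D -> 0 < t ->
  is_derive (fun D => Kern1 D t) D (Kern2 D t).
Proof.
  intros HD Ht.
  assert (EA := is_derive_thA 2 1 D t HD Ht).
  assert (EA' := is_derive_thA 1 0 D t HD Ht).
  assert (EB := is_derive_thB 2 1 D t HD Ht).
  assert (EC := is_derive_thB 0 0 D t HD Ht).
  assert (EC' := is_derive_thB 1 1 D t HD Ht).
  assert (ED2 : is_derive (fun D => 2 / D ^ 2) D (- 4 / D ^ 3)).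
  { auto_derive; [nra|field; lra]. }
  assert (ED4 : is_derive (fun D => 4 / D ^ 2) D (- 8 / D ^ 3)).
  { auto_derive; [nra|field; lra]. }
  unfold Kern1, Kern2.
  evar_last.
  - apply is_derive_Rminus; [apply is_derive_Rplus; [apply is_derive_Rminus|]|].
    + apply is_derive_Rscal, EA.
    + apply is_derive_Rmult; [exact ED2|exact EB].
    + apply is_derive_Rmult; [apply is_derive_Rscal, EA|exact EC].
    + apply is_derive_Rmult; [|exact EC'].
      apply is_derive_Rmult; [exact ED4|exact EA'].
  - cbv beta; field. lra.
Qed.

Lemma Kern_bracket (D t : R) : 0 < D -> 0 < t -> bracket_cd D t = Kern D t.
Proof.
  intros HD Ht. assert (HPI := PI_RGT_0). unfold bracket_cd, Kern.
  assert (0 < PI * t) by nra.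
  assert (0 < PI * t * D) by nra.
  assert (0 < PI * t / D) by (apply Rdiv_lt_0_compat; assumption).
  rewrite !theta3_exp.
  - do 3 f_equal; field; lra.
  - replace (- PI * t / D) with (- (PI * t / D)) by (field; lra). lra.
  - lra.
Qed.

(** [Kern1] is computed from the inverted thetas and [bracket_ab] from the original ones; both give
    the derivative of [Kern] in [D]. *)
Lemma Kern1_bracket (D t : R) : 0 < D -> 0 < t -> PI * t * bracket_ab D t = Kern1 D t.
Proof.
  intros HD Ht. assert (HPI := PI_RGT_0).
  assert (H0 : 0 < PI * t) by nra.
  assert (H1 : 0 < PI * t * D) by nra.
  assert (H2 : 0 < PI * t / D) by (apply Rdiv_lt_0_compat; assumption).
  assert (H3 : 0 < t / D) by (apply Rdiv_lt_0_compat; assumption).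
  rewrite <- (is_derive_unique _ _ _ (is_derive_Kern D t HD Ht)).
  symmetry. apply is_derive_unique. unfold Kern, bracket_ab.
  assert (E1 := is_derive_theta (t * D) ltac:(nra)).
  assert (E2 := is_derive_theta (t / D) H3).
  rewrite !theta3_exp, !vartheta_exp; [|lra| | |lra].
  2,3: replace (- PI * t / D) with (- (PI * t / D)) by (field; lra); lra.
  replace (- (- PI * t * D) / PI) with (t * D) by (field; lra).
  replace (- (- PI * t / D) / PI) with (t / D) by (field; lra).
  auto_derive.
  - repeat split; try (eexists; eassumption); lra.
  - repeat match goal with |- context [Derive ?f ?x] =>
      replace (Derive f x) with (2 * theta_der 1 x)
        by (symmetry; apply is_derive_unique; first [exact E1 | exact E2])
    end.
    unfold Rdiv. field. lra.
Qed.

(* [O (t ^ p)] on [0 < t <= 1], uniformly for [D] in the compact [[m, 1 / m]]. *)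
Definition unif_bound (m : R) (p : nat) (f : R -> R -> R) : Prop :=
  exists C : R, forall D t, m <= D <= / m -> 0 < t <= 1 -> Rabs (f D t) <= C * t ^ p.

Lemma unif_bound_plus (m : R) (p : nat) (f g : R -> R -> R) :
  unif_bound m p f -> unif_bound m p g -> unif_bound m p (fun D t => f D t + g D t).
Proof.
  intros [C1 H1] [C2 H2]. exists (C1 + C2). intros D t HD Ht.
  eapply Rle_trans; [apply Rabs_triang|].
  generalize (H1 D t HD Ht) (H2 D t HD Ht). lra.
Qed.

Lemma unif_bound_mult (m : R) (p : nat) (f g : R -> R -> R) :
  unif_bound m 0 f -> unif_bound m p g -> unif_bound m p (fun D t => f D t * g D t).
Proof.
  intros [C1 H1] [C2 H2]. exists (C1 * C2). intros D t HD Ht.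
  rewrite Rabs_mult, Rmult_assoc.
  generalize (H1 D t HD Ht) (H2 D t HD Ht). simpl. rewrite Rmult_1_r. intros.
  apply Rmult_le_compat; try apply Rabs_pos; assumption.
Qed.

Lemma unif_bound_minus (m : R) (p : nat) (f g : R -> R -> R) :
  unif_bound m p f -> unif_bound m p g -> unif_bound m p (fun D t => f D t - g D t).
Proof.
  intros [C1 H1] [C2 H2]. exists (C1 + C2). intros D t HD Ht.
  eapply Rle_trans; [apply Rabs_triang|]. rewrite Rabs_Ropp.
  generalize (H1 D t HD Ht) (H2 D t HD Ht). lra.
Qed.

Lemma unif_bound_coef (m c : R) (j : nat) : 0 < m -> unif_bound m 0 (fun D _ => c / D ^ j).
Proof.
  intros Hm. exists (Rabs c / m ^ j). intros D t [HD _] _. simpl. rewrite Rmult_1_r.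
  assert (0 < m ^ j) by (apply pow_lt, Hm).
  assert (0 < D ^ j) by (apply pow_lt; lra).
  unfold Rdiv. rewrite Rabs_mult, Rabs_inv, (Rabs_pos_eq (D ^ j)) by lra.
  apply Rmult_le_compat_l; [apply Rabs_pos|]. apply Rinv_le_contravar; [assumption|].
  apply pow_incr. lra.
Qed.

Lemma unif_bound_const (m c : R) : unif_bound m 0 (fun _ _ => c).
Proof. exists (Rabs c). intros. simpl. lra. Qed.

Lemma theta_der_scaled_bound (m : R) (i k p : nat) : 0 < m ->
  exists C, forall t x, 0 < t <= 1 -> m / t <= x -> Rabs (/ t ^ i * theta_der k x) <= C * t ^ p.
Proof.
  (* Of this exponent, [i] pays for [/ t ^ i], [p] is the order wanted, and [k + 1] meets the
     condition of [theta_der_bound]. *)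
  intros Hm. destruct (theta_der_bound k (p + i + k + 1) ltac:(lia)) as [C [HC H]].
  exists (C / m ^ (p + i + k + 1)). intros t x Ht Hx.
  assert (Hmt : 0 < m / t) by (apply Rdiv_lt_0_compat; lra).
  assert (Hti : 0 < t ^ i) by (apply pow_lt; lra).
  rewrite Rabs_mult, Rabs_inv, (Rabs_pos_eq (t ^ i)) by lra.
  rewrite Rmult_comm. apply Rle_div_l; [exact Hti|].
  eapply Rle_trans; [apply H; lra|].
  set (q := (p + i + k + 1)%nat).
  apply Rle_trans with (C / (m / t) ^ q).
  - apply Rmult_le_compat_l; [lra|]. apply Rinv_le_contravar; [apply pow_lt, Hmt|].
    apply pow_incr. lra.
  - unfold Rdiv at 2. rewrite Rpow_mult_distr, pow_inv.
    assert (Htq : t ^ q = t ^ p * t ^ i * t ^ (k + 1)).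
    { unfold q. rewrite <- !pow_add. f_equal. lia. }
    assert (H1 : t ^ (k + 1) <= 1) by (rewrite <- (pow1 (k + 1)); apply pow_incr; lra).
    assert (Hmq : 0 < m ^ q) by (apply pow_lt, Hm).
    assert (Htp : 0 < t ^ p) by (apply pow_lt; lra).
    replace (C / (m ^ q * / t ^ q)) with (C / m ^ q * (t ^ p * t ^ i * t ^ (k + 1))).
    2: { rewrite <- Htq. field. split; [apply pow_nonzero|]; lra. }
    rewrite (Rmult_assoc _ (t ^ p) (t ^ i)). apply Rmult_le_compat_l; [apply Rdiv_le_0_compat; lra|].
    assert (0 < t ^ p * t ^ i) by nra. nra.
Qed.

Lemma unif_bound_thA (m : R) (i k p : nat) : 0 < m -> unif_bound m p (thA i k).
Proof.
  intros Hm. destruct (theta_der_scaled_bound m i k p Hm) as [C H]. exists C.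
  intros D t HD Ht. apply H; [exact Ht|]. apply Rmult_le_compat_r; [|lra].
  left. apply Rinv_0_lt_compat. lra.
Qed.

Lemma unif_bound_thB (m : R) (i k p : nat) : 0 < m -> unif_bound m p (thB i k).
Proof.
  intros Hm. destruct (theta_der_scaled_bound m i k p Hm) as [C H]. exists C.
  intros D t HD Ht. apply H; [exact Ht|]. rewrite Rinv_mult.
  apply Rmult_le_compat_r; [left; apply Rinv_0_lt_compat; lra|].
  rewrite <- (Rinv_inv m). apply Rinv_le_contravar; lra.
Qed.

Ltac unif_bound_tac :=
  repeat first [apply unif_bound_thA; assumption | apply unif_bound_thB; assumption
    | apply unif_bound_const | apply unif_bound_coef; assumption
    | apply unif_bound_minus | apply unif_bound_plus | apply unif_bound_mult].

Lemma unif_bound_Kern (m : R) (p : nat) : 0 < m -> unif_bound m p Kern.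
Proof.
  intros Hm.
  assert (H : unif_bound m p (fun D t =>
    2 * thA 1 0 D t + 2 * thB 1 0 D t + 4 * thA 1 0 D t * thB 0 0 D t)) by unif_bound_tac.
  destruct H as [C H]. exists C. intros D t HD Ht. rewrite Kern_dual by lra. apply H; assumption.
Qed.

Lemma unif_bound_Kern1 (m : R) (p : nat) : 0 < m -> unif_bound m p Kern1.
Proof. intros Hm. unfold Kern1. unif_bound_tac. Qed.

Lemma unif_bound_Kern2 (m : R) (p : nat) : 0 < m -> unif_bound m p Kern2.
Proof. intros Hm. unfold Kern2. unif_bound_tac. Qed.

Lemma continuous_thA (i k : nat) (D t : R) : 0 < D -> 0 < t -> continuous (thA i k D) t.
Proof.
  intros HD Ht. unfold thA.
  assert (Hx : 0 < D / t) by (apply Rdiv_lt_0_compat; assumption).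
  assert (E := is_derive_theta_der k (D / t) Hx).
  apply (ex_derive_continuous (fun t => / t ^ i * theta_der k (D / t))). auto_derive.
  repeat split; try (apply pow_nonzero); try lra. eexists; exact E.
Qed.

Lemma continuous_thB (i k : nat) (D t : R) : 0 < D -> 0 < t -> continuous (thB i k D) t.
Proof.
  intros HD Ht. unfold thB.
  assert (Hp : 0 < D * t) by (apply Rmult_lt_0_compat; assumption).
  assert (Hx : 0 < / (D * t)) by (apply Rinv_0_lt_compat, Hp).
  assert (E := is_derive_theta_der k (/ (D * t)) Hx).
  apply (ex_derive_continuous (fun t => / t ^ i * theta_der k (/ (D * t)))). auto_derive.
  repeat split; try (apply pow_nonzero); try lra. eexists; exact E.
Qed.

Lemma continuous_Rplus (f g : R -> R) (x : R) :
  continuous f x -> continuous g x -> continuous (fun x => f x + g x) x.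
Proof. exact (continuous_plus f g x). Qed.

Lemma continuous_Rminus (f g : R -> R) (x : R) :
  continuous f x -> continuous g x -> continuous (fun x => f x - g x) x.
Proof. exact (continuous_minus f g x). Qed.

Lemma continuous_Rmult (f g : R -> R) (x : R) :
  continuous f x -> continuous g x -> continuous (fun x => f x * g x) x.
Proof. exact (continuous_mult f g x). Qed.

Ltac continuous_th_tac :=
  repeat match goal with
  | |- continuous (fun t => thA ?i ?k ?D t) _ => apply continuous_thA; assumption
  | |- continuous (fun t => thB ?i ?k ?D t) _ => apply continuous_thB; assumption
  | |- continuous (fun t => @?f t + @?g t) _ => apply (continuous_Rplus f g)
  | |- continuous (fun t => @?f t - @?g t) _ => apply (continuous_Rminus f g)
  | |- continuous (fun t => @?f t * @?g t) _ => apply (continuous_Rmult f g)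
  | |- continuous (fun _ => ?c) _ => apply continuous_const
  end.

Lemma continuous_Kern (D t : R) : 0 < D -> 0 < t -> continuous (Kern D) t.
Proof.
  intros HD Ht.
  apply continuous_ext_loc with
    (fun t => 2 * thA 1 0 D t + 2 * thB 1 0 D t + 4 * thA 1 0 D t * thB 0 0 D t).
  { exists (mkposreal _ Ht). intros t' Ht'. symmetry. apply Kern_dual; [exact HD|].
    unfold ball in Ht'; simpl in Ht'. unfold AbsRing_ball, abs, minus, plus, opp in Ht'; simpl in Ht'.
    apply Rabs_def2 in Ht'. lra. }
  continuous_th_tac.
Qed.

Lemma continuous_Kern1 (D t : R) : 0 < D -> 0 < t -> continuous (Kern1 D) t.
Proof.
  intros HD Ht. unfold Kern1.
  continuous_th_tac.
Qed.

(** * Riemann integrals on [0, 1] and their dependence on a parameter *)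

Lemma RInt_Rplus (f g : R -> R) (a b : R) : ex_RInt f a b -> ex_RInt g a b ->
  RInt (fun x => f x + g x) a b = RInt f a b + RInt g a b.
Proof. exact (RInt_plus f g a b). Qed.

Lemma RInt_Rminus (f g : R -> R) (a b : R) : ex_RInt f a b -> ex_RInt g a b ->
  RInt (fun x => f x - g x) a b = RInt f a b - RInt g a b.
Proof. exact (RInt_minus f g a b). Qed.

Lemma RInt_Rscal (c : R) (f : R -> R) (a b : R) : ex_RInt f a b ->
  RInt (fun x => c * f x) a b = c * RInt f a b.
Proof. exact (RInt_scal f a b c). Qed.

Lemma ex_RInt_Rplus (f g : R -> R) (a b : R) : ex_RInt f a b -> ex_RInt g a b ->
  ex_RInt (fun x => f x + g x) a b.
Proof. exact (ex_RInt_plus f g a b). Qed.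

Lemma ex_RInt_Rminus (f g : R -> R) (a b : R) : ex_RInt f a b -> ex_RInt g a b ->
  ex_RInt (fun x => f x - g x) a b.
Proof. exact (ex_RInt_minus f g a b). Qed.

Lemma ex_RInt_Rscal (c : R) (f : R -> R) (a b : R) : ex_RInt f a b ->
  ex_RInt (fun x => c * f x) a b.
Proof. exact (ex_RInt_scal f a b c). Qed.

(** An integrand that is [O (t^e)] with [e > 0] becomes continuous on [0, 1] once its value at 0 is
    reset to 0, and the integral does not see the end point. *)
Lemma ex_RInt_01 (f : R -> R) (C e : R) : 0 < e ->
  (forall t, 0 < t <= 1 -> continuous f t) ->
  (forall t, 0 < t <= 1 -> Rabs (f t) <= C * exp (e * ln t)) -> ex_RInt f 0 1.
Proof.
  intros He Hc Hb.
  set (g := fun t => if Rle_dec t 0 then 0 else f t).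
  apply ex_RInt_ext with g.
  { intros t [Ht _]. rewrite Rmin_left in Ht by lra. unfold g.
    destruct Rle_dec; [lra|reflexivity]. }
  apply (ex_RInt_continuous (V := R_CompleteNormedModule)).
  rewrite Rmin_left, Rmax_right by lra. intros t [Ht0 Ht1].
  destruct (Rle_lt_or_eq_dec _ _ Ht0) as [Ht|<-].
  - apply continuous_ext_loc with f; [|apply Hc; lra].
    exists (mkposreal _ Ht). intros s Hs.
    unfold ball in Hs; simpl in Hs. unfold AbsRing_ball, abs, minus, plus, opp in Hs; simpl in Hs.
    apply Rabs_def2 in Hs. unfold g. destruct Rle_dec; [lra|reflexivity].
  - intros P [eps HP].
    assert (HC : 0 < Rabs C + 1) by (generalize (Rabs_pos C); lra).
    assert (Hq : 0 < eps / (Rabs C + 1)) by (apply Rdiv_lt_0_compat; [apply cond_pos|exact HC]).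
    assert (Hd : 0 < Rmin 1 (exp (ln (eps / (Rabs C + 1)) / e))).
    { apply Rmin_pos; [lra|apply exp_pos]. }
    exists (mkposreal _ Hd). intros s Hs. apply HP.
    unfold ball in *; simpl in *. unfold AbsRing_ball, abs, minus, plus, opp in *; simpl in *.
    unfold g at 2. destruct Rle_dec as [_|n]; [|lra]. unfold g.
    rewrite Ropp_0, Rplus_0_r in *.
    destruct Rle_dec as [Hs0|Hs0]; [rewrite Rabs_R0; apply cond_pos|].
    assert (Hs1 : 0 < s) by lra. rewrite (Rabs_pos_eq s) in Hs by lra.
    assert (Hs2 := Rlt_le_trans _ _ _ Hs (Rmin_l _ _)).
    assert (Hs3 := Rlt_le_trans _ _ _ Hs (Rmin_r _ _)).
    eapply Rle_lt_trans; [apply Hb; lra|].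
    assert (Hl : exp (e * ln s) < eps / (Rabs C + 1)).
    { rewrite <- (exp_ln _ Hq). apply exp_increasing.
      apply ln_increasing in Hs3; [|exact Hs1]. rewrite ln_exp in Hs3.
      apply Rlt_div_r in Hs3; [|exact He]. lra. }
    apply Rlt_div_r in Hl; [|exact HC].
    generalize (Rle_abs C) (exp_pos (e * ln s)). intros. nra.
Qed.

Lemma RInt_01_bound (f : R -> R) (M : R) : ex_RInt f 0 1 ->
  (forall t, 0 < t < 1 -> Rabs (f t) <= M) -> Rabs (RInt f 0 1) <= M.
Proof.
  intros E H.
  assert (HM : forall c : R, RInt (fun _ => c) 0 1 = c).
  { intros c. rewrite RInt_const. unfold scal; simpl. unfold mult; simpl. ring. }
  apply Rabs_le. split.
  - rewrite <- (HM (- M)). apply RInt_le; [lra|apply ex_RInt_const|exact E|].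
    intros t Ht. specialize (H t Ht). apply Rabs_le_between in H. lra.
  - rewrite <- (HM M). apply RInt_le; [lra|exact E|apply ex_RInt_const|].
    intros t Ht. specialize (H t Ht). apply Rabs_le_between in H. lra.
Qed.

Lemma taylor_2 (g g1 g2 : R -> R) (x0 x M r : R) : Rabs (x - x0) < r ->
  (forall y, Rabs (y - x0) < r -> is_derive g y (g1 y)) ->
  (forall y, Rabs (y - x0) < r -> is_derive g1 y (g2 y)) ->
  (forall y, Rabs (y - x0) < r -> Rabs (g2 y) <= M) ->
  Rabs (g x - g x0 - (x - x0) * g1 x0) <= M * (x - x0) ^ 2.
Proof.
  intros Hx H1 H2 HM.
  assert (Hbt : forall y z, Rabs (y - x0) < r -> Rmin x0 y <= z <= Rmax x0 y ->
    Rabs (z - x0) <= Rabs (y - x0)).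
  { intros y z _. unfold Rmin, Rmax. repeat destruct Rle_dec; intros [? ?];
      unfold Rabs; repeat destruct Rcase_abs; lra. }
  destruct (MVT_gen g x0 x g1) as [c [Hc Ec]].
  { intros y Hy. apply H1. eapply Rle_lt_trans; [apply (Hbt x); [exact Hx|lra]|exact Hx]. }
  { intros y Hy. apply continuity_pt_filterlim, (ex_derive_continuous g). exists (g1 y). apply H1.
    eapply Rle_lt_trans; [apply (Hbt x); [exact Hx|lra]|exact Hx]. }
  assert (Hc' := Hbt x c Hx Hc).
  assert (Hcr : Rabs (c - x0) < r) by lra.
  destruct (MVT_gen g1 x0 c g2) as [d [Hd Ed]].
  { intros y Hy. apply H2. eapply Rle_lt_trans; [apply (Hbt c); [exact Hcr|lra]|exact Hcr]. }
  { intros y Hy. apply continuity_pt_filterlim, (ex_derive_continuous g1). exists (g2 y). apply H2.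
    eapply Rle_lt_trans; [apply (Hbt c); [exact Hcr|lra]|exact Hcr]. }
  assert (Hd' := Hbt c d Hcr Hd).
  rewrite Ec. replace (g1 c * (x - x0) - (x - x0) * g1 x0) with ((g1 c - g1 x0) * (x - x0)) by ring.
  rewrite Ed, !Rabs_mult.
  assert (HMd := HM d ltac:(lra)).
  rewrite <- (pow2_abs (x - x0)).
  replace (Rabs (x - x0) ^ 2) with (Rabs (x - x0) * Rabs (x - x0)) by ring.
  rewrite <- Rmult_assoc.
  apply Rmult_le_compat_r; [apply Rabs_pos|].
  apply Rmult_le_compat; try apply Rabs_pos; assumption.
Qed.

(** A bound on the second derivative in the parameter, uniform in [t], lets the pointwise Taylor
    remainders integrate to [O (h^2)]. *)
Lemma is_derive_RInt_01 (f f1 f2 : R -> R -> R) (x0 r M : R) : 0 < r ->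
  (forall x, Rabs (x - x0) < r -> ex_RInt (f x) 0 1) -> ex_RInt (f1 x0) 0 1 ->
  (forall x t, Rabs (x - x0) < r -> 0 < t < 1 -> is_derive (fun x => f x t) x (f1 x t)) ->
  (forall x t, Rabs (x - x0) < r -> 0 < t < 1 -> is_derive (fun x => f1 x t) x (f2 x t)) ->
  (forall x t, Rabs (x - x0) < r -> 0 < t < 1 -> Rabs (f2 x t) <= M) ->
  is_derive (fun x => RInt (f x) 0 1) x0 (RInt (f1 x0) 0 1).
Proof.
  intros Hr Hf Hf1 D1 D2 HM.
  apply is_derive_quadratic with (M := M) (r := r); [exact Hr|].
  intros h Hh.
  assert (Hx : Rabs (x0 + h - x0) < r) by (replace (x0 + h - x0) with h by ring; exact Hh).
  assert (E0 := Hf x0 ltac:(rewrite Rminus_diag, Rabs_R0; exact Hr)).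
  assert (E := Hf (x0 + h) Hx).
  assert (E1 := ex_RInt_Rscal h _ _ _ Hf1).
  assert (E2 := ex_RInt_Rminus _ _ _ _ E E0).
  rewrite <- (RInt_Rscal h (f1 x0)), <- (RInt_Rminus (f (x0 + h)) (f x0)),
    <- (RInt_Rminus (fun t => f (x0 + h) t - f x0 t) (fun t => h * f1 x0 t)) by assumption.
  apply RInt_01_bound.
  - apply ex_RInt_Rminus; [apply ex_RInt_Rminus|]; assumption.
  - intros t Ht.
    generalize (taylor_2 (fun x => f x t) (fun x => f1 x t) (fun x => f2 x t) x0 (x0 + h) M r Hx).
    cbv beta. replace (x0 + h - x0) with h by ring. intros T. apply T; intros; eauto.
Qed.

(** * Integrals over (0, 1] and scaling *)

(* Equations between integrands may be stated in [R_NormedModule], which [ring]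
   and [field] do not recognize as [R]. *)
Ltac real_eq := match goal with |- ?L = ?M => change (@eq R L M) end.

(* [f t = O (t ^ p)] on [0 < t <= 1], for real [p]. *)
Definition bigO (p : R) (f : R -> R) : Prop :=
  exists C, forall t, 0 < t <= 1 -> Rabs (f t) <= C * exp (p * ln t).

Lemma ln_le_0 (t : R) : 0 < t <= 1 -> ln t <= 0.
Proof. intros Ht. rewrite <- ln_1. apply ln_le; lra. Qed.

Lemma bigO_weaken (p q : R) (f : R -> R) : q <= p -> bigO p f -> bigO q f.
Proof.
  intros Hpq [C H]. exists (Rabs C). intros t Ht.
  eapply Rle_trans; [apply H, Ht|].
  eapply Rle_trans; [apply Rmult_le_compat_r; [left; apply exp_pos|apply Rle_abs]|].
  apply Rmult_le_compat_l; [apply Rabs_pos|]. apply exp_le.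
  generalize (ln_le_0 t Ht). intros; nra.
Qed.

Lemma bigO_mult (p q r : R) (f g : R -> R) : bigO p f -> bigO q g -> p + q = r ->
  bigO r (fun t => f t * g t).
Proof.
  intros [C1 H1] [C2 H2] <-. exists (C1 * C2). intros t Ht.
  rewrite Rabs_mult.
  replace (C1 * C2 * exp ((p + q) * ln t)) with
    ((C1 * exp (p * ln t)) * (C2 * exp (q * ln t))).
  - apply Rmult_le_compat; try apply Rabs_pos; auto.
  - rewrite Rmult_plus_distr_r, exp_plus. ring.
Qed.

Lemma bigO_plus (p : R) (f g : R -> R) : bigO p f -> bigO p g -> bigO p (fun t => f t + g t).
Proof.
  intros [C1 H1] [C2 H2]. exists (C1 + C2). intros t Ht.
  eapply Rle_trans; [apply Rabs_triang|].
  generalize (H1 t Ht) (H2 t Ht). lra.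
Qed.

Lemma bigO_minus (p : R) (f g : R -> R) : bigO p f -> bigO p g -> bigO p (fun t => f t - g t).
Proof.
  intros [C1 H1] [C2 H2]. exists (C1 + C2). intros t Ht.
  eapply Rle_trans; [apply Rabs_triang|]. rewrite Rabs_Ropp.
  generalize (H1 t Ht) (H2 t Ht). lra.
Qed.

Lemma bigO_ext (p : R) (f g : R -> R) : (forall t, 0 < t <= 1 -> f t = g t) -> bigO p f -> bigO p g.
Proof. intros E [C H]. exists C. intros t Ht. rewrite <- E by exact Ht. apply H, Ht. Qed.

Lemma bigO_0_bounded (f : R -> R) (C : R) : (forall t, 0 < t <= 1 -> Rabs (f t) <= C) -> bigO 0 f.
Proof. intros H. exists C. intros t Ht. rewrite Rmult_0_l, exp_0, Rmult_1_r. apply H, Ht. Qed.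

Lemma bigO_const (c : R) : bigO 0 (fun _ => c).
Proof. apply bigO_0_bounded with (Rabs c). intros. apply Rle_refl. Qed.

Lemma bigO_pow (p : R) : bigO p (fun t => exp (p * ln t)).
Proof. exists 1. intros t _. rewrite Rabs_pos_eq; [lra|left; apply exp_pos]. Qed.

Lemma bigO_cos (f : R -> R) : bigO 0 (fun t => cos (f t)).
Proof. apply bigO_0_bounded with 1. intros t _. apply Rabs_le. apply COS_bound. Qed.

Lemma exp_ln_opp (t : R) (n : nat) : 0 < t -> exp (- INR n * ln t) = / t ^ n.
Proof.
  intros Ht. rewrite <- (Rpower_pow n t Ht). unfold Rpower. rewrite <- exp_Ropp. f_equal. ring.
Qed.

Lemma exp_ln_nat (t : R) (n : nat) : 0 < t -> exp (INR n * ln t) = t ^ n.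
Proof. intros Ht. apply (Rpower_pow n t Ht). Qed.

Lemma bigO_inv_pow (n : nat) : bigO (- INR n) (fun t => / t ^ n).
Proof.
  exists 1. intros t Ht. rewrite exp_ln_opp by lra. rewrite Rmult_1_l, Rabs_pos_eq; [lra|].
  left. apply Rinv_0_lt_compat, pow_lt. lra.
Qed.

Lemma bigO_inv : bigO (- 1) (fun t => / t).
Proof.
  destruct (bigO_inv_pow 1) as [C H]. exists C. intros t Ht. generalize (H t Ht).
  simpl. rewrite Rmult_1_r. auto.
Qed.

Lemma nat_ge (p : R) : exists n : nat, p <= INR n.
Proof.
  destruct (Rle_lt_dec p 0) as [H|H]; [exists 0%nat; exact H|].
  destruct (archimed p) as [H1 _]. exists (Z.to_nat (up p)).
  rewrite INR_IZR_INZ, Z2Nat.id; [lra|]. apply le_IZR. lra.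
Qed.

Lemma bigO_exp_lin (c : R) : 0 < c -> bigO 0 (fun t => exp (- c * t)).
Proof.
  intros Hc. apply bigO_0_bounded with 1. intros t Ht.
  rewrite Rabs_pos_eq by (left; apply exp_pos). rewrite <- exp_0. apply exp_le. nra.
Qed.

Lemma bigO_exp_inv (c p : R) : 0 < c -> bigO p (fun t => exp (- c / t)).
Proof.
  intros Hc. destruct (nat_ge p) as [n Hn]. apply bigO_weaken with (INR n); [exact Hn|].
  exists (INR n ^ n / c ^ n). intros t Ht.
  rewrite Rabs_pos_eq by (left; apply exp_pos).
  assert (H : 0 < c / t) by (apply Rdiv_lt_0_compat; lra).
  replace (- c / t) with (- (c / t)) by (field; lra).
  eapply Rle_trans; [apply (exp_neg_le _ n H)|].
  rewrite exp_ln_nat by lra. unfold Rdiv at 2. rewrite Rpow_mult_distr, pow_inv.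
  apply Req_le. field. split; apply pow_nonzero; lra.
Qed.

Lemma bigO_Kern (D p : R) : 0 < D -> bigO p (Kern D).
Proof.
  intros HD. destruct (nat_ge p) as [n Hn]. apply bigO_weaken with (INR n); [exact Hn|].
  destruct (unif_bound_Kern (Rmin D (/ D)) n) as [C H].
  { apply Rmin_pos; [exact HD|apply Rinv_0_lt_compat, HD]. }
  exists C. intros t Ht. rewrite exp_ln_nat by lra. apply H; [|exact Ht].
  split; [apply Rmin_l|]. rewrite <- (Rinv_inv D) at 1.
  apply Rinv_le_contravar; [|apply Rmin_r]. apply Rmin_pos; [exact HD|apply Rinv_0_lt_compat, HD].
Qed.

(** Powers of the logarithm cost an arbitrarily small power of [t]: this is [exp_neg_le] at
    [- e ln t], apart from the point where [ln t = 0]. *)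
Lemma bigO_ln (k : nat) (e : R) : 0 < e -> bigO (- e) (fun t => ln t ^ k).
Proof.
  intros He. exists (INR k ^ k / e ^ k). intros t Ht.
  assert (Hl := ln_le_0 t Ht).
  destruct (Req_dec (ln t) 0) as [E|E].
  - rewrite E, Rmult_0_r, exp_0, Rmult_1_r. destruct k as [|k].
    + simpl. rewrite Rabs_R1. lra.
    + simpl pow at 1. rewrite Rmult_0_l, Rabs_R0. apply Rdiv_le_0_compat.
      * apply pow_le, pos_INR.
      * apply pow_lt, He.
  - assert (Hx : 0 < e * - ln t) by nra.
    generalize (exp_neg_le _ k Hx). intros H.
    replace (- e * ln t) with (e * - ln t) by ring.
    rewrite exp_Ropp in H.
    rewrite <- RPow_abs, Rabs_left1 by exact Hl.
    assert (Hp : 0 < (- ln t) ^ k) by (apply pow_lt; lra).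
    assert (Hpe : 0 < e ^ k) by (apply pow_lt, He).
    rewrite Rpow_mult_distr in H.
    assert (Hexp := exp_pos (e * - ln t)).
    apply (Rmult_le_compat_r (exp (e * - ln t) * (- ln t) ^ k)) in H; [|nra].
    replace (/ exp (e * - ln t) * (exp (e * - ln t) * (- ln t) ^ k)) with ((- ln t) ^ k) in H
      by (field; lra).
    eapply Rle_trans; [exact H|]. apply Req_le. field. lra.
Qed.

Definition cont_pos (f : R -> R) : Prop := forall t, 0 < t -> continuous f t.

Lemma ex_RInt_bigO (f : R -> R) (p : R) : 0 < p -> cont_pos f -> bigO p f -> ex_RInt f 0 1.
Proof.
  intros Hp Hc [C H]. apply (ex_RInt_01 f C p Hp); [|exact H]. intros t Ht. apply Hc. lra.
Qed.

Lemma cont_pos_plus (f g : R -> R) : cont_pos f -> cont_pos g -> cont_pos (fun t => f t + g t).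
Proof. intros Hf Hg t Ht. apply continuous_Rplus; auto. Qed.

Lemma cont_pos_minus (f g : R -> R) : cont_pos f -> cont_pos g -> cont_pos (fun t => f t - g t).
Proof. intros Hf Hg t Ht. apply continuous_Rminus; auto. Qed.

Lemma cont_pos_mult (f g : R -> R) : cont_pos f -> cont_pos g -> cont_pos (fun t => f t * g t).
Proof. intros Hf Hg t Ht. apply continuous_Rmult; auto. Qed.

Lemma cont_pos_const (c : R) : cont_pos (fun _ => c).
Proof. intros t _. apply continuous_const. Qed.

Lemma cont_pos_id : cont_pos (fun t => t).
Proof. intros t _. apply continuous_id. Qed.

Lemma cont_pos_exp (f : R -> R) : cont_pos f -> cont_pos (fun t => exp (f t)).
Proof.
  intros H t Ht. apply (continuous_comp f exp); [apply H, Ht|].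
  apply (ex_derive_continuous exp). auto_derive. exact I.
Qed.

Lemma cont_pos_cos (f : R -> R) : cont_pos f -> cont_pos (fun t => cos (f t)).
Proof. intros H t Ht. apply (continuous_comp f cos); [apply H, Ht|]. apply continuous_cos. Qed.

Lemma cont_pos_ln : cont_pos ln.
Proof. intros t Ht. apply (ex_derive_continuous ln). auto_derive. exact Ht. Qed.

Lemma cont_pos_pow (f : R -> R) (n : nat) : cont_pos f -> cont_pos (fun t => f t ^ n).
Proof.
  intros H. induction n as [|n IH]; simpl; [apply cont_pos_const|].
  apply cont_pos_mult; assumption.
Qed.

Lemma cont_pos_inv : cont_pos (fun t => / t).
Proof. intros t Ht. apply (ex_derive_continuous (fun t => / t)). auto_derive. lra. Qed.

Lemma cont_pos_comp_inv (f : R -> R) : cont_pos f -> cont_pos (fun t => f (/ t)).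
Proof.
  intros H t Ht. apply (continuous_comp (fun t => / t) f).
  - apply cont_pos_inv, Ht.
  - apply H, Rinv_0_lt_compat, Ht.
Qed.

Lemma cont_pos_Kern (D : R) : 0 < D -> cont_pos (Kern D).
Proof. intros HD t Ht. apply continuous_Kern; assumption. Qed.

(* The real part of [e^(i al) t^(sg + i y)]. *)
Definition cpow (sg y al t : R) : R := exp (sg * ln t) * cos (y * ln t + al).

Lemma cont_pos_cpow (sg y al : R) : cont_pos (cpow sg y al).
Proof.
  apply cont_pos_mult; [apply cont_pos_exp|apply cont_pos_cos, cont_pos_plus];
    try apply cont_pos_const; apply cont_pos_mult;
    first [apply cont_pos_const|apply cont_pos_ln].
Qed.

Lemma cont_pos_inv_sqr : cont_pos (fun t => / t ^ 2).
Proof. intros t Ht. apply (ex_derive_continuous (fun t => / t ^ 2)). auto_derive. nra. Qed.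

Ltac cont_pos_tac :=
  repeat match goal with
  | |- cont_pos _ => assumption
  | |- cont_pos (fun t => cpow ?a ?b ?c t) => apply cont_pos_cpow
  | |- cont_pos (fun t => / t ^ 2) => apply cont_pos_inv_sqr
  | |- cont_pos (fun t => ln t) => apply cont_pos_ln
  | |- cont_pos (fun t => / t) => apply cont_pos_inv
  | |- cont_pos (fun t => t) => apply cont_pos_id
  | |- cont_pos (fun t => Kern ?D t) => apply cont_pos_Kern; assumption
  | |- cont_pos (fun _ => ?c) => apply cont_pos_const
  | |- cont_pos (fun t => exp (@?f t)) => apply (cont_pos_exp f)
  | |- cont_pos (fun t => cos (@?f t)) => apply (cont_pos_cos f)
  | |- cont_pos (fun t => @?f t + @?g t) => apply (cont_pos_plus f g)
  | |- cont_pos (fun t => @?f t - @?g t) => apply (cont_pos_minus f g)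
  | |- cont_pos (fun t => @?f t * @?g t) => apply (cont_pos_mult f g)
  | |- cont_pos (fun t => @?f t / t) => apply (cont_pos_mult f (fun t => / t))
  | |- cont_pos (fun t => @?f t ^ ?n) => apply (cont_pos_pow f n)
  end.

Lemma RInt_01_ext (f g : R -> R) : (forall t, 0 < t < 1 -> f t = g t) -> RInt f 0 1 = RInt g 0 1.
Proof.
  intros H. apply RInt_ext. rewrite Rmin_left, Rmax_right by lra. exact H.
Qed.

(** Formulas in [ln t] and [/ t] carry no meaning for [t <= 0], yet the fundamental theorem of
    calculus asks for differentiability around the end point 0. *)
Definition cut0 (f : R -> R) (t : R) : R := if Rle_dec t 0 then 0 else f t.

Lemma cut0_pos (f : R -> R) (t : R) : 0 < t -> cut0 f t = f t.
Proof. intros Ht. unfold cut0. destruct Rle_dec; [lra|reflexivity]. Qed.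

Lemma locally_pos (t : R) (P : R -> Prop) : 0 < t -> (forall s, 0 < s -> P s) -> locally t P.
Proof.
  intros Ht H. exists (mkposreal _ Ht). intros s Hs. apply H.
  unfold ball in Hs; simpl in Hs. unfold AbsRing_ball, abs, minus, plus, opp in Hs; simpl in Hs.
  apply Rabs_def2 in Hs. lra.
Qed.

(* Integration up to the end point [0], where [v] extends by [0] to a [C^1]
   function. *)
Lemma FTC_01 (v v' : R -> R) : (forall t, 0 < t -> is_derive v t (v' t)) ->
  bigO 2 v -> cont_pos v' -> bigO 1 v' -> RInt v' 0 1 = v 1.
Proof.
  intros Hd [C Hv] Hc [C' Hv'].
  rewrite (RInt_01_ext v' (cut0 v')) by (intros t Ht; symmetry; apply cut0_pos; lra).
  apply is_RInt_unique.
  replace (v 1) with (cut0 v 1 - cut0 v 0).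
  2: { rewrite cut0_pos by lra. unfold cut0. destruct Rle_dec; [ring|lra]. }
  assert (Hpow : forall t, 0 < t -> exp (2 * ln t) = t ^ 2 /\ exp (1 * ln t) = t).
  { intros t Ht. split; [apply (exp_ln_nat t 2 Ht)|].
    rewrite Rmult_1_l. apply exp_ln, Ht. }
  apply (is_RInt_derive (V := R_CompleteNormedModule) (cut0 v) (cut0 v'));
    rewrite Rmin_left, Rmax_right by lra; intros t [Ht0 Ht1];
    destruct (Rle_lt_or_eq_dec _ _ Ht0) as [Ht|<-].
  - rewrite cut0_pos by exact Ht.
    apply is_derive_ext_loc with v; [|apply Hd, Ht].
    apply locally_pos; [exact Ht|]. intros s Hs. symmetry. apply cut0_pos, Hs.
  - assert (E0 : forall f, cut0 f 0 = 0) by (intros f; unfold cut0; destruct Rle_dec; lra).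
    rewrite E0. apply is_derive_quadratic with (M := Rabs C) (r := 1); [lra|].
    intros h Hh. rewrite E0, Rplus_0_l.
    destruct (Rle_lt_dec h 0) as [H|H].
    + unfold cut0. destruct Rle_dec; [|lra].
      replace (0 - 0 - h * 0) with 0 by ring. rewrite Rabs_R0.
      apply Rmult_le_pos; [apply Rabs_pos|apply pow2_ge_0].
    + rewrite cut0_pos by exact H. replace (v h - 0 - h * 0) with (v h) by ring.
      apply Rabs_def2 in Hh.
      eapply Rle_trans; [apply Hv; lra|]. rewrite (proj1 (Hpow h H)).
      apply Rmult_le_compat_r; [apply pow2_ge_0|apply Rle_abs].
  - apply continuous_ext_loc with v'; [|apply Hc, Ht].
    apply locally_pos; [exact Ht|]. intros s Hs. symmetry. apply cut0_pos, Hs.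
  - intros P [eps HP].
    assert (HC : 0 < Rabs C' + 1) by (generalize (Rabs_pos C'); lra).
    assert (Hd0 : 0 < Rmin 1 (eps / (Rabs C' + 1))).
    { apply Rmin_pos; [lra|apply Rdiv_lt_0_compat; [apply cond_pos|exact HC]]. }
    exists (mkposreal _ Hd0). intros s Hs. apply HP.
    unfold ball in *; simpl in *. unfold AbsRing_ball, abs, minus, plus, opp in *; simpl in *.
    unfold cut0 at 2. destruct Rle_dec as [_|n]; [|lra].
    rewrite Ropp_0, Rplus_0_r in *.
    destruct (Rle_lt_dec s 0) as [H|H].
    + unfold cut0. destruct Rle_dec; [|lra]. rewrite Rabs_R0. apply cond_pos.
    + rewrite cut0_pos by exact H. rewrite (Rabs_pos_eq s) in Hs by lra.
      assert (Hs2 := Rlt_le_trans _ _ _ Hs (Rmin_l _ _)).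
      assert (Hs3 := Rlt_le_trans _ _ _ Hs (Rmin_r _ _)).
      apply Rlt_div_r in Hs3; [|exact HC].
      eapply Rle_lt_trans; [apply Hv'; lra|]. rewrite (proj2 (Hpow s H)).
      generalize (Rle_abs C'). intros. nra.
Qed.

(* Scale invariance of [int_0^oo f], whose part on [1, oo) is moved to
   [0, 1] by [t -> 1 / t]. *)
Lemma mellin_scaling (f : R -> R) (l : R) : 0 < l -> cont_pos f -> bigO 1 f ->
  bigO 1 (fun t => f (/ t) * / t ^ 2) ->
  RInt (fun t => l * f (l * t) + l * f (l / t) * / t ^ 2) 0 1 =
  RInt (fun t => f t + f (/ t) * / t ^ 2) 0 1.
Proof.
  intros Hl Hc Hb Hb'.
  set (h := fun t => f (/ t) * / t ^ 2).
  assert (Hinv2 : cont_pos (fun t => / t ^ 2)).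
  { intros t Ht. apply (ex_derive_continuous (fun t => / t ^ 2)). auto_derive. nra. }
  assert (Hh : cont_pos h).
  { apply (cont_pos_mult (fun t => f (/ t))); [apply cont_pos_comp_inv, Hc|exact Hinv2]. }
  assert (Ef : ex_RInt f 0 1) by (apply ex_RInt_bigO with 1; [lra|assumption|assumption]).
  assert (Eh : ex_RInt h 0 1) by (apply ex_RInt_bigO with 1; [lra|assumption|assumption]).
  assert (Epos : forall g a b, cont_pos g -> 0 < a -> 0 < b -> ex_RInt g a b).
  { intros g a b Hg Ha Hb0. apply (ex_RInt_continuous (V := R_CompleteNormedModule)).
    intros z [Hz _]. apply Hg. eapply Rlt_le_trans; [|exact Hz]. apply Rmin_pos; assumption. }
  assert (Hil : 0 < / l) by (apply Rinv_0_lt_compat, Hl).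
  assert (Ef1 := Epos f 1 l Hc Rlt_0_1 Hl).
  assert (Eh1 := Epos h 1 (/ l) Hh Rlt_0_1 Hil).
  assert (Efl : ex_RInt f 0 l) by exact (ex_RInt_Chasles f 0 1 l Ef Ef1).
  assert (Ehl : ex_RInt h 0 (/ l)) by exact (ex_RInt_Chasles h 0 1 (/ l) Eh Eh1).
  assert (S1 : is_RInt (fun t => l * f (l * t)) 0 1 (RInt f 0 l)).
  { apply is_RInt_ext with (fun y => scal l (f (l * y + 0))).
    { intros t _. rewrite Rplus_0_r. reflexivity. }
    apply (is_RInt_comp_lin f l 0 0 1).
    rewrite Rmult_0_r, Rmult_1_r, !Rplus_0_r. apply (RInt_correct f 0 l Efl). }
  assert (S2 : is_RInt (fun t => l * f (l / t) * / t ^ 2) 0 1 (RInt h 0 (/ l))).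
  { apply is_RInt_ext with (fun y => scal (/ l) (h (/ l * y + 0))).
    { rewrite Rmin_left, Rmax_right by lra. intros t Ht. rewrite Rplus_0_r. unfold h, scal; simpl.
      unfold mult; simpl.
      replace (/ (/ l * t)) with (l / t) by (field; lra). field. lra. }
    apply (is_RInt_comp_lin h (/ l) 0 0 1).
    rewrite Rmult_0_r, Rmult_1_r, !Rplus_0_r. apply (RInt_correct h 0 (/ l) Ehl). }
  rewrite (RInt_Rplus _ h) by assumption.
  etransitivity.
  { apply (RInt_Rplus (fun t => l * f (l * t)) (fun t => l * f (l / t) * / t ^ 2));
      eexists; eassumption. }
  rewrite (is_RInt_unique _ _ _ _ S1), (is_RInt_unique _ _ _ _ S2).
  rewrite <- (RInt_Chasles f 0 1 l Ef Ef1), <- (RInt_Chasles h 0 1 (/ l) Eh Eh1).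
  (* Scaling replaces the upper bound 1 by [l] for [f] and by [/ l] for [h]; the substitution
     [t -> / t] shows that the two corrections are opposite. *)
  assert (S3 : RInt h 1 (/ l) = - RInt f 1 l).
  { assert (S : is_RInt (fun t => scal (- / t ^ 2) (f (/ t))) 1 (/ l)
      (RInt f (/ 1) (/ / l))).
    { apply (is_RInt_comp (V := R_CompleteNormedModule) f (fun t => / t) (fun t => - / t ^ 2));
        intros t [Ht _]; assert (Ht' : 0 < t)
          by (eapply Rlt_le_trans; [|exact Ht]; apply Rmin_pos; lra).
      - apply Hc, Rinv_0_lt_compat, Ht'.
      - split; [auto_derive; [lra|field; lra]|].
        apply (ex_derive_continuous (fun t => - / t ^ 2)). auto_derive. nra. }
    rewrite Rinv_1, Rinv_inv in S.
    rewrite <- (is_RInt_unique _ _ _ _ S).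
    set (g := fun t => scal (- / t ^ 2) (f (/ t))) in *.
    replace (- RInt g 1 (/ l)) with (-1 * RInt g 1 (/ l)) by ring.
    rewrite <- (RInt_Rscal (-1) g) by (eexists; exact S).
    apply RInt_ext. intros t _. unfold h, g, scal; simpl. unfold mult; simpl. ring. }
  rewrite S3. unfold plus; simpl. fold h. ring.
Qed.

(** * Mellin transforms *)

Lemma bigO_cpow (sg y al : R) : bigO sg (cpow sg y al).
Proof.
  unfold cpow. apply bigO_mult with sg 0; [apply bigO_pow|apply bigO_cos|ring].
Qed.

Lemma cpow_inv (sg y al t : R) : 0 < t -> cpow sg y al (/ t) = cpow (- sg) (- y) al t.
Proof. intros Ht. unfold cpow. rewrite ln_Rinv by exact Ht. do 2 f_equal; ring. Qed.

Lemma cpow_scal (sg y al l t : R) : 0 < l -> 0 < t ->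
  cpow sg y al (l * t) = exp (sg * ln l) * cpow sg y (al + y * ln l) t.
Proof.
  intros Hl Ht. unfold cpow. rewrite ln_mult by assumption.
  rewrite Rmult_plus_distr_l, exp_plus, Rmult_assoc. do 3 f_equal. ring.
Qed.

Lemma cpow_phase (sg y al t : R) :
  cpow sg y al t = cos al * cpow sg y 0 t - sin al * cpow sg y (- (PI / 2)) t.
Proof.
  unfold cpow. rewrite Rplus_0_r, !cos_plus, cos_neg, sin_neg, cos_PI2, sin_PI2. ring.
Qed.

(** Modelled on the lattice sum [thetaM], which is of order [/ t] at 0 and decreases faster than
    every power at infinity. *)
Definition admissible (g : R -> R) : Prop :=
  cont_pos g /\ bigO (-1) g /\ forall p, bigO p (fun t => g (/ t)).

Definition mellin_int (sg y al : R) (g : R -> R) (t : R) : R :=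
  cpow sg y al t * / t * g t + cpow (- sg) (- y) al t * / t * g (/ t).

(* [mellin s g] is the Mellin transform [int_0^oo t^(s - 1) g t dt], the part on
   [1, oo) being moved to [0, 1]. Here and below the suffix [_ph] marks the real part
   of [e^(i al)] times a complex quantity; [al = 0] and [al = - PI / 2] give its real
   and imaginary parts. *)
Definition mellin_ph (sg y al : R) (g : R -> R) : R := RInt (mellin_int sg y al g) 0 1.

Definition mellin (s : C) (g : R -> R) : C := (mellin_ph (Re s) (Im s) 0 g, mellin_ph (Re s) (Im s) (- (PI / 2)) g).

(** The integrand is [O (t^(sg - 2))]; for a proper Riemann integral up to 0 this exponent is kept
    positive. *)
Lemma ex_RInt_mellin_int (sg y al : R) (g : R -> R) : 2 < sg -> admissible g -> ex_RInt (mellin_int sg y al g) 0 1.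
Proof.
  intros Hs [Hc [H0 Hi]].
  assert (Hgi := cont_pos_comp_inv g Hc).
  apply ex_RInt_bigO with (sg - 2); [lra| |].
  - unfold mellin_int. cont_pos_tac.
  - unfold mellin_int. apply bigO_plus.
    + apply bigO_mult with (sg - 1) (-1); [|exact H0|ring].
      apply bigO_mult with sg (- 1); [apply bigO_cpow|apply bigO_inv|ring].
    + apply bigO_mult with (- sg - 1) (2 * sg - 1); [|apply Hi|ring].
      apply bigO_mult with (- sg) (- 1); [apply bigO_cpow|apply bigO_inv|ring].
Qed.

Lemma admissible_plus (g h : R -> R) : admissible g -> admissible h -> admissible (fun t => g t + h t).
Proof.
  intros [A1 [A2 A3]] [B1 [B2 B3]]. split; [|split].
  - apply cont_pos_plus; assumption.
  - apply bigO_plus; assumption.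
  - intros p. apply bigO_plus; auto.
Qed.

Lemma admissible_exp (c : R) : 0 < c -> admissible (fun t => exp (- c * t)).
Proof.
  intros Hc. split; [|split].
  - cont_pos_tac.
  - apply bigO_weaken with 0; [lra|apply bigO_exp_lin, Hc].
  - intros p. apply bigO_exp_inv, Hc.
Qed.

Lemma admissible_0 : admissible (fun _ => 0).
Proof.
  split; [|split].
  - apply cont_pos_const.
  - apply bigO_weaken with 0; [lra|apply bigO_const].
  - intros p. exists 0. intros t _. rewrite Rabs_R0. lra.
Qed.

Lemma mellin_ph_plus (sg y al : R) (g h : R -> R) : 2 < sg -> admissible g -> admissible h ->
  mellin_ph sg y al (fun t => g t + h t) = mellin_ph sg y al g + mellin_ph sg y al h.
Proof.
  intros Hs Hg Hh. unfold mellin_ph.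
  rewrite <- (RInt_Rplus (mellin_int sg y al g) (mellin_int sg y al h)) by (apply ex_RInt_mellin_int; assumption).
  apply RInt_01_ext. intros t _. unfold mellin_int. ring.
Qed.

Lemma mellin_plus (s : C) (g h : R -> R) : 2 < Re s -> admissible g -> admissible h ->
  mellin s (fun t => g t + h t) = (mellin s g + mellin s h)%C.
Proof. intros Hs Hg Hh. unfold mellin. rewrite !mellin_ph_plus by assumption. reflexivity. Qed.

Lemma mellin_0 (s : C) : mellin s (fun _ => 0) = RtoC 0.
Proof.
  unfold mellin, mellin_ph, RtoC. f_equal.
  all: rewrite (RInt_01_ext _ (fun _ => 0)) by (intros; unfold mellin_int; ring).
  all: rewrite RInt_const; unfold scal; simpl; unfold mult; simpl; ring.
Qed.

(** Compared with the integrand of [Gamma] there is one more power of [t], so the integrand is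
    [O (t^sg)] and the integral is proper for every [sg > 0], in particular on the critical line. *)
Definition gamma_int (c sg y al t : R) : R :=
  c * (cpow sg y al t * exp (- c * t)) + c * (cpow (- sg) (- y) al t * exp (- c / t)) * / t ^ 2.

(* [gamma_c c s] is [s Gamma(s) c^(- s) = c int_0^oo t^s e^(- c t) dt], convergent for
   [0 < Re s]. *)
Definition gamma_ph (c sg y al : R) : R := RInt (gamma_int c sg y al) 0 1.

Lemma bigO_inv_sqr : bigO (- 2) (fun t => / t ^ 2).
Proof. exact (bigO_inv_pow 2). Qed.

Lemma bigO_scal (p c : R) (f : R -> R) : bigO p f -> bigO p (fun t => c * f t).
Proof. intros H. apply bigO_mult with 0 p; [apply bigO_const|exact H|ring]. Qed.

Lemma cont_pos_gamma_int (c sg y al : R) : cont_pos (gamma_int c sg y al).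
Proof.
  unfold gamma_int. cont_pos_tac.
Qed.

Lemma bigO_gamma_int (c sg y al : R) : 0 < c -> bigO sg (gamma_int c sg y al).
Proof.
  intros Hc. unfold gamma_int. apply bigO_plus.
  - apply bigO_scal. apply bigO_mult with sg 0; [apply bigO_cpow|apply bigO_exp_lin, Hc|ring].
  - apply bigO_mult with (sg + 2) (- 2); [|apply bigO_inv_sqr|ring].
    apply bigO_scal. apply bigO_mult with (- sg) (2 * sg + 2); [apply bigO_cpow|apply bigO_exp_inv, Hc|ring].
Qed.

Lemma ex_RInt_gamma_int (c sg y al : R) : 0 < c -> 0 < sg -> ex_RInt (gamma_int c sg y al) 0 1.
Proof.
  intros Hc Hs. apply ex_RInt_bigO with sg; [exact Hs|apply cont_pos_gamma_int|apply bigO_gamma_int, Hc].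
Qed.

(* Integration by parts: [s int t^(s-1) e^(-ct) = c int t^s e^(-ct)]. *)
Lemma mellin_exp_parts (c sg y al : R) : 0 < c -> 2 < sg ->
  sg * mellin_ph sg y al (fun t => exp (- c * t)) +
  y * mellin_ph sg y (al + PI / 2) (fun t => exp (- c * t)) = gamma_ph c sg y al.
Proof.
  intros Hc Hs.
  assert (Ha := admissible_exp c Hc).
  assert (E1 := ex_RInt_mellin_int sg y al _ Hs Ha).
  assert (E2 := ex_RInt_mellin_int sg y (al + PI / 2) _ Hs Ha).
  assert (E3 := ex_RInt_gamma_int c sg y al Hc ltac:(lra)).
  set (g := fun t => exp (- c * t)) in *.
  set (v' := fun t => sg * mellin_int sg y al g t + y * mellin_int sg y (al + PI / 2) g t - gamma_int c sg y al t).
  assert (R0 : RInt v' 0 1 = 0).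
  (* The primitive joins [t^s e^(- c t)] with its folded counterpart [t^(- s) e^(- c / t)], negative
     because folding reverses the orientation; the two cancel at [t = 1]. *)
  { rewrite (FTC_01 (fun t => cpow sg y al t * exp (- c * t) - cpow (- sg) (- y) al t * exp (- c / t)) v').
    - unfold cpow. rewrite ln_1, !Rmult_0_r, exp_0. unfold Rdiv. rewrite Rinv_1. apply Rminus_diag.
    - intros t Ht. unfold v', mellin_int, gamma_int, g, cpow.
      rewrite <- !(Rplus_assoc _ al (PI / 2)).
      rewrite !(cos_plus _ (PI / 2)), cos_PI2, sin_PI2.
      replace (- c * / t) with (- c / t) by reflexivity.
      auto_derive; [repeat split; lra|]. unfold Rdiv. field. lra.
    - apply bigO_weaken with sg; [lra|]. apply bigO_minus.
      + apply bigO_mult with sg 0; [apply bigO_cpow|apply bigO_exp_lin, Hc|ring].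
      + apply bigO_mult with (- sg) (2 * sg); [apply bigO_cpow|apply bigO_exp_inv, Hc|ring].
    - destruct Ha as [Ha1 _]. assert (Hi := cont_pos_comp_inv g Ha1).
      unfold v', mellin_int, gamma_int. cont_pos_tac.
    - apply bigO_weaken with (sg - 1); [lra|].
      assert (Hm : forall al, bigO (sg - 1) (mellin_int sg y al g)).
      { intros al0. unfold mellin_int. apply bigO_plus.
        - apply bigO_mult with (sg - 1) 0; [|apply bigO_exp_lin, Hc|ring].
          apply bigO_mult with sg (- 1); [apply bigO_cpow|apply bigO_inv|ring].
        - apply bigO_mult with (- sg - 1) (2 * sg); [|apply bigO_exp_inv, Hc|ring].
          apply bigO_mult with (- sg) (- 1); [apply bigO_cpow|apply bigO_inv|ring]. }
      unfold v'. apply bigO_minus; [apply bigO_plus; apply bigO_scal, Hm|].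
      apply bigO_weaken with sg; [lra|apply bigO_gamma_int, Hc]. }
  unfold mellin_ph, gamma_ph. unfold v' in R0.
  assert (E4 := ex_RInt_Rscal sg _ _ _ E1).
  assert (E5 := ex_RInt_Rscal y _ _ _ E2).
  assert (E6 := ex_RInt_Rplus _ _ _ _ E4 E5).
  rewrite (RInt_Rminus (fun t => sg * mellin_int sg y al g t + y * mellin_int sg y (al + PI / 2) g t)
    (gamma_int c sg y al)), (RInt_Rplus (fun t => sg * mellin_int sg y al g t)
    (fun t => y * mellin_int sg y (al + PI / 2) g t)), !RInt_Rscal in R0 by assumption.
  lra.
Qed.

(** The substitution [t -> l t] in [c int t^s e^(- c t) dt]. The resulting factor [l^(- s)] has
    modulus [exp (- sg * ln l)] and turns the phase by [- y * ln l]. *)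
Lemma gamma_ph_scaling (c l sg y al : R) : 0 < c -> 0 < l -> 2 < sg ->
  gamma_ph (c * l) sg y al = exp (- sg * ln l) * gamma_ph c sg y (al - y * ln l).
Proof.
  intros Hc Hl Hs.
  set (al' := al - y * ln l).
  set (f := fun t => c * (cpow sg y al' t * exp (- c * t))).
  assert (Hf : cont_pos f).
  { unfold f. cont_pos_tac. }
  assert (Hqf : forall t, 0 < t -> gamma_int c sg y al' t = f t + f (/ t) * / t ^ 2).
  { intros t Ht. unfold f, gamma_int. rewrite cpow_inv by exact Ht. reflexivity. }
  assert (S := mellin_scaling f l Hl Hf).
  unfold gamma_ph at 2. rewrite (RInt_01_ext (gamma_int c sg y al') (fun t => f t + f (/ t) * / t ^ 2))
    by (intros t Ht; apply Hqf; lra).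
  rewrite <- S.
  - assert (Hx : RInt (gamma_int (c * l) sg y al) 0 1 =
      RInt (fun t => exp (- sg * ln l) * (l * f (l * t) + l * f (l / t) * / t ^ 2)) 0 1).
    { apply RInt_01_ext. intros t Ht. unfold f, gamma_int.
      assert (Hi : 0 < / t) by (apply Rinv_0_lt_compat; lra).
      unfold Rdiv. rewrite !cpow_scal by lra. rewrite cpow_inv by lra.
      replace (al' + y * ln l) with al by (unfold al'; ring).
      replace (- (c * l) * t) with (- c * (l * t)) by ring.
      replace (- (c * l) * / t) with (- c * (l * / t)) by ring.
      assert (Ee : exp (- sg * ln l) * exp (sg * ln l) = 1).
      { rewrite <- exp_plus. replace (- sg * ln l + sg * ln l) with 0 by ring. apply exp_0. }
      set (e1 := exp (- sg * ln l)) in *. set (e2 := exp (sg * ln l)) in *.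
      real_eq.
      match goal with |- ?L = _ => transitivity ((e1 * e2) * L); [rewrite Ee|]; ring end. }
    unfold gamma_ph. rewrite Hx. apply RInt_Rscal.
    assert (Hs0 := ex_RInt_gamma_int (c * l) sg y al ltac:(nra) ltac:(lra)).
    apply ex_RInt_ext with (fun t => exp (sg * ln l) * gamma_int (c * l) sg y al t).
    + rewrite Rmin_left, Rmax_right by lra. intros t Ht. unfold f, gamma_int.
      assert (Hi : 0 < / t) by (apply Rinv_0_lt_compat; lra).
      unfold Rdiv. rewrite !cpow_scal by lra. rewrite cpow_inv by lra.
      replace (al' + y * ln l) with al by (unfold al'; ring).
      replace (- (c * l) * t) with (- c * (l * t)) by ring.
      replace (- (c * l) * / t) with (- c * (l * / t)) by ring.
      real_eq. ring.
    + apply ex_RInt_Rscal, Hs0.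
  - unfold f. apply bigO_weaken with sg; [lra|]. apply bigO_scal.
    apply bigO_mult with sg 0; [apply bigO_cpow|apply bigO_exp_lin, Hc|ring].
  - apply bigO_ext with (fun t => c * (cpow (- sg) (- y) al' t * exp (- c / t)) * / t ^ 2).
    { intros t Ht. unfold f. rewrite cpow_inv by lra. reflexivity. }
    apply bigO_mult with 3 (- 2); [|apply bigO_inv_sqr|ring].
    apply bigO_scal. apply bigO_mult with (- sg) (sg + 3); [apply bigO_cpow|apply bigO_exp_inv, Hc|ring].
Qed.

Lemma gamma_ph_phase (c sg y al : R) : 0 < c -> 0 < sg ->
  gamma_ph c sg y al = cos al * gamma_ph c sg y 0 - sin al * gamma_ph c sg y (- (PI / 2)).
Proof.
  intros Hc Hs. unfold gamma_ph.
  assert (E1 := ex_RInt_gamma_int c sg y 0 Hc Hs).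
  assert (E2 := ex_RInt_gamma_int c sg y (- (PI / 2)) Hc Hs).
  rewrite <- (RInt_Rscal (cos al)), <- (RInt_Rscal (sin al)) by assumption.
  rewrite <- (RInt_Rminus (fun t => cos al * gamma_int c sg y 0 t)
    (fun t => sin al * gamma_int c sg y (- (PI / 2)) t)) by (apply ex_RInt_Rscal; assumption).
  apply RInt_01_ext. intros t _. unfold gamma_int.
  rewrite (cpow_phase sg y al), (cpow_phase (- sg) (- y) al). ring.
Qed.

Lemma mellin_ph_phase_opp (sg y al : R) (g : R -> R) : 2 < sg -> admissible g ->
  mellin_ph sg y (al + PI) g = - mellin_ph sg y al g.
Proof.
  intros Hs Hg. unfold mellin_ph.
  replace (- RInt (mellin_int sg y al g) 0 1) with (-1 * RInt (mellin_int sg y al g) 0 1) by ring.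
  rewrite <- RInt_Rscal by (apply ex_RInt_mellin_int; assumption).
  apply RInt_01_ext. intros t _. unfold mellin_int, cpow.
  rewrite <- !(Rplus_assoc _ al PI), !neg_cos. ring.
Qed.

Definition gamma_c (c : R) (s : C) : C := (gamma_ph c (Re s) (Im s) 0, gamma_ph c (Re s) (Im s) (- (PI / 2))).

(** Both sides equal [s Gamma(s) (c l)^(- s)], the left one by scaling and the right one by parts.
    Products are kept, so that nothing has to be divided by [s] or [Gamma(s)]. *)
Lemma mellin_exp (c l : R) (s : C) : 0 < c -> 0 < l -> 2 < Re s ->
  (Rcpow l (- s) * gamma_c c s = s * mellin s (fun t => exp (- (c * l) * t)))%C.
Proof.
  destruct s as [sg y]. unfold Re, Im; simpl fst; simpl snd. intros Hc Hl Hs.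
  assert (Hcl : 0 < c * l) by nra.
  assert (Ha := admissible_exp (c * l) Hcl).
  assert (P1 := mellin_exp_parts (c * l) sg y 0 Hcl Hs).
  assert (P2 := mellin_exp_parts (c * l) sg y (- (PI / 2)) Hcl Hs).
  rewrite gamma_ph_scaling in P1, P2 by assumption.
  rewrite gamma_ph_phase in P1, P2 by lra.
  replace (0 + PI / 2) with (- (PI / 2) + PI) in P1 by field.
  rewrite mellin_ph_phase_opp in P1 by assumption.
  replace (- (PI / 2) + PI / 2) with 0 in P2 by field.
  replace (0 - y * ln l) with (- y * ln l) in P1 by ring.
  rewrite cos_minus, sin_minus, cos_neg, sin_neg, cos_PI2, sin_PI2 in P2.
  unfold Rcpow, gamma_c, mellin, Cmult, Copp, RtoC, Re, Im, Rpower; simpl fst; simpl snd.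
  replace (- y * ln l) with (- (y * ln l)) in * by ring.
  rewrite cos_neg, sin_neg in *.
  f_equal; lra.
Qed.

(** * The Epstein series *)

Definition norm2 (D : R) (p : Z * Z) : R := IZR (fst p) ^ 2 + D ^ 2 * IZR (snd p) ^ 2.

Lemma norm2_pos (D : R) (p : Z * Z) : 0 < D -> p <> (0%Z, 0%Z) -> 0 < norm2 D p.
Proof.
  intros HD Hp. destruct p as [j k]. unfold norm2; simpl fst; simpl snd.
  assert (HD2 : 0 < D ^ 2) by (apply pow_lt, HD).
  assert (H1 := pow2_ge_0 (IZR j)). assert (H2 := pow2_ge_0 (IZR k)).
  destruct (Z.eq_dec j 0) as [->|Hj].
  - destruct (Z.eq_dec k 0) as [->|Hk]; [congruence|].
    assert (0 < IZR k ^ 2) by (apply not_0_IZR in Hk; apply pow2_gt_0, Hk). nra.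
  - assert (0 < IZR j ^ 2) by (apply not_0_IZR in Hj; apply pow2_gt_0, Hj). nra.
Qed.

Definition lsum {A : Type} (g : A -> R) (l : list A) : R := fold_right (fun a r => g a + r) 0 l.

Lemma lsum_app {A : Type} (g : A -> R) (l l' : list A) : lsum g (l ++ l') = lsum g l + lsum g l'.
Proof. induction l as [|a l IH]; simpl; [|rewrite IH]; ring. Qed.

Lemma lsum_map_pair {A B : Type} (g : A -> R) (h : B -> R) (a : A) (l : list B) :
  lsum (fun p => g (fst p) * h (snd p)) (map (fun y => (a, y)) l) = g a * lsum h l.
Proof. induction l as [|b l IH]; simpl; [|rewrite IH; simpl]; ring. Qed.

Lemma lsum_list_prod {A B : Type} (g : A -> R) (h : B -> R) (l : list A) (l' : list B) :
  lsum (fun p => g (fst p) * h (snd p)) (list_prod l l') = lsum g l * lsum h l'.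
Proof.
  induction l as [|a l IH]; simpl; [ring|].
  rewrite lsum_app, IH, lsum_map_pair. ring.
Qed.

(** With the weight [PI / D] the exponent is [PI (j^2 t / D + k^2 t D)], so that over a square the
    sum factors into partial sums of the two thetas. *)
Definition exp_sum (D : R) (F : list (Z * Z)) (t : R) : R :=
  lsum (fun p => exp (- (PI / D * norm2 D p) * t)) F.

Lemma mellin_list (D : R) (s : C) (F : list (Z * Z)) : 0 < D -> 2 < Re s ->
  List.Forall (fun p => p <> (0%Z, 0%Z)) F ->
  admissible (exp_sum D F) /\
  (fold_right Cplus (RtoC 0) (map (zeta2_term D s) F) * gamma_c (PI / D) s = s * mellin s (exp_sum D F))%C.
Proof.
  intros HD Hs HF.
  assert (Hc : 0 < PI / D) by (apply Rdiv_lt_0_compat; [apply PI_RGT_0|exact HD]).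
  induction HF as [|p F Hp HF [IHa IH]].
  - split; [exact admissible_0|]. change (exp_sum D nil) with (fun _ : R => 0). rewrite mellin_0. simpl. ring.
  - assert (Hl := norm2_pos D p HD Hp).
    assert (Ha : admissible (fun t => exp (- (PI / D * norm2 D p) * t))).
    { apply admissible_exp. apply Rmult_lt_0_compat; assumption. }
    split.
    + apply (admissible_plus _ (exp_sum D F)); assumption.
    + change (exp_sum D (p :: F)) with
        (fun t => exp (- (PI / D * norm2 D p) * t) + exp_sum D F t).
      rewrite mellin_plus by assumption. simpl fold_right.
      rewrite Cmult_plus_distr_r, IH, Cmult_plus_distr_l. f_equal.
      apply mellin_exp; assumption.
Qed.

Fixpoint Z_nonzero (N : nat) : list Z :=
  match N with
  | O => nil
  | S M => Z.of_nat N :: (- Z.of_nat N)%Z :: Z_nonzero M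
  end.

Definition Z_range (N : nat) : list Z := 0%Z :: Z_nonzero N.

(** The square [|j|, |k| <= N] without the origin, split at [j = 0] so that both pieces are
    products. *)
Definition box (N : nat) : list (Z * Z) := list_prod (Z_nonzero N) (Z_range N) ++ list_prod (0%Z :: nil) (Z_nonzero N).

Lemma In_Z_nonzero (N : nat) (z : Z) : In z (Z_nonzero N) <-> z <> 0%Z /\ (Z.abs z <= Z.of_nat N)%Z.
Proof.
  induction N as [|N IH]; [simpl; lia|].
  cbn [Z_nonzero In]. rewrite IH. lia.
Qed.

Lemma NoDup_Z_nonzero (N : nat) : NoDup (Z_nonzero N).
Proof.
  induction N as [|N IH]; [constructor|]. cbn [Z_nonzero].
  constructor; [|constructor; [|exact IH]]; cbn [In]; rewrite In_Z_nonzero; lia.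
Qed.

Lemma NoDup_Z_range (N : nat) : NoDup (Z_range N).
Proof. constructor; [rewrite In_Z_nonzero; lia|apply NoDup_Z_nonzero]. Qed.

Lemma In_box (N : nat) (j k : Z) : In (j, k) (box N) <->
  (j, k) <> (0%Z, 0%Z) /\ (Z.abs j <= Z.of_nat N)%Z /\ (Z.abs k <= Z.of_nat N)%Z.
Proof.
  unfold box. rewrite in_app_iff, !in_prod_iff. unfold Z_range. cbn [In]. rewrite !In_Z_nonzero.
  split.
  - intros H. split; [intros E; injection E; lia|lia].
  - intros [H1 H2]. assert (~ (j = 0 /\ k = 0)%Z) by (intros [-> ->]; apply H1; reflexivity). lia.
Qed.

Lemma NoDup_list_prod {A B : Type} (l : list A) (l' : list B) :
  NoDup l -> NoDup l' -> NoDup (list_prod l l').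
Proof.
  intros Hl Hl'. induction Hl as [|a l Ha Hl IH]; [constructor|]. cbn [list_prod].
  apply NoDup_app; [|exact IH|].
  - apply FinFun.Injective_map_NoDup; [|exact Hl']. intros x y E. injection E. auto.
  - intros [x y] H. apply in_map_iff in H. destruct H as [z [E _]]. injection E. intros _ <-.
    rewrite in_prod_iff. tauto.
Qed.

Lemma NoDup_box (N : nat) : NoDup (box N).
Proof.
  apply NoDup_app.
  - apply NoDup_list_prod; [apply NoDup_Z_nonzero|apply NoDup_Z_range].
  - apply NoDup_list_prod; [repeat constructor; intros []|apply NoDup_Z_nonzero].
  - intros [j k]. rewrite !in_prod_iff, !In_Z_nonzero. cbn [In]. lia.
Qed.

Lemma Forall_box (N : nat) : List.Forall (fun p => p <> (0%Z, 0%Z)) (box N).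
Proof. apply Forall_forall. intros [j k] H. apply In_box in H. apply H. Qed.

Lemma incl_box (F : list (Z * Z)) : List.Forall (fun p => p <> (0%Z, 0%Z)) F ->
  exists N0, forall N, (N0 <= N)%nat -> incl F (box N).
Proof.
  induction 1 as [|[j k] F Hp _ [N0 IH]].
  - exists O. intros N _ p [].
  - exists (max N0 (max (Z.to_nat (Z.abs j)) (Z.to_nat (Z.abs k)))). intros N HN p [<-|Hp'].
    + apply In_box. split; [exact Hp|]. lia.
    + apply IH; [lia|exact Hp'].
Qed.

Definition theta_partial (N : nat) (x : R) : R := dsum (fun k => exp (- (PI * x * INR k ^ 2))) N.

Lemma lsum_Z_nonzero (x : R) (N : nat) :
  lsum (fun j => exp (- (PI * x * IZR j ^ 2))) (Z_range N) = theta_partial N x.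
Proof.
  unfold Z_range, theta_partial. cbn [lsum fold_right].
  induction N as [|N IH]; [simpl; ring|].
  cbn [dsum Z_nonzero]. rewrite <- IH. cbn [fold_right].
  rewrite opp_IZR, <- INR_IZR_INZ.
  replace ((- INR (S N)) ^ 2) with (INR (S N) ^ 2) by ring. ring.
Qed.

Lemma exp_sum_box (D t : R) (N : nat) : 0 < D ->
  exp_sum D (box N) t = theta_partial N (t / D) * theta_partial N (t * D) - 1.
Proof.
  intros HD. unfold exp_sum, box. rewrite lsum_app.
  set (A := fun j : Z => exp (- (PI * (t / D) * IZR j ^ 2))).
  set (B := fun k : Z => exp (- (PI * (t * D) * IZR k ^ 2))).
  assert (E : forall l, lsum (fun p => exp (- (PI / D * norm2 D p) * t)) l =
    lsum (fun p => A (fst p) * B (snd p)) l).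
  { induction l as [|p l IH]; [reflexivity|]. cbn [lsum fold_right] in *. f_equal; [|exact IH].
    unfold A, B. rewrite <- exp_plus. f_equal. unfold norm2. field. lra. }
  assert (E2 : forall x, lsum (fun j => exp (- (PI * x * IZR j ^ 2))) (Z_nonzero N) = theta_partial N x - 1).
  { intros x. rewrite <- lsum_Z_nonzero. unfold Z_range. cbn [lsum fold_right].
    replace (- (PI * x * 0 ^ 2)) with 0 by ring. rewrite exp_0. unfold lsum. ring. }
  rewrite !E, !lsum_list_prod.
  unfold A, B. rewrite lsum_Z_nonzero, !E2. cbn [lsum fold_right].
  replace (- (PI * (t / D) * 0 ^ 2)) with 0 by ring. rewrite exp_0. ring.
Qed.

(** The common rate of convergence: [theta_tail] bounds every truncation error by it, with an
    explicit power of [x] as factor. *)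
Definition inv_sqr_tail (N : nat) : R :=
  Series (fun n => / INR (S n) ^ 2) - sum_n (fun n => / INR (S n) ^ 2) N.

Lemma is_lim_seq_inv_sqr_tail : is_lim_seq inv_sqr_tail 0.
Proof.
  set (Z := Series (fun n => / INR (S n) ^ 2)).
  replace (Finite 0) with (Finite (Z - Z)) by (f_equal; ring).
  apply is_lim_seq_minus'; [apply is_lim_seq_const|].
  exact (Series_correct _ ex_series_inv_sqr).
Qed.

Lemma theta_tail (p N : nat) (x : R) : 0 < x -> (1 <= p)%nat ->
  0 <= theta x - theta_partial (S N) x <= 2 * INR p ^ p * inv_sqr_tail N / x ^ p.
Proof.
  intros Hx Hp. unfold theta_partial. rewrite dsum_sum_n. unfold theta, dseries.
  set (f := fun k => exp (- (PI * x * INR (S k) ^ 2))).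
  assert (Hxp : 0 < x ^ p) by (apply pow_lt, Hx).
  assert (T : Series f - sum_n f N <= INR p ^ p / x ^ p * inv_sqr_tail N).
  { unfold inv_sqr_tail. rewrite Rmult_minus_distr_l, <- Series_scal_l.
    replace (INR p ^ p / x ^ p * sum_n (fun n => / INR (S n) ^ 2) N) with
      (sum_n (fun n => INR p ^ p / x ^ p * / INR (S n) ^ 2) N)
      by (exact (sum_n_mult_l (INR p ^ p / x ^ p) (fun n => / INR (S n) ^ 2) N)).
    eapply Rle_trans; [apply Rle_abs|]. apply Series_tail_le.
    - intros k. generalize (theta_term_bound 0 p k x Hx ltac:(lia)). unfold theta_term, f.
      rewrite pow_O, Rmult_1_l. auto.
    - apply ex_series_Rscal, ex_series_inv_sqr. }
  assert (T0 : 0 <= Series f - sum_n f N).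
  { assert (Ef : ex_series f) by (apply ex_series_theta, Hx).
    rewrite (Series_incr_n f (S N)) by (lia || exact Ef). simpl pred. rewrite <- sum_n_Reals.
    replace (sum_n f N + Series (fun k => f (S N + k)%nat) - sum_n f N)
      with (Series (fun k => f (S N + k)%nat)) by ring.
    apply Series_ge0; [intros; left; apply exp_pos|]. apply (ex_series_incr_n f), Ef. }
  split; [lra|].
  replace (2 * INR p ^ p * inv_sqr_tail N / x ^ p) with (2 * (INR p ^ p / x ^ p * inv_sqr_tail N)) by (field; lra).
  lra.
Qed.

(** The limit of [exp_sum] over the boxes; the origin accounts for the 1 subtracted. *)
Definition thetaM (D t : R) : R := theta (t / D) * theta (t * D) - 1.

Lemma thetaM_Kern (D t : R) : thetaM D t = Kern D t + / t - 1.
Proof. unfold thetaM, Kern, Rdiv. ring. Qed.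

(** At [/ t] the thetas have the inverted arguments of [Kern_dual]. This expresses the folded part
    of the Mellin integral by [Kern] as well. *)
Lemma thetaM_inv (D t : R) : 0 < D -> 0 < t -> thetaM D (/ t) = t * Kern D t.
Proof.
  intros HD Ht. rewrite Kern_dual by assumption. unfold thetaM, thA, thB.
  rewrite !theta_theta_der. replace (/ t / D) with (/ (D * t)) by (field; lra).
  replace (/ t * D) with (D / t) by (field; lra). field. lra.
Qed.

Lemma admissible_thetaM (D : R) : 0 < D -> admissible (thetaM D).
Proof.
  intros HD. split; [|split].
  - assert (H : cont_pos (fun t => Kern D t + / t - 1)) by cont_pos_tac.
    intros t Ht. apply continuous_ext with (2 := H t Ht). intros s. symmetry. apply thetaM_Kern.
  - apply bigO_ext with (fun t => Kern D t + / t - 1); [intros; symmetry; apply thetaM_Kern|].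
    apply bigO_minus; [apply bigO_plus|].
    + apply bigO_Kern, HD.
    + apply bigO_inv.
    + apply bigO_weaken with 0; [lra|apply bigO_const].
  - intros p. apply bigO_ext with (fun t => t * Kern D t).
    + intros t Ht. symmetry. apply thetaM_inv; lra.
    + apply bigO_mult with 0 p; [|apply bigO_Kern, HD|ring].
      apply bigO_0_bounded with 1. intros t Ht. rewrite Rabs_pos_eq; lra.
Qed.

Lemma theta_partial_ge0 (N : nat) (x : R) : 0 <= theta_partial N x.
Proof.
  unfold theta_partial. induction N as [|N IH]; cbn [dsum]; [left; apply exp_pos|].
  generalize (exp_pos (- (PI * x * INR (S N) ^ 2))). lra.
Qed.

Lemma theta_le : exists C, 0 < C /\ forall x, 0 < x -> 0 < theta x <= 1 + C / x.
Proof.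
  destruct (theta_der_bound 0 1 ltac:(lia)) as [C [HC H]]. exists (2 * C). split; [lra|].
  intros x Hx. split; [apply theta_pos, Hx|]. rewrite theta_theta_der.
  generalize (H x Hx) (Rle_abs (theta_der 0 x)). rewrite pow_1. unfold Rdiv. intros. lra.
Qed.

Lemma inv_sqr_tail_ge0 (N : nat) : 0 <= inv_sqr_tail N.
Proof.
  generalize (proj1 (theta_tail 1 N 1 Rlt_0_1 ltac:(lia))) (proj2 (theta_tail 1 N 1 Rlt_0_1 ltac:(lia))).
  simpl. intros. lra.
Qed.

Lemma theta_prod_tail (N : nat) (x y e1 e2 b1 b2 : R) : 0 < x -> 0 < y ->
  theta x - theta_partial (S N) x <= e1 -> theta y - theta_partial (S N) y <= e2 ->
  theta x <= b1 -> theta y <= b2 ->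
  Rabs (theta x * theta y - theta_partial (S N) x * theta_partial (S N) y) <= e1 * b2 + b1 * e2.
Proof.
  intros Hx Hy H1 H2 H3 H4.
  assert (P1 := proj1 (theta_tail 1 N x Hx ltac:(lia))).
  assert (P2 := proj1 (theta_tail 1 N y Hy ltac:(lia))).
  assert (Q1 := theta_partial_ge0 (S N) x). assert (Q2 := theta_partial_ge0 (S N) y).
  replace (theta x * theta y - theta_partial (S N) x * theta_partial (S N) y) with
    ((theta x - theta_partial (S N) x) * theta y + theta_partial (S N) x * (theta y - theta_partial (S N) y)) by ring.
  rewrite Rabs_pos_eq by nra.
  apply Rplus_le_compat; apply Rmult_le_compat; lra.
Qed.

(* [thetaM] minus its truncation, which is uniformly small both on [0, 1] and,
   through the inversion, on [1, oo). *)
Lemma thetaM_tail (D : R) (p : nat) : 0 < D -> (1 <= p)%nat -> exists K, forall N t, 0 < t <= 1 ->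
  Rabs (thetaM D t - exp_sum D (box (S N)) t) <= K * inv_sqr_tail N / t ^ 2 /\
  Rabs (thetaM D (/ t) - exp_sum D (box (S N)) (/ t)) <= K * inv_sqr_tail N * t ^ p.
Proof.
  intros HD Hp. destruct theta_le as [C [HC Hth]].
  set (M := 2 * INR p ^ p).
  assert (HM : 0 <= M) by (unfold M; generalize (pow_le (INR p) p (pos_INR p)); lra).
  assert (HDp : 0 < D ^ p) by (apply pow_lt, HD).
  assert (Hi : 0 < / D) by (apply Rinv_0_lt_compat, HD).
  set (K1 := 2 * D * (1 + C / D) + (1 + C * D) * (2 / D)).
  set (K2 := M * D ^ p * (1 + C * / D) + (1 + C * D) * (M / D ^ p)).
  assert (HCD : 0 < C * D) by nra. assert (HCi : 0 < C / D) by (apply Rdiv_lt_0_compat; lra).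
  assert (HK1 : 0 <= K1).
  { unfold K1. assert (0 < 2 / D) by (apply Rdiv_lt_0_compat; lra). nra. }
  assert (HK2 : 0 <= K2).
  { unfold K2. assert (0 <= M / D ^ p) by (apply Rdiv_le_0_compat; lra).
    assert (0 <= M * D ^ p) by nra. unfold Rdiv in HCi. nra. }
  exists (K1 + K2). intros N t Ht. assert (Hz := inv_sqr_tail_ge0 N).
  assert (Hti : 0 < / t) by (apply Rinv_0_lt_compat; lra).
  assert (Hti1 : 1 <= / t) by (rewrite <- Rinv_1; apply Rinv_le_contravar; lra).
  assert (Htp : 0 < t ^ p) by (apply pow_lt; lra).
  assert (Hx1 : 0 < t / D) by (apply Rdiv_lt_0_compat; lra).
  assert (Hx2 : 0 < t * D) by (apply Rmult_lt_0_compat; lra).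
  assert (Hx3 : 0 < / t / D) by (apply Rdiv_lt_0_compat; lra).
  assert (Hx4 : 0 < / t * D) by (apply Rmult_lt_0_compat; lra).
  split.
  - rewrite exp_sum_box by exact HD. unfold thetaM.
    replace (theta (t / D) * theta (t * D) - 1 - (theta_partial (S N) (t / D) * theta_partial (S N) (t * D) - 1))
      with (theta (t / D) * theta (t * D) - theta_partial (S N) (t / D) * theta_partial (S N) (t * D)) by ring.
    eapply Rle_trans.
    (* Near 0 [theta_tail] is used with exponent 1, which costs a single [/ t]; the second half uses
       the exponent [p], which there produces decay. *)
    { apply theta_prod_tail with (e1 := 2 * D * inv_sqr_tail N * / t) (e2 := 2 / D * inv_sqr_tail N * / t)
        (b1 := (1 + C * D) * / t) (b2 := (1 + C / D) * / t); try assumption.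
      - eapply Rle_trans; [apply (theta_tail 1 N _ Hx1 ltac:(lia))|].
        simpl. apply Req_le. field. lra.
      - eapply Rle_trans; [apply (theta_tail 1 N _ Hx2 ltac:(lia))|].
        simpl. apply Req_le. field. lra.
      - eapply Rle_trans; [apply (Hth _ Hx1)|].
        replace (C / (t / D)) with (C * D * / t) by (field; lra). nra.
      - eapply Rle_trans; [apply (Hth _ Hx2)|].
        replace (C / (t * D)) with (C / D * / t) by (field; lra). nra. }
    apply Rle_trans with (K1 * inv_sqr_tail N / t ^ 2).
    + apply Req_le. unfold K1. field. lra.
    + unfold Rdiv. apply Rmult_le_compat_r; [left; apply Rinv_0_lt_compat, pow_lt; lra|].
      apply Rmult_le_compat_r; lra.
  - rewrite exp_sum_box by exact HD. unfold thetaM.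
    replace (theta (/ t / D) * theta (/ t * D) - 1 - (theta_partial (S N) (/ t / D) * theta_partial (S N) (/ t * D) - 1))
      with (theta (/ t / D) * theta (/ t * D) - theta_partial (S N) (/ t / D) * theta_partial (S N) (/ t * D)) by ring.
    eapply Rle_trans.
    { apply theta_prod_tail with (e1 := M * D ^ p * inv_sqr_tail N * t ^ p) (e2 := M / D ^ p * inv_sqr_tail N * t ^ p)
        (b1 := 1 + C * D) (b2 := 1 + C * / D); try assumption.
      - eapply Rle_trans; [apply (theta_tail p N _ Hx3 Hp)|].
        fold M. unfold Rdiv. rewrite !Rpow_mult_distr, !pow_inv. apply Req_le. field. split; lra.
      - eapply Rle_trans; [apply (theta_tail p N _ Hx4 Hp)|].
        fold M. unfold Rdiv. rewrite !Rpow_mult_distr, !pow_inv. apply Req_le. field. split; lra.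
      - eapply Rle_trans; [apply (Hth _ Hx3)|].
        replace (C / (/ t / D)) with (C * D * t) by (field; lra). nra.
      - eapply Rle_trans; [apply (Hth _ Hx4)|].
        replace (C / (/ t * D)) with (C / D * t) by (field; lra). unfold Rdiv in HCi |- *. nra. }
    apply Rle_trans with (K2 * inv_sqr_tail N * t ^ p).
    + apply Req_le. unfold K2. field. lra.
    + apply Rmult_le_compat_r; [lra|]. apply Rmult_le_compat_r; lra.
Qed.

Lemma cpow_abs_le (sg y al t : R) : Rabs (cpow sg y al t) <= exp (sg * ln t).
Proof.
  unfold cpow. rewrite Rabs_mult, Rabs_pos_eq by (left; apply exp_pos).
  rewrite <- (Rmult_1_r (exp (sg * ln t))) at 2.
  apply Rmult_le_compat_l; [left; apply exp_pos|]. apply Rabs_le, COS_bound.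
Qed.

(** The condition [3 < sg] pays for the [/ t] and the [/ t ^ 2] near 0; on the folded part, where
    the power is [t^(- sg)], the exponent [n + 1] with [sg <= n] does so. *)
Lemma mellin_ph_tail (D sg : R) : 0 < D -> 3 < sg -> exists K, forall N y al,
  Rabs (mellin_ph sg y al (thetaM D) - mellin_ph sg y al (exp_sum D (box (S N)))) <= K * inv_sqr_tail N.
Proof.
  intros HD Hs. destruct (nat_ge sg) as [n Hn].
  destruct (thetaM_tail D (n + 1) HD ltac:(lia)) as [K HK].
  exists (2 * K). intros N y al. assert (Hz := inv_sqr_tail_ge0 N).
  assert (A1 := admissible_thetaM D HD).
  assert (A2 : admissible (exp_sum D (box (S N)))).
  { apply (mellin_list D (RtoC 3) (box (S N)) HD); [simpl; lra|apply Forall_box]. }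
  assert (E1 := ex_RInt_mellin_int sg y al _ ltac:(lra) A1).
  assert (E2 := ex_RInt_mellin_int sg y al _ ltac:(lra) A2).
  unfold mellin_ph. rewrite <- RInt_Rminus by assumption.
  apply RInt_01_bound; [apply ex_RInt_Rminus; assumption|].
  intros t Ht. destruct (HK N t ltac:(lra)) as [H1 H2].
  unfold mellin_int. set (g := thetaM D) in *. set (h := exp_sum D (box (S N))) in *.
  replace (cpow sg y al t * / t * g t + cpow (- sg) (- y) al t * / t * g (/ t) -
    (cpow sg y al t * / t * h t + cpow (- sg) (- y) al t * / t * h (/ t))) with
    (cpow sg y al t * / t * (g t - h t) + cpow (- sg) (- y) al t * / t * (g (/ t) - h (/ t))) by ring.
  eapply Rle_trans; [apply Rabs_triang|]. rewrite !Rabs_mult.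
  assert (Hti : 0 < / t) by (apply Rinv_0_lt_compat; lra).
  rewrite (Rabs_pos_eq (/ t)) by lra.
  assert (Hl := ln_le_0 t ltac:(lra)).
  replace (2 * K * inv_sqr_tail N) with (K * inv_sqr_tail N + K * inv_sqr_tail N) by ring.
  apply Rplus_le_compat.
  - apply Rle_trans with (t ^ 3 * / t * (K * inv_sqr_tail N / t ^ 2)).
    + apply Rmult_le_compat; [|apply Rabs_pos| |exact H1].
      * apply Rmult_le_pos; [apply Rabs_pos|lra].
      * apply Rmult_le_compat_r; [lra|]. eapply Rle_trans; [apply cpow_abs_le|].
        rewrite <- (exp_ln_nat t 3) by lra. apply exp_le. simpl. nra.
    + apply Req_le. field. lra.
  - apply Rle_trans with (/ t ^ n * / t * (K * inv_sqr_tail N * t ^ (n + 1))).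
    + apply Rmult_le_compat; [|apply Rabs_pos| |exact H2].
      * apply Rmult_le_pos; [apply Rabs_pos|lra].
      * apply Rmult_le_compat_r; [lra|]. eapply Rle_trans; [apply cpow_abs_le|].
        rewrite <- (exp_ln_opp t n) by lra. apply exp_le. nra.
    + apply Req_le. rewrite pow_add. field. split; [lra|apply pow_nonzero; lra].
Qed.

Lemma Cmod_le_sum (z : C) : Cmod z <= Rabs (Re z) + Rabs (Im z).
Proof.
  destruct z as [a b]. unfold Cmod, Re, Im; simpl fst; simpl snd.
  assert (Ha := Rabs_pos a). assert (Hb := Rabs_pos b).
  rewrite <- (sqrt_pow2 (Rabs a + Rabs b)) by lra.
  apply sqrt_le_1_alt. rewrite <- (pow2_abs a), <- (pow2_abs b). nra.
Qed.

Lemma Cmod_small_eq (z : C) : (forall e : posreal, Cmod z <= e) -> z = RtoC 0.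
Proof.
  intros H. apply Cmod_eq_0. destruct (Rle_lt_or_eq_dec _ _ (Cmod_ge_0 z)) as [Hz|Hz]; [|auto].
  assert (Hz2 : 0 < Cmod z / 2) by lra. specialize (H (mkposreal _ Hz2)). simpl in H. lra.
Qed.

(** The unordered sum is evaluated along the boxes, which eventually contain any finite set of
    nonzero points and over which [mellin_list] and the tail bound apply. *)
Lemma mellin_zeta (D : R) (s l : C) : 0 < D -> 3 < Re s ->
  has_sum (fun p => p <> (0%Z, 0%Z)) (zeta2_term D s) l ->
  (l * gamma_c (PI / D) s = s * mellin s (thetaM D))%C.
Proof.
  intros HD Hs Hsum. destruct (mellin_ph_tail D (Re s) HD Hs) as [K HK].
  set (Q := gamma_c (PI / D) s). set (M := mellin s (thetaM D)).
  assert (E : (l * Q - s * M)%C = RtoC 0).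
  { apply Cmod_small_eq. intros e.
    assert (HQ := Cmod_ge_0 Q). assert (Hcs := Cmod_ge_0 s). assert (He := cond_pos e).
    assert (He1 : 0 < e / (2 * (Cmod Q + 1))) by (apply Rdiv_lt_0_compat; lra).
    destruct (Hsum (mkposreal _ He1)) as [F0 [HF0 HF]]. simpl in HF.
    destruct (incl_box F0 HF0) as [N0 HN0].
    assert (Hlim : is_lim_seq (fun N => Cmod s * (2 * (K * inv_sqr_tail N))) 0).
    { replace (Finite 0) with (Finite (Cmod s * (2 * (K * 0)))) by (f_equal; ring).
      repeat (apply is_lim_seq_mult'; [apply is_lim_seq_const|]). apply is_lim_seq_inv_sqr_tail. }
    apply is_lim_seq_spec in Hlim. assert (He2 : 0 < e / 2) by lra.
    destruct (Hlim (mkposreal _ He2)) as [N1 HN1]. cbn [pos] in HN1.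
    set (N := max N0 N1). specialize (HN1 N ltac:(lia)).
    rewrite Rminus_0_r in HN1. apply Rabs_def2 in HN1.
    specialize (HF (box (S N)) (NoDup_box _) (Forall_box _) (HN0 (S N) ltac:(lia))).
    destruct (mellin_list D s (box (S N)) HD ltac:(lra) (Forall_box _)) as [_ HL].
    set (lN := fold_right Cplus (RtoC 0) (map (zeta2_term D s) (box (S N)))) in *.
    set (MN := mellin s (exp_sum D (box (S N)))) in *. fold Q in HL.
    replace (l * Q - s * M)%C with (- ((lN - l) * Q) + s * (MN - M))%C.
    2: { replace (s * (MN - M))%C with (s * MN - s * M)%C by ring. rewrite <- HL. ring. }
    eapply Rle_trans; [apply Cmod_triangle|].
    rewrite Cmod_opp, !Cmod_mult.
    assert (B1 : Cmod (lN - l) * Cmod Q <= e / 2).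
    { apply Rle_trans with (e / (2 * (Cmod Q + 1)) * (Cmod Q + 1)).
      - apply Rmult_le_compat; try apply Cmod_ge_0; lra.
      - apply Req_le. field. lra. }
    assert (B2 : Cmod (MN - M) <= 2 * (K * inv_sqr_tail N)).
    { eapply Rle_trans; [apply Cmod_le_sum|].
      assert (K1 := HK N (Im s) 0). assert (K2 := HK N (Im s) (- (PI / 2))).
      rewrite Rabs_minus_sym in K1, K2. unfold MN, M, mellin, Re, Im in *. simpl in *. unfold Rminus in *. lra. }
    assert (B3 := Rmult_le_compat_l _ _ _ Hcs B2). lra. }
  replace (l * Q)%C with ((l * Q - s * M) + s * M)%C by ring. rewrite E. ring.
Qed.

(** The integrand [(t^(s - 1) + t^(- s)) Kern D t] of the entire part in Riemann's decomposition,
    symmetric under [s -> 1 - s] and integrable for every [s]. *)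
Definition J_int (D sg y al t : R) : R := (cpow (sg - 1) y al t + cpow (- sg) (- y) al t) * Kern D t.
Definition J_ph (D sg y al : R) : R := RInt (J_int D sg y al) 0 1.
Definition J_c (D : R) (s : C) : C := (J_ph D (Re s) (Im s) 0, J_ph D (Re s) (Im s) (- (PI / 2))).

Lemma cont_pos_J_int (D sg y al : R) : 0 < D -> cont_pos (J_int D sg y al).
Proof. intros HD. unfold J_int. cont_pos_tac. Qed.

Lemma bigO_J_int (D sg y al p : R) : 0 < D -> bigO p (J_int D sg y al).
Proof.
  intros HD. unfold J_int.
  apply bigO_mult with (Rmin (sg - 1) (- sg)) (p - Rmin (sg - 1) (- sg)); [|apply bigO_Kern, HD|ring].
  apply bigO_plus.
  - apply bigO_weaken with (sg - 1); [apply Rmin_l|apply bigO_cpow].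
  - apply bigO_weaken with (- sg); [apply Rmin_r|apply bigO_cpow].
Qed.

Lemma ex_RInt_J_int (D sg y al : R) : 0 < D -> ex_RInt (J_int D sg y al) 0 1.
Proof.
  intros HD. apply ex_RInt_bigO with 1; [lra|apply cont_pos_J_int, HD|apply bigO_J_int, HD].
Qed.

(* [1 / s], as [int_0^1 t^(s - 1) dt]. *)
Definition inv_ph (sg y al : R) : R := RInt (fun t => cpow sg y al t * / t) 0 1.
Definition inv_c (s : C) : C := (inv_ph (Re s) (Im s) 0, inv_ph (Re s) (Im s) (- (PI / 2))).

Lemma ex_RInt_inv_ph (sg y al : R) : 1 < sg -> ex_RInt (fun t => cpow sg y al t * / t) 0 1.
Proof.
  intros Hs. apply ex_RInt_bigO with (sg - 1); [lra| |].
  - cont_pos_tac.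
  - apply bigO_mult with sg (- 1); [apply bigO_cpow|apply bigO_inv|ring].
Qed.

Lemma inv_ph_parts (sg y al : R) : 2 < sg -> sg * inv_ph sg y al + y * inv_ph sg y (al + PI / 2) = cos al.
Proof.
  intros Hs. assert (E1 := ex_RInt_inv_ph sg y al ltac:(lra)).
  assert (E2 := ex_RInt_inv_ph sg y (al + PI / 2) ltac:(lra)).
  unfold inv_ph. rewrite <- !RInt_Rscal by assumption.
  rewrite <- (RInt_Rplus (fun t => sg * (cpow sg y al t * / t))
    (fun t => y * (cpow sg y (al + PI / 2) t * / t))) by (apply ex_RInt_Rscal; assumption).
  rewrite (FTC_01 (cpow sg y al)).
  - unfold cpow. rewrite ln_1, !Rmult_0_r, exp_0, Rmult_1_l, Rplus_0_l. reflexivity.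
  - intros t Ht. unfold cpow. rewrite <- !(Rplus_assoc _ al (PI / 2)).
    rewrite !(cos_plus _ (PI / 2)), cos_PI2, sin_PI2.
    auto_derive; [repeat split; lra|]. field. lra.
  - apply bigO_weaken with sg; [lra|apply bigO_cpow].
  - cont_pos_tac.
  - apply bigO_weaken with (sg - 1); [lra|].
    apply bigO_plus; apply bigO_scal; (apply bigO_mult with sg (- 1); [apply bigO_cpow|apply bigO_inv|ring]).
Qed.

Lemma inv_ph_phase_opp (sg y al : R) : 1 < sg -> inv_ph sg y (al + PI) = - inv_ph sg y al.
Proof.
  intros Hs. assert (E1 := ex_RInt_inv_ph sg y al Hs). unfold inv_ph.
  replace (- RInt (fun t => cpow sg y al t * / t) 0 1) with
    (-1 * RInt (fun t => cpow sg y al t * / t) 0 1) by ring.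
  rewrite <- RInt_Rscal by assumption. apply RInt_01_ext. intros t _. unfold cpow.
  rewrite <- (Rplus_assoc _ al PI), neg_cos.
  real_eq. ring.
Qed.

Lemma inv_c_inv (s : C) : 2 < Re s -> (s * inv_c s = RtoC 1)%C.
Proof.
  destruct s as [sg y]. unfold inv_c, Re, Im; simpl fst; simpl snd. intros Hs.
  assert (P1 := inv_ph_parts sg y 0 Hs). assert (P2 := inv_ph_parts sg y (- (PI / 2)) Hs).
  replace (0 + PI / 2) with (- (PI / 2) + PI) in P1 by field.
  rewrite inv_ph_phase_opp in P1 by lra.
  replace (- (PI / 2) + PI / 2) with 0 in P2 by field.
  rewrite cos_0 in P1. rewrite cos_neg, cos_PI2 in P2.
  unfold Cmult, RtoC; simpl. f_equal; lra.
Qed.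

(** On (0, 1] [thetaM] is [Kern + / t - 1], and the two elementary terms give [1 / (s - 1) - 1 / s];
    the folded part is [Kern] alone. *)
Lemma mellin_thetaM (D : R) (s : C) : 0 < D -> 3 < Re s ->
  mellin s (thetaM D) = (J_c D s + inv_c (s - 1) - inv_c s)%C.
Proof.
  destruct s as [sg y]. unfold Re; simpl fst. intros HD Hs.
  assert (H : forall al, mellin_ph sg y al (thetaM D) = J_ph D sg y al + inv_ph (sg - 1) y al - inv_ph sg y al).
  { intros al. assert (E1 := ex_RInt_J_int D sg y al HD).
    assert (E2 := ex_RInt_inv_ph (sg - 1) y al ltac:(lra)). assert (E3 := ex_RInt_inv_ph sg y al ltac:(lra)).
    unfold mellin_ph, J_ph, inv_ph.
    assert (E12 := ex_RInt_Rplus _ _ _ _ E1 E2).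
    rewrite <- (RInt_Rplus (J_int D sg y al) (fun t => cpow (sg - 1) y al t * / t)),
      <- (RInt_Rminus (fun t => J_int D sg y al t + cpow (sg - 1) y al t * / t)
           (fun t => cpow sg y al t * / t)) by assumption.
    apply RInt_01_ext. intros t Ht. unfold mellin_int, J_int.
    rewrite thetaM_inv, thetaM_Kern by lra.
    replace (cpow (sg - 1) y al t) with (cpow sg y al t * / t).
    2: { unfold cpow. rewrite Rmult_minus_distr_r. unfold Rminus. rewrite exp_plus, Rmult_1_l, exp_Ropp, exp_ln by lra.
         ring. }
    real_eq. field. lra. }
  unfold mellin, J_c, inv_c, Cplus, Cminus, Copp, RtoC, Re, Im; simpl.
  rewrite !H. rewrite Ropp_0, Rplus_0_r. unfold Rminus. reflexivity.
Qed.

(** Riemann's formula cleared of denominators. The 1 is what remains of the polar terms: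
    [s - (s - 1)]. In this form only products and differences have to be continued. *)
Lemma zeta2_mellin (D : R) (f : C -> C) (s : C) : 0 < D -> is_zeta2 D f -> 3 < Re s ->
  ((s - 1) * (2 * f s) * gamma_c (PI / D) s = 1 + s * (s - 1) * J_c D s)%C.
Proof.
  intros HD [_ Hf] Hs. destruct (Hf s ltac:(lra)) as [l [Hl ->]].
  replace (2 * (RtoC (1 / 2) * l))%C with l.
  2: { replace (RtoC 2) with (RtoC 2 * RtoC 1)%C by ring.
       replace (RtoC (1 / 2)) with (/ RtoC 2)%C by (rewrite <- RtoC_inv; f_equal; lra).
       field. }
  assert (E := mellin_zeta D s l HD Hs Hl). rewrite mellin_thetaM in E by assumption.
  assert (I1 := inv_c_inv s ltac:(lra)).
  assert (I2 := inv_c_inv (s - 1)).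
  replace ((s - 1) * l * gamma_c (PI / D) s)%C with ((s - 1) * (l * gamma_c (PI / D) s))%C by ring.
  rewrite E.
  replace ((s - 1) * (s * (J_c D s + inv_c (s - 1) - inv_c s)))%C with
    (s * (s - 1) * J_c D s + s * ((s - 1) * inv_c (s - 1)) - (s - 1) * (s * inv_c s))%C by ring.
  rewrite I1, I2; [ring|]. destruct s as [sg y]. unfold Re in *. simpl in *. lra.
Qed.

(** * Real analytic functions *)

Lemma sum_n_RS (a : nat -> R) (n : nat) : sum_n a (S n) = sum_n a n + a (S n).
Proof. exact (sum_Sn a n). Qed.

Definition ranalytic (f : R -> R) (x : R) : Prop :=
  exists (a : nat -> R) (r : R), 0 < r /\ forall h, Rabs h < r -> is_pseries a h (f (x + h)).

Lemma is_pseries_lt_radius (a : nat -> R) (r : R) (f : R -> R) :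
  (forall h, Rabs h < r -> is_pseries a h (f h)) ->
  forall h, Rabs h < r -> Rbar_lt (Rabs h) (CV_radius a).
Proof.
  intros H h Hh. set (h' := (Rabs h + r) / 2).
  assert (Hp := Rabs_pos h).
  assert (Hh' : Rabs h < h' < r) by (unfold h'; lra).
  apply Rbar_lt_le_trans with h'; [exact (proj1 Hh')|].
  apply Rbar_not_lt_le. intros Hlt.
  apply (CV_disk_outside a h').
  - rewrite Rabs_pos_eq by lra. exact Hlt.
  - assert (E : is_pseries a h' (f h')) by (apply H; rewrite Rabs_pos_eq; lra).
    apply is_pseries_R in E. apply (ex_series_lim_0 (fun n => a n * h' ^ n)).
    exists (f h'). exact E.
Qed.

Lemma ranalytic_ext_loc (f g : R -> R) (x r : R) : 0 < r ->
  (forall h, Rabs h < r -> f (x + h) = g (x + h)) -> ranalytic f x -> ranalytic g x.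
Proof.
  intros Hr E [a [r' [Hr' H]]]. exists a, (Rmin r r'). split; [apply Rmin_pos; assumption|].
  intros h Hh. rewrite <- E.
  - apply H. eapply Rlt_le_trans; [exact Hh|apply Rmin_r].
  - eapply Rlt_le_trans; [exact Hh|apply Rmin_l].
Qed.

Lemma ranalytic_plus (f g : R -> R) (x : R) :
  ranalytic f x -> ranalytic g x -> ranalytic (fun x => f x + g x) x.
Proof.
  intros [a [r [Hr H]]] [b [r' [Hr' H']]].
  exists (PS_plus a b), (Rmin r r'). split; [apply Rmin_pos; assumption|].
  intros h Hh. apply (is_pseries_plus a b h (f (x + h)) (g (x + h))).
  - apply H. eapply Rlt_le_trans; [exact Hh|apply Rmin_l].
  - apply H'. eapply Rlt_le_trans; [exact Hh|apply Rmin_r].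
Qed.

Lemma ranalytic_mult (f g : R -> R) (x : R) :
  ranalytic f x -> ranalytic g x -> ranalytic (fun x => f x * g x) x.
Proof.
  intros [a [r [Hr H]]] [b [r' [Hr' H']]].
  exists (PS_mult a b), (Rmin r r'). split; [apply Rmin_pos; assumption|].
  intros h Hh.
  assert (H1 : Rabs h < r) by (eapply Rlt_le_trans; [exact Hh|apply Rmin_l]).
  assert (H2 : Rabs h < r') by (eapply Rlt_le_trans; [exact Hh|apply Rmin_r]).
  apply is_pseries_mult; [apply H, H1|apply H', H2| |].
  - apply (is_pseries_lt_radius a r (fun h => f (x + h))); assumption.
  - apply (is_pseries_lt_radius b r' (fun h => g (x + h))); assumption.
Qed.

Lemma ranalytic_const (c x : R) : ranalytic (fun _ => c) x.
Proof.
  exists (fun n => match n with O => c | S _ => 0 end), 1. split; [lra|]. intros h _.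
  apply is_pseries_R.
  assert (E : forall N, sum_n (fun n => match n with O => c | S _ => 0 end * h ^ n) N = c).
  { induction N as [|N IH]; [rewrite sum_O; simpl; ring|].
    rewrite sum_Sn, IH. rewrite Rmult_0_l. apply Rplus_0_r. }
  change (is_lim_seq (sum_n (fun n => match n with O => c | S _ => 0 end * h ^ n)) c).
  apply is_lim_seq_ext with (fun _ => c); [intros; symmetry; apply E|apply is_lim_seq_const].
Qed.

Lemma ranalytic_id (x : R) : ranalytic (fun x => x) x.
Proof.
  exists (fun n => match n with O => x | 1%nat => 1 | _ => 0 end), 1. split; [lra|]. intros h _.
  apply is_pseries_R.
  set (u := fun n => match n with O => x | 1%nat => 1 | _ => 0 end * h ^ n).
  assert (E : forall N, sum_n u (S N) = x + h).
  { induction N as [|N IH].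
    - rewrite sum_Sn, sum_O. unfold u, plus; simpl. ring.
    - rewrite sum_Sn, IH. unfold u at 1. rewrite Rmult_0_l. apply Rplus_0_r. }
  change (is_lim_seq (sum_n u) (x + h)). apply is_lim_seq_incr_1.
  apply is_lim_seq_ext with (fun _ => x + h); [intros; symmetry; apply E|apply is_lim_seq_const].
Qed.

Lemma ranalytic_opp (f : R -> R) (x : R) : ranalytic f x -> ranalytic (fun x => - f x) x.
Proof.
  intros H. apply ranalytic_ext_loc with (r := 1) (f := fun x => -1 * f x); [lra|intros; ring|].
  apply ranalytic_mult; [apply ranalytic_const|exact H].
Qed.

(** Continuity at 0 annihilates the constant coefficient; division by [h] shifts the series and the
    argument repeats. Only positive [h] are assumed because [ranalytic_identity] knows the zeros on
    one side. *)
Lemma PSeries_0_right (r : R) : 0 < r -> forall (n : nat) (a : nat -> R),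
  (forall h, 0 < h < r -> is_pseries a h 0) -> a n = 0.
Proof.
  intros Hr n.
  assert (H0 : forall a : nat -> R, (forall h, 0 < h < r -> is_pseries a h 0) -> a O = 0).
  { intros a H. destruct (Req_dec (a O) 0) as [E|E]; [exact E|exfalso].
    assert (HR : Rbar_lt (Rabs 0) (CV_radius a)).
    { rewrite Rabs_R0. apply Rbar_lt_le_trans with (r / 2); [simpl; lra|].
      apply Rbar_not_lt_le. intros Hlt.
      apply (CV_disk_outside a (r / 2)); [rewrite Rabs_pos_eq by lra; exact Hlt|].
      assert (Es := H (r / 2) ltac:(lra)). apply is_pseries_R in Es.
      apply (ex_series_lim_0 (fun n => a n * (r / 2) ^ n)). exists 0. exact Es. }
    assert (C := PSeries_continuity a 0 HR).
    assert (Ha : 0 < Rabs (a O)) by (apply Rabs_pos_lt, E).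
    destruct (C (Rabs (a O)) Ha) as [d [Hd Hx]].
    set (h := Rmin (d / 2) (r / 2)).
    assert (Hh : 0 < h) by (apply Rmin_pos; lra).
    assert (Hh1 := Rmin_l (d / 2) (r / 2)). assert (Hh2 := Rmin_r (d / 2) (r / 2)).
    fold h in Hh1, Hh2.
    specialize (Hx h). simpl in Hx. unfold R_dist in Hx.
    rewrite (is_pseries_unique a h 0) in Hx by (apply H; lra).
    rewrite PSeries_0, Rminus_0_l, Rabs_Ropp in Hx.
    assert (Rabs (a O) < Rabs (a O)); [|lra]. apply Hx. split.
    - split; [exact I|lra].
    - rewrite Rminus_0_r, Rabs_pos_eq; lra. }
  induction n as [|n IH]; intros a H; [apply H0, H|].
  change (a (S n)) with (PS_decr_1 a n). apply IH. intros h Hh.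
  assert (E := is_pseries_decr_1 a h (/ h) 0).
  replace 0 with (scal (/ h) (plus 0 (opp (a O)))).
  - apply E; [|apply H, Hh]. change (/ h * h = 1). field. lra.
  - rewrite (H0 a H). unfold scal, plus, opp; simpl. unfold mult; simpl. ring.
Qed.

(** Let [m] be the supremum of the points where [F] does not vanish. The expansion at [m] is zero to
    the right of [m], hence has zero coefficients, and so [F] vanishes on a full neighbourhood of
    [m]: a contradiction. *)
Lemma ranalytic_identity (F : R -> R) (b : R) : (forall x, 0 < x -> ranalytic F x) ->
  (forall x, b < x -> F x = 0) -> forall x, 0 < x -> F x = 0.
Proof.
  intros HA Hb x Hx. destruct (Req_dec (F x) 0) as [E|E]; [exact E|exfalso].
  set (S := fun z => 0 < z /\ F z <> 0).
  destruct (completeness S) as [m [Hm1 Hm2]].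
  - exists b. intros z [_ Hz]. destruct (Rle_lt_dec z b) as [H|H]; [exact H|].
    exfalso. apply Hz, Hb, H.
  - exists x. split; assumption.
  - assert (Hxm : x <= m) by (apply Hm1; split; assumption).
    destruct (HA m ltac:(lra)) as [a [r [Hr H]]].
    assert (Ha : forall n, a n = 0).
    { intros n. apply (PSeries_0_right r Hr). intros h Hh.
      assert (E0 : F (m + h) = 0).
      { destruct (Req_dec (F (m + h)) 0) as [E'|E']; [exact E'|].
        assert (m + h <= m) by (apply Hm1; split; [lra|exact E']). lra. }
      rewrite <- E0. apply H. rewrite Rabs_pos_eq; lra. }
    assert (Hr2 : m <= m - r).
    { apply Hm2. intros z Hz. destruct (Rle_lt_dec z (m - r)) as [H1|H1]; [exact H1|exfalso].
      assert (H2 := Hm1 z Hz). apply (proj2 Hz).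
      assert (P := H (z - m) ltac:(rewrite Rabs_left1; lra)).
      replace (m + (z - m)) with z in P by ring.
      rewrite <- (is_pseries_unique _ _ _ P). unfold PSeries.
      rewrite (Series_ext _ (fun k => 0 * 0)) by (intros n; rewrite Ha; ring).
      rewrite Series_scal_l. ring. }
    lra.
Qed.

Lemma ranalytic_continuous (f : R -> R) (x : R) : ranalytic f x -> continuous f x.
Proof.
  intros [a [r [Hr H]]].
  assert (HR : Rbar_lt (Rabs 0) (CV_radius a)).
  { apply (is_pseries_lt_radius a r (fun h => f (x + h)) H). rewrite Rabs_R0. exact Hr. }
  assert (C := PSeries_continuity a 0 HR). apply continuity_pt_filterlim in C.
  apply continuous_ext_loc with (fun z => PSeries a (z - x)).
  - exists (mkposreal _ Hr). intros z Hz. apply is_pseries_unique.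
    replace z with (x + (z - x)) at 2 by ring. apply H. exact Hz.
  - apply (continuous_comp (fun z => z - x) (PSeries a)).
    + apply continuous_Rminus; [apply continuous_id|apply continuous_const].
    + rewrite Rminus_diag. exact C.
Qed.

(* The exponential series of [t ^ (kappa h)] may be integrated termwise: near
   [x0] the remainder is absorbed by half of the decay at [t = 0]. *)
Lemma ranalytic_mellin (kappa p x0 : R) (w : R -> R) : cont_pos w -> bigO p w ->
  0 < kappa * x0 + p ->
  ranalytic (fun x => RInt (fun t => exp (kappa * x * ln t) * w t) 0 1) x0.
Proof.
  intros Hw Hb He. set (e := kappa * x0 + p) in *.
  set (g := fun t => exp (kappa * x0 * ln t) * w t).
  assert (Hg : cont_pos g) by (unfold g; cont_pos_tac).
  assert (Og : bigO e g).
  { unfold g. apply bigO_mult with (kappa * x0) p; [apply bigO_pow|exact Hb|reflexivity]. }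
  assert (Ek : forall k, ex_RInt (fun t => ln t ^ k * g t) 0 1).
  { intros k. apply ex_RInt_bigO with (e / 2); [lra|cont_pos_tac|].
    apply bigO_mult with (- (e / 2)) e; [apply bigO_ln; lra|exact Og|lra]. }
  set (a := fun n => kappa ^ n / INR (fact n) * RInt (fun t => ln t ^ n * g t) 0 1).
  assert (Hk : 0 < 2 * (Rabs kappa + 1)) by (generalize (Rabs_pos kappa); lra).
  (* This radius gives [2 * Rabs (kappa * h) < e], so that the factor [exp (2 |kappa h ln t|)] of
     the remainder is at most [t^(- e)] and is absorbed by [g]. *)
  exists a, (e / (2 * (Rabs kappa + 1))). split; [apply Rdiv_lt_0_compat; lra|].
  intros h Hh. apply Rlt_div_r in Hh; [|exact Hk].
  destruct Og as [C HC].
  set (T := fun N t => exp_taylor N (kappa * h * ln t) * g t).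
  assert (HT : forall N, ex_RInt (T N) 0 1 /\ RInt (T N) 0 1 = sum_n (fun n => a n * h ^ n) N).
  { induction N as [|N [IH1 IH2]].
    - assert (E : forall t, T O t = 1 * (ln t ^ 0 * g t)).
      { intros t. unfold T, exp_taylor. rewrite sum_O. simpl. field. }
      split.
      + apply ex_RInt_ext with (fun t => 1 * (ln t ^ 0 * g t)); [intros; symmetry; apply E|].
        apply ex_RInt_Rscal, Ek.
      + rewrite (RInt_01_ext _ (fun t => 1 * (ln t ^ 0 * g t))) by (intros; apply E).
        rewrite RInt_Rscal by apply Ek. rewrite sum_O. unfold a. rewrite !pow_O. change (INR (fact 0)) with 1.
        real_eq. field.
    - set (c := (kappa * h) ^ S N / INR (fact (S N))).
      assert (E : forall t, T (S N) t = T N t + c * (ln t ^ S N * g t)).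
      { intros t. unfold T, exp_taylor. rewrite sum_n_RS.
        rewrite (Rpow_mult_distr (kappa * h) (ln t)). unfold c, Rdiv. ring. }
      assert (E2 := ex_RInt_Rscal c _ _ _ (Ek (S N))).
      split.
      + apply ex_RInt_ext with (fun t => T N t + c * (ln t ^ S N * g t)); [intros; symmetry; apply E|].
        apply ex_RInt_Rplus; assumption.
      + rewrite (RInt_01_ext _ (fun t => T N t + c * (ln t ^ S N * g t))) by (intros; apply E).
        rewrite (RInt_Rplus (T N) (fun t => c * (ln t ^ S N * g t))) by assumption.
        rewrite RInt_Rscal by apply Ek. rewrite IH2, sum_n_RS. unfold a at 3, c.
        rewrite Rpow_mult_distr. unfold Rdiv.
        real_eq. ring. }
  assert (EF : ex_RInt (fun t => exp (kappa * (x0 + h) * ln t) * w t) 0 1).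
  { apply ex_RInt_bigO with (kappa * (x0 + h) + p); [|cont_pos_tac|].
    - assert (Rabs (kappa * h) < e).
      { rewrite Rabs_mult. generalize (Rabs_pos kappa) (Rabs_pos h). intros. nra. }
      apply Rabs_def2 in H. unfold e in *. lra.
    - apply bigO_mult with (kappa * (x0 + h)) p; [apply bigO_pow|exact Hb|reflexivity]. }
  apply is_pseries_R.
  change (is_lim_seq (sum_n (fun n => a n * h ^ n)) (RInt (fun t => exp (kappa * (x0 + h) * ln t) * w t) 0 1)).
  apply is_lim_seq_spec. intros eps.
  assert (L : is_lim_seq (fun N => Rabs C * (/ 2) ^ N) 0).
  { replace (Finite 0) with (Finite (Rabs C * 0)) by (f_equal; ring).
    apply is_lim_seq_mult'; [apply is_lim_seq_const|]. apply is_lim_seq_geom.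
    rewrite Rabs_pos_eq; lra. }
  apply is_lim_seq_spec in L. destruct (L eps) as [N0 HN0]. exists N0. intros N HN.
  specialize (HN0 N HN). rewrite Rminus_0_r in HN0. apply Rabs_def2 in HN0.
  destruct (HT N) as [HT1 HT2]. rewrite <- HT2, Rabs_minus_sym.
  rewrite <- (RInt_Rminus (fun t => exp (kappa * (x0 + h) * ln t) * w t) (T N)) by assumption.
  eapply Rle_lt_trans; [|exact (proj1 HN0)].
  apply RInt_01_bound; [apply ex_RInt_Rminus; assumption|].
  intros t Ht.
  replace (exp (kappa * (x0 + h) * ln t) * w t - T N t) with
    ((exp (kappa * h * ln t) - exp_taylor N (kappa * h * ln t)) * g t).
  2: { unfold T, g. replace (kappa * (x0 + h) * ln t) with (kappa * h * ln t + kappa * x0 * ln t) by ring.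
       rewrite exp_plus. ring. }
  rewrite Rabs_mult.
  assert (R1 := exp_remainder_geom N (kappa * h * ln t)).
  assert (R2 := HC t ltac:(lra)).
  assert (Hl := ln_le_0 t ltac:(lra)).
  eapply Rle_trans; [apply Rmult_le_compat; try apply Rabs_pos; eassumption|].
  apply Rle_trans with ((/ 2) ^ N * C * exp (2 * Rabs (kappa * h * ln t) + e * ln t)).
  { rewrite exp_plus. apply Req_le. ring. }
  assert (Hexp : exp (2 * Rabs (kappa * h * ln t) + e * ln t) <= 1).
  { rewrite <- exp_0. apply exp_le. rewrite !Rabs_mult, (Rabs_left1 (ln t)) by exact Hl.
    assert (Rabs kappa * Rabs h * 2 <= e).
    { generalize (Rabs_pos kappa) (Rabs_pos h). intros. nra. }
    nra. }
  assert (H2 : 0 < (/ 2) ^ N) by (apply pow_lt; lra).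
  assert (Hep := exp_pos (2 * Rabs (kappa * h * ln t) + e * ln t)).
  assert (HCa := Rle_abs C). assert (HCp := Rabs_pos C).
  apply Rle_trans with ((/ 2) ^ N * Rabs C * exp (2 * Rabs (kappa * h * ln t) + e * ln t)).
  - apply Rmult_le_compat_r; [lra|]. apply Rmult_le_compat_l; lra.
  - assert (0 <= (/ 2) ^ N * Rabs C) by (apply Rmult_le_pos; lra). nra.
Qed.

(** * Analytic continuation *)

Lemma is_series_C_components (u : nat -> C) (l : C) :
  is_series (K := C_AbsRing) (V := C_NormedModule) u l ->
  is_series (fun n => Re (u n)) (Re l) /\ is_series (fun n => Im (u n)) (Im l).
Proof.
  intros H.
  assert (E : forall N, sum_n (fun n => Re (u n)) N = Re (sum_n u N) /\
                        sum_n (fun n => Im (u n)) N = Im (sum_n u N)).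
  { induction N as [|N [IH1 IH2]]; [rewrite !sum_O; split; reflexivity|].
    rewrite !sum_n_RS, !sum_Sn, IH1, IH2. split; reflexivity. }
  split.
  - change (is_lim_seq (sum_n (fun n => Re (u n))) (Re l)). apply is_lim_seq_spec. intros eps.
    assert (Hb : locally l (fun z : C => Rabs (Re z - Re l) < eps)).
    { exists eps. intros z Hz. exact (proj1 Hz). }
    destruct (H _ Hb) as [N HN]. exists N. intros n Hn. rewrite (proj1 (E n)). apply HN, Hn.
  - change (is_lim_seq (sum_n (fun n => Im (u n))) (Im l)). apply is_lim_seq_spec. intros eps.
    assert (Hb : locally l (fun z : C => Rabs (Im z - Im l) < eps)).
    { exists eps. intros z Hz. exact (proj2 Hz). }
    destruct (H _ Hb) as [N HN]. exists N. intros n Hn. rewrite (proj2 (E n)). apply HN, Hn.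
Qed.

(** Applied with [v = 1] for continuation along horizontal lines and with [v = Ci] for the approach
    to the real axis. *)
Lemma analytic_at_line (f : C -> C) (s0 v : C) (x0 : R) : analytic_at f s0 ->
  ranalytic (fun x => Re (f (s0 + RtoC (x - x0) * v)%C)) x0 /\
  ranalytic (fun x => Im (f (s0 + RtoC (x - x0) * v)%C)) x0.
Proof.
  intros [a [r H]].
  assert (Hv := Cmod_ge_0 v).
  assert (Hr : 0 < r / (Cmod v + 1)) by (apply Rdiv_lt_0_compat; [apply cond_pos|lra]).
  assert (P : forall h, Rabs h < r / (Cmod v + 1) ->
    let z := f (s0 + RtoC (x0 + h - x0) * v)%C in
    is_pseries (fun n => Re (pow_n (K := C_Ring) v n * a n)%C) h (Re z) /\
    is_pseries (fun n => Im (pow_n (K := C_Ring) v n * a n)%C) h (Im z)).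
  { intros h Hh. apply Rlt_div_r in Hh; [|lra].
    replace (x0 + h - x0) with h by ring. intros z.
    assert (Hz : Cmod ((s0 + RtoC h * v) - s0)%C < r).
    { replace ((s0 + RtoC h * v) - s0)%C with (RtoC h * v)%C by ring.
      rewrite Cmod_mult, Cmod_R. generalize (Rabs_pos h). intros; nra. }
    specialize (H _ Hz).
    replace ((s0 + RtoC h * v) - s0)%C with (RtoC h * v)%C in H by ring.
    assert (Hp : forall n, pow_n (K := C_Ring) (RtoC h * v)%C n = (RtoC (h ^ n) * pow_n (K := C_Ring) v n)%C).
    { induction n as [|n IH]; simpl pow_n.
      - change (@one C_Ring) with (RtoC 1). simpl. ring.
      - rewrite IH. change (h ^ S n) with (h * h ^ n). rewrite RtoC_mult.
        change ((RtoC h * v * (RtoC (h ^ n) * pow_n (K := C_Ring) v n))%C =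
          (RtoC h * RtoC (h ^ n) * (v * pow_n (K := C_Ring) v n))%C). ring. }
    assert (HT : forall n, scal (K := C_Ring) (V := C_ModuleSpace) (pow_n (K := C_Ring) (RtoC h * v)%C n) (a n) =
      (RtoC (h ^ n) * (pow_n (K := C_Ring) v n * a n))%C).
    { intros n. rewrite Hp.
      change (((RtoC (h ^ n) * pow_n (K := C_Ring) v n) * a n)%C =
        (RtoC (h ^ n) * (pow_n (K := C_Ring) v n * a n))%C). ring. }
    destruct (is_series_C_components _ _ H) as [H1 H2].
    split; apply is_pseries_R.
    - eapply is_series_ext; [|exact H1]. intros n. cbv beta. etransitivity.
      { apply f_equal. apply HT. }
      unfold RtoC, Cmult, Re; simpl. ring.
    - eapply is_series_ext; [|exact H2]. intros n. cbv beta. etransitivity.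
      { apply f_equal. apply HT. }
      unfold RtoC, Cmult, Im; simpl. ring. }
  split; (eexists; exists (r / (Cmod v + 1)); split; [exact Hr|]); intros h Hh; apply (P h Hh).
Qed.

Lemma C_eq_0 (z : C) : Re z = 0 -> Im z = 0 -> z = RtoC 0.
Proof. destruct z as [a b]. unfold Re, Im; simpl. intros -> ->. reflexivity. Qed.

Definition canal (f : R -> C) (x : R) : Prop :=
  ranalytic (fun x => Re (f x)) x /\ ranalytic (fun x => Im (f x)) x.

Lemma canal_mult (f g : R -> C) (x : R) : canal f x -> canal g x -> canal (fun x => (f x * g x)%C) x.
Proof.
  intros [F1 F2] [G1 G2]. split.
  - apply (ranalytic_plus (fun x => Re (f x) * Re (g x)) (fun x => - (Im (f x) * Im (g x)))).
    + apply ranalytic_mult; assumption.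
    + apply ranalytic_opp, ranalytic_mult; assumption.
  - apply (ranalytic_plus (fun x => Re (f x) * Im (g x)) (fun x => Im (f x) * Re (g x)));
      apply ranalytic_mult; assumption.
Qed.

Lemma canal_minus (f g : R -> C) (x : R) : canal f x -> canal g x -> canal (fun x => (f x - g x)%C) x.
Proof.
  intros [F1 F2] [G1 G2].
  split; apply ranalytic_plus; try apply ranalytic_opp; assumption.
Qed.

Lemma canal_const (c : C) (x : R) : canal (fun _ => c) x.
Proof. split; apply ranalytic_const. Qed.

Lemma canal_horizontal (y x : R) : canal (fun x => (x, y)) x.
Proof. split; [apply ranalytic_id|exact (ranalytic_const y x)]. Qed.

Lemma ranalytic_gamma_ph (c y al x : R) : 0 < c -> 0 < x -> ranalytic (fun sg => gamma_ph c sg y al) x.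
Proof.
  intros Hc Hx.
  set (w1 := fun t => c * (cos (y * ln t + al) * exp (- c * t))).
  set (w2 := fun t => c * (cos (- y * ln t + al) * exp (- c / t)) * / t ^ 2).
  assert (C1 : cont_pos w1) by (unfold w1; cont_pos_tac).
  assert (C2 : cont_pos w2) by (unfold w2; cont_pos_tac).
  assert (O1 : bigO 0 w1).
  { unfold w1. apply bigO_scal. apply bigO_mult with 0 0; [apply bigO_cos|apply bigO_exp_lin, Hc|ring]. }
  assert (O2 : forall p, bigO p w2).
  { intros p. unfold w2. apply bigO_mult with (p + 2) (- 2); [|apply bigO_inv_sqr|ring].
    apply bigO_scal. apply bigO_mult with 0 (p + 2); [apply bigO_cos|apply bigO_exp_inv, Hc|ring]. }
  apply ranalytic_ext_loc with (r := x) (f := fun sg =>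
    RInt (fun t => exp (1 * sg * ln t) * w1 t) 0 1 + RInt (fun t => exp (- (1) * sg * ln t) * w2 t) 0 1).
  - exact Hx.
  - intros h Hh. apply Rabs_def2 in Hh. unfold gamma_ph.
    rewrite <- (RInt_Rplus (fun t => exp (1 * (x + h) * ln t) * w1 t)
      (fun t => exp (- (1) * (x + h) * ln t) * w2 t)).
    + apply RInt_01_ext. intros t _. unfold gamma_int, w1, w2, cpow.
      replace (1 * (x + h) * ln t) with ((x + h) * ln t) by ring.
      replace (- (1) * (x + h) * ln t) with (- (x + h) * ln t) by ring.
      real_eq. ring.
    + apply ex_RInt_bigO with (x + h); [lra|cont_pos_tac|].
      apply bigO_mult with (1 * (x + h)) 0; [apply bigO_pow|exact O1|ring].
    + apply ex_RInt_bigO with 1; [lra|cont_pos_tac|].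
      apply bigO_mult with (- (1) * (x + h)) (1 + (x + h)); [apply bigO_pow|apply O2|ring].
  - apply ranalytic_plus.
    + apply ranalytic_mellin with 0; [exact C1|exact O1|lra].
    + apply ranalytic_mellin with (1 + x); [exact C2|apply O2|lra].
Qed.

Lemma ranalytic_J_ph (D y al x : R) : 0 < D -> ranalytic (fun sg => J_ph D sg y al) x.
Proof.
  intros HD.
  set (w1 := fun t => cos (y * ln t + al) * / t * Kern D t).
  set (w2 := fun t => cos (- y * ln t + al) * Kern D t).
  assert (C1 : cont_pos w1) by (unfold w1; cont_pos_tac).
  assert (C2 : cont_pos w2) by (unfold w2; cont_pos_tac).
  assert (O1 : forall p, bigO p w1).
  { intros p. unfold w1. apply bigO_mult with (- 1) (p + 1); [|apply bigO_Kern, HD|ring].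
    apply bigO_mult with 0 (- 1); [apply bigO_cos|apply bigO_inv|ring]. }
  assert (O2 : forall p, bigO p w2).
  { intros p. unfold w2. apply bigO_mult with 0 p; [apply bigO_cos|apply bigO_Kern, HD|ring]. }
  apply ranalytic_ext_loc with (r := 1) (f := fun sg =>
    RInt (fun t => exp (1 * sg * ln t) * w1 t) 0 1 + RInt (fun t => exp (- (1) * sg * ln t) * w2 t) 0 1).
  - lra.
  - intros h Hh. apply Rabs_def2 in Hh. unfold J_ph.
    rewrite <- (RInt_Rplus (fun t => exp (1 * (x + h) * ln t) * w1 t)
      (fun t => exp (- (1) * (x + h) * ln t) * w2 t)).
    + apply RInt_01_ext. intros t Ht. unfold J_int, w1, w2, cpow.
      replace (1 * (x + h) * ln t) with ((x + h) * ln t) by ring.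
      replace (- (1) * (x + h) * ln t) with (- (x + h) * ln t) by ring.
      rewrite Rmult_minus_distr_r. unfold Rminus.
      rewrite (exp_plus ((x + h) * ln t)), Rmult_1_l, exp_Ropp, exp_ln by lra.
      real_eq. ring.
    + apply ex_RInt_bigO with 1; [lra|cont_pos_tac|].
      apply bigO_mult with (1 * (x + h)) (1 - (x + h)); [apply bigO_pow|apply O1|ring].
    + apply ex_RInt_bigO with 1; [lra|cont_pos_tac|].
      apply bigO_mult with (- (1) * (x + h)) (1 + (x + h)); [apply bigO_pow|apply O2|ring].
  - apply ranalytic_plus.
    + apply ranalytic_mellin with (1 - x); [exact C1|apply O1|lra].
    + apply ranalytic_mellin with (1 + x); [exact C2|apply O2|lra].
Qed.

(** On the half line [x > 0] at height [y <> 0], away from the pole, both sides are real analytic in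
    [x], and they agree for [x > 3]. *)
Lemma zeta2_mellin_offreal (D : R) (f : C -> C) (s : C) : 0 < D -> is_zeta2 D f ->
  0 < Re s -> Im s <> 0 ->
  ((s - 1) * (2 * f s) * gamma_c (PI / D) s = 1 + s * (s - 1) * J_c D s)%C.
Proof.
  destruct s as [sg y]. unfold Re, Im; simpl fst; simpl snd. intros HD Hf Hs Hy.
  assert (Hc : 0 < PI / D) by (apply Rdiv_lt_0_compat; [apply PI_RGT_0|exact HD]).
  (* The right side is written with subtractions only, matching the closure properties proved for
     [canal]. *)
  set (F := fun x : R => let s := (x, y) : C in
    ((s - 1) * (2 * f s) * gamma_c (PI / D) s - (1 - (0 - s) * (s - 1) * J_c D s))%C).
  assert (HA : forall x, 0 < x -> canal F x).
  { intros x Hx. unfold F.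
    assert (K1 : canal (fun x => (x, y) : C) x) by apply canal_horizontal.
    assert (K2 : canal (fun x => f (x, y)) x).
    { destruct (analytic_at_line f (x, y) (RtoC 1) x) as [L1 L2].
      { apply (proj1 Hf). intros E. apply Hy. injection E. auto. }
      assert (E : forall h, ((x, y) + RtoC (x + h - x) * RtoC 1)%C = (x + h, y)).
      { intros h. unfold Cplus, Cmult, RtoC; simpl. f_equal; ring. }
      split; [apply ranalytic_ext_loc with (r := 1) (3 := L1)
             |apply ranalytic_ext_loc with (r := 1) (3 := L2)];
        try lra; intros h _; cbv beta; rewrite E; reflexivity. }
    assert (K3 : canal (fun x => gamma_c (PI / D) (x, y)) x).
    { split; unfold gamma_c, Re, Im; simpl; apply ranalytic_gamma_ph; assumption. }
    assert (K4 : canal (fun x => J_c D (x, y)) x).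
    { split; unfold J_c, Re, Im; simpl; apply ranalytic_J_ph; assumption. }
    assert (K0 : forall c, canal (fun _ => c) x) by (intros c; apply canal_const).
    assert (K5 := canal_minus _ _ _ K1 (K0 (RtoC 1))).
    assert (K6 := canal_mult _ _ _ (canal_mult _ _ _ K5 (canal_mult _ _ _ (K0 (RtoC 2)) K2)) K3).
    assert (K7 := canal_mult _ _ _ (canal_mult _ _ _ (canal_minus _ _ _ (K0 (RtoC 0)) K1) K5) K4).
    exact (canal_minus _ _ _ K6 (canal_minus _ _ _ (K0 (RtoC 1)) K7)). }
  assert (H0 : forall x, 3 < x -> F x = RtoC 0).
  { intros x Hx. unfold F. cbv zeta.
    rewrite (zeta2_mellin D f (x, y) HD Hf) by exact Hx. ring. }
  assert (R0 : F sg = RtoC 0).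
  { assert (Z1 := ranalytic_identity (fun x => Re (F x)) 3 (fun x Hx => proj1 (HA x Hx))
      (fun x Hx => f_equal Re (H0 x Hx)) sg Hs).
    assert (Z2 := ranalytic_identity (fun x => Im (F x)) 3 (fun x Hx => proj2 (HA x Hx))
      (fun x Hx => f_equal Im (H0 x Hx)) sg Hs).
    exact (C_eq_0 _ Z1 Z2). }
  unfold F in R0. cbv zeta in R0.
  match goal with |- ?A = ?B => replace A with (A - (1 - (0 - (sg, y)) * ((sg, y) - 1) * J_c D (sg, y)) + B)%C by ring end.
  rewrite R0. ring.
Qed.

(** * Continuity in the imaginary part and the identity on the real axis *)

Lemma bigO_pos_bounded (p : R) (f : R -> R) : 0 <= p -> bigO p f ->
  exists M, 0 <= M /\ forall t, 0 < t <= 1 -> Rabs (f t) <= M.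
Proof.
  intros Hp H. destruct (bigO_weaken p 0 f Hp H) as [C HC].
  exists (Rabs C). split; [apply Rabs_pos|]. intros t Ht. generalize (HC t Ht) (Rle_abs C).
  rewrite Rmult_0_l, exp_0. lra.
Qed.

Lemma cos_lipschitz (a b : R) : Rabs (cos a - cos b) <= Rabs (a - b).
Proof.
  destruct (MVT_gen cos b a (fun x => - sin x)) as [c [_ E]].
  - intros x _. apply is_derive_Reals, derivable_pt_lim_cos.
  - intros x _. apply continuity_cos.
  - rewrite E, Rabs_mult, Rabs_Ropp.
    rewrite <- (Rmult_1_l (Rabs (a - b))) at 2. apply Rmult_le_compat_r; [apply Rabs_pos|].
    apply Rabs_le, SIN_bound.
Qed.

(** The Lipschitz constant bounds [|k ln t * g t|]; the logarithm consumes half of the decay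
    exponent [p]. *)
Lemma oscillating_lipschitz (k al p : R) (g : R -> R) : 0 < p -> cont_pos g -> bigO p g ->
  exists M, 0 <= M /\ forall y y',
    Rabs (RInt (fun t => cos (k * y * ln t + al) * g t) 0 1 -
          RInt (fun t => cos (k * y' * ln t + al) * g t) 0 1) <= M * Rabs (y - y').
Proof.
  intros Hp Hg Og.
  assert (E : forall y, ex_RInt (fun t => cos (k * y * ln t + al) * g t) 0 1).
  { intros y. apply ex_RInt_bigO with p; [exact Hp|cont_pos_tac|].
    apply bigO_mult with 0 p; [apply bigO_cos|exact Og|ring]. }
  destruct (bigO_pos_bounded (p / 2) (fun t => ln t ^ 1 * g t)) as [M [HM H]]; [lra| |].
  { apply bigO_mult with (- (p / 2)) p; [apply bigO_ln; lra|exact Og|lra]. }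
  exists (Rabs k * M). split; [apply Rmult_le_pos; [apply Rabs_pos|exact HM]|].
  intros y y'. rewrite <- RInt_Rminus by apply E.
  apply RInt_01_bound; [apply ex_RInt_Rminus; apply E|].
  intros t Ht. specialize (H t ltac:(lra)).
  rewrite <- Rmult_minus_distr_r, Rabs_mult.
  eapply Rle_trans; [apply Rmult_le_compat_r; [apply Rabs_pos|apply cos_lipschitz]|].
  replace (k * y * ln t + al - (k * y' * ln t + al)) with (k * (y - y') * ln t) by ring.
  rewrite !Rabs_mult. rewrite pow_1, Rabs_mult in H.
  replace (Rabs k * Rabs (y - y') * Rabs (ln t) * Rabs (g t)) with
    (Rabs k * Rabs (y - y') * (Rabs (ln t) * Rabs (g t))) by ring.
  replace (Rabs k * M * Rabs (y - y')) with (Rabs k * Rabs (y - y') * M) by ring.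
  apply Rmult_le_compat_l; [|exact H]. apply Rmult_le_pos; apply Rabs_pos.
Qed.

Lemma lipschitz_continuous (f : R -> R) (M x : R) : 0 <= M ->
  (forall y, Rabs (f y - f x) <= M * Rabs (y - x)) -> continuous f x.
Proof.
  intros HM H. apply continuity_pt_filterlim. intros eps Heps.
  assert (HM1 : 0 < M + 1) by lra.
  exists (eps / (M + 1)). split; [apply Rdiv_lt_0_compat; lra|].
  intros y [_ Hy]. simpl in *. unfold R_dist in *.
  eapply Rle_lt_trans; [apply H|]. apply Rlt_div_r in Hy; [|exact HM1].
  generalize (Rabs_pos (y - x)). intros; nra.
Qed.

Lemma oscillating_continuous (k al p x : R) (g : R -> R) : 0 < p -> cont_pos g -> bigO p g ->
  continuous (fun y => RInt (fun t => cos (k * y * ln t + al) * g t) 0 1) x.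
Proof.
  intros Hp Hg Og. destruct (oscillating_lipschitz k al p g Hp Hg Og) as [M [HM H]].
  apply lipschitz_continuous with M; [exact HM|]. intros y. apply H.
Qed.

Definition ccont (f : R -> C) (x : R) : Prop :=
  continuous (fun x => Re (f x)) x /\ continuous (fun x => Im (f x)) x.

Lemma ccont_mult (f g : R -> C) (x : R) : ccont f x -> ccont g x -> ccont (fun x => (f x * g x)%C) x.
Proof.
  intros [F1 F2] [G1 G2]. split.
  - apply (continuous_Rminus (fun x => Re (f x) * Re (g x)) (fun x => Im (f x) * Im (g x)));
      apply continuous_Rmult; assumption.
  - apply (continuous_Rplus (fun x => Re (f x) * Im (g x)) (fun x => Im (f x) * Re (g x)));
      apply continuous_Rmult; assumption.
Qed.

Lemma ccont_minus (f g : R -> C) (x : R) : ccont f x -> ccont g x -> ccont (fun x => (f x - g x)%C) x.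
Proof.
  intros [F1 F2] [G1 G2]. split; apply continuous_Rminus; assumption.
Qed.

Lemma ccont_const (c : C) (x : R) : ccont (fun _ => c) x.
Proof. split; apply continuous_const. Qed.

Lemma continuous_gamma_ph (c sg al x : R) : 0 < c -> 0 < sg -> continuous (fun y => gamma_ph c sg y al) x.
Proof.
  intros Hc Hs.
  set (g1 := fun t => exp (sg * ln t) * (c * exp (- c * t))).
  set (g2 := fun t => exp (- sg * ln t) * (c * exp (- c / t) * / t ^ 2)).
  assert (C1 : cont_pos g1) by (unfold g1; cont_pos_tac).
  assert (C2 : cont_pos g2) by (unfold g2; cont_pos_tac).
  assert (O1 : bigO sg g1).
  { unfold g1. apply bigO_mult with sg 0; [apply bigO_pow|apply bigO_scal, bigO_exp_lin, Hc|ring]. }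
  assert (O2 : bigO 1 g2).
  { unfold g2. apply bigO_mult with (- sg) (sg + 1); [apply bigO_pow| |ring].
    apply bigO_mult with (sg + 3) (- 2); [apply bigO_scal, bigO_exp_inv, Hc|apply bigO_inv_sqr|ring]. }
  apply continuous_ext with (fun y => RInt (fun t => cos (1 * y * ln t + al) * g1 t) 0 1 +
    RInt (fun t => cos (- (1) * y * ln t + al) * g2 t) 0 1).
  - intros y. unfold gamma_ph.
    rewrite <- (RInt_Rplus (fun t => cos (1 * y * ln t + al) * g1 t)
      (fun t => cos (- (1) * y * ln t + al) * g2 t)).
    + apply RInt_01_ext. intros t _. unfold gamma_int, g1, g2, cpow.
      replace (1 * y * ln t) with (y * ln t) by ring.
      replace (- (1) * y * ln t) with (- y * ln t) by ring.
      real_eq. ring.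
    + apply ex_RInt_bigO with sg; [exact Hs|cont_pos_tac|].
      apply bigO_mult with 0 sg; [apply bigO_cos|exact O1|ring].
    + apply ex_RInt_bigO with 1; [lra|cont_pos_tac|].
      apply bigO_mult with 0 1; [apply bigO_cos|exact O2|ring].
  - apply continuous_Rplus.
    + apply oscillating_continuous with sg; assumption.
    + apply oscillating_continuous with 1; [lra|assumption|assumption].
Qed.

Lemma continuous_J_ph (D sg al x : R) : 0 < D -> continuous (fun y => J_ph D sg y al) x.
Proof.
  intros HD.
  set (g1 := fun t => exp ((sg - 1) * ln t) * Kern D t).
  set (g2 := fun t => exp (- sg * ln t) * Kern D t).
  assert (C1 : cont_pos g1) by (unfold g1; cont_pos_tac).
  assert (C2 : cont_pos g2) by (unfold g2; cont_pos_tac).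
  assert (O1 : bigO 1 g1).
  { unfold g1. apply bigO_mult with (sg - 1) (2 - sg); [apply bigO_pow|apply bigO_Kern, HD|ring]. }
  assert (O2 : bigO 1 g2).
  { unfold g2. apply bigO_mult with (- sg) (1 + sg); [apply bigO_pow|apply bigO_Kern, HD|ring]. }
  apply continuous_ext with (fun y => RInt (fun t => cos (1 * y * ln t + al) * g1 t) 0 1 +
    RInt (fun t => cos (- (1) * y * ln t + al) * g2 t) 0 1).
  - intros y. unfold J_ph.
    rewrite <- (RInt_Rplus (fun t => cos (1 * y * ln t + al) * g1 t)
      (fun t => cos (- (1) * y * ln t + al) * g2 t)).
    + apply RInt_01_ext. intros t _. unfold J_int, g1, g2, cpow.
      replace (1 * y * ln t) with (y * ln t) by ring.
      replace (- (1) * y * ln t) with (- y * ln t) by ring.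
      real_eq. ring.
    + apply ex_RInt_bigO with 1; [lra|cont_pos_tac|].
      apply bigO_mult with 0 1; [apply bigO_cos|exact O1|ring].
    + apply ex_RInt_bigO with 1; [lra|cont_pos_tac|].
      apply bigO_mult with 0 1; [apply bigO_cos|exact O2|ring].
  - apply continuous_Rplus; apply oscillating_continuous with 1; first [lra|assumption].
Qed.

Lemma continuous_punctured_0 (f : R -> R) : continuous f 0 -> (forall x, x <> 0 -> f x = 0) -> f 0 = 0.
Proof.
  intros Hc H. destruct (Req_dec (f 0) 0) as [E|E]; [exact E|exfalso].
  apply continuity_pt_filterlim in Hc.
  destruct (Hc (Rabs (f 0)) (Rabs_pos_lt _ E)) as [d [Hd Hx]].
  specialize (Hx (d / 2)). simpl in Hx. unfold R_dist in Hx.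
  rewrite (H (d / 2)), Rminus_0_l, Rabs_Ropp in Hx by lra.
  assert (Rabs (f 0) < Rabs (f 0)); [|lra]. apply Hx. split.
  - split; [exact I|lra].
  - rewrite Rminus_0_r, Rabs_pos_eq; lra.
Qed.

(** For real [s] the horizontal line passes through the pole, so the identity is obtained as the
    limit [y -> 0] along the vertical line through [s]. *)
Lemma zeta2_mellin_strip (D : R) (f : C -> C) (s : C) : 0 < D -> is_zeta2 D f ->
  0 < Re s -> s <> RtoC 1 ->
  ((s - 1) * (2 * f s) * gamma_c (PI / D) s = 1 + s * (s - 1) * J_c D s)%C.
Proof.
  destruct s as [sg y]. unfold Re; simpl fst. intros HD Hf Hs Hs1.
  destruct (Req_dec y 0) as [->|Hy]; [|apply zeta2_mellin_offreal; assumption].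
  assert (Hc : 0 < PI / D) by (apply Rdiv_lt_0_compat; [apply PI_RGT_0|exact HD]).
  set (F := fun y : R => ((((sg, y) : C) - 1) * (2 * f (sg, y)) * gamma_c (PI / D) (sg, y) -
    (1 - (0 - (sg, y)) * ((sg, y) - 1) * J_c D (sg, y)))%C).
  assert (HA : ccont F 0).
  { assert (K0 : forall c, ccont (fun _ => c) 0) by (intros c; apply ccont_const).
    assert (K1 : ccont (fun y => (sg, y) : C) 0).
    { split; [exact (continuous_const sg 0)|exact (continuous_id 0)]. }
    assert (K2 : ccont (fun y => f (sg, y)) 0).
    { destruct (analytic_at_line f (sg, 0) Ci 0) as [L1 L2].
      { apply (proj1 Hf). exact Hs1. }
      assert (E : forall x, ((sg, 0) + RtoC (x - 0) * Ci)%C = (sg, x)).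
      { intros x. unfold Cplus, Cmult, RtoC, Ci; simpl. f_equal; ring. }
      apply ranalytic_continuous in L1. apply ranalytic_continuous in L2.
      split; [apply continuous_ext with (2 := L1)|apply continuous_ext with (2 := L2)];
        intros x; rewrite E; reflexivity. }
    assert (K3 : ccont (fun y => gamma_c (PI / D) (sg, y)) 0).
    { split; unfold gamma_c, Re, Im; simpl; apply continuous_gamma_ph; assumption. }
    assert (K4 : ccont (fun y => J_c D (sg, y)) 0).
    { split; unfold J_c, Re, Im; simpl; apply continuous_J_ph; assumption. }
    assert (K5 := ccont_minus _ _ _ K1 (K0 (RtoC 1))).
    assert (K6 := ccont_mult _ _ _ (ccont_mult _ _ _ K5 (ccont_mult _ _ _ (K0 (RtoC 2)) K2)) K3).
    assert (K7 := ccont_mult _ _ _ (ccont_mult _ _ _ (ccont_minus _ _ _ (K0 (RtoC 0)) K1) K5) K4).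
    exact (ccont_minus _ _ _ K6 (ccont_minus _ _ _ (K0 (RtoC 1)) K7)). }
  assert (H0 : forall x, x <> 0 -> F x = RtoC 0).
  { intros x Hx. unfold F. rewrite (zeta2_mellin_offreal D f (sg, x) HD Hf) by assumption. ring. }
  assert (R0 : F 0 = RtoC 0).
  { apply C_eq_0.
    - apply (continuous_punctured_0 (fun x => Re (F x)) (proj1 HA)). intros x Hx. rewrite H0 by exact Hx. reflexivity.
    - apply (continuous_punctured_0 (fun x => Im (F x)) (proj2 HA)). intros x Hx. rewrite H0 by exact Hx. reflexivity. }
  unfold F in R0.
  match goal with |- ?A = ?B =>
    replace A with (A - (1 - (0 - (sg, 0)) * ((sg, 0) - 1) * J_c D (sg, 0)) + B)%C by ring end.
  rewrite R0. ring.
Qed.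

Lemma zero_equation (D : R) (f : C -> C) (s : C) : 0 < D -> is_zeta2 D f ->
  0 < Re s -> s <> RtoC 1 -> f s = RtoC 0 -> (1 + s * (s - 1) * J_c D s)%C = RtoC 0.
Proof.
  intros HD Hf Hs Hs1 H0. rewrite <- (zeta2_mellin_strip D f s HD Hf Hs Hs1), H0. ring.
Qed.

(** * Derivatives of G *)

Definition weight (k : nat) (t : R) : R := ln t ^ k * exp (- (1 / 2) * ln t).

(** Each derivative in [y] brings out one [ln t] and advances the phase by [PI / 2], so one formula
    covers all orders. *)
Definition A_int (k : nat) (X : R -> R -> R) (D y t : R) : R :=
  cos (y * ln t + INR k * (PI / 2)) * (weight k t * X D t).

(* [A_der Kern k D y] is the [k]-th derivative in [y] of
   [int_0^1 cos (y ln t) Kern D t / sqrt t dt]. *)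
Definition A_der (X : R -> R -> R) (k : nat) (D y : R) : R := RInt (A_int k X D y) 0 1.

Lemma bigO_weight (k : nat) : bigO (- 1) (weight k).
Proof.
  unfold weight. apply bigO_mult with (- (1 / 2)) (- (1 / 2)); [apply bigO_ln; lra|apply bigO_pow|lra].
Qed.

Lemma cont_pos_weight (k : nat) : cont_pos (weight k).
Proof. unfold weight. cont_pos_tac. Qed.

Lemma cont_pos_Kern1 (D : R) : 0 < D -> cont_pos (Kern1 D).
Proof. intros HD t Ht. apply continuous_Kern1; assumption. Qed.

Lemma unif_bound_bigO (m : R) (p : nat) (X : R -> R -> R) (D : R) :
  unif_bound m p X -> m <= D <= / m -> bigO (INR p) (X D).
Proof.
  intros [C H] HD. exists C. intros t Ht. rewrite exp_ln_nat by lra. apply H; assumption.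
Qed.

Lemma unif_bound_weight (m : R) (p : nat) (w : R -> R) (X : R -> R -> R) : bigO (- INR p) w -> unif_bound m p X ->
  exists M, 0 <= M /\ forall D t, m <= D <= / m -> 0 < t <= 1 -> Rabs (w t * X D t) <= M.
Proof.
  intros [C1 H1] [C2 H2]. exists (Rabs C1 * Rabs C2).
  split; [apply Rmult_le_pos; apply Rabs_pos|]. intros D t HD Ht.
  specialize (H1 t Ht). specialize (H2 D t HD Ht).
  rewrite exp_ln_opp in H1 by lra. rewrite Rabs_mult.
  assert (Htp : 0 < t ^ p) by (apply pow_lt; lra).
  assert (Hti : 0 < / t ^ p) by (apply Rinv_0_lt_compat, Htp).
  apply Rle_trans with ((Rabs C1 * / t ^ p) * (Rabs C2 * t ^ p)).
  - apply Rmult_le_compat; try apply Rabs_pos.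
    + eapply Rle_trans; [exact H1|]. apply Rmult_le_compat_r; [lra|apply Rle_abs].
    + eapply Rle_trans; [exact H2|]. apply Rmult_le_compat_r; [lra|apply Rle_abs].
  - apply Req_le. field. lra.
Qed.

Lemma ex_RInt_A_int (k : nat) (X : R -> R -> R) (D y : R) : cont_pos (X D) -> bigO 2 (X D) ->
  ex_RInt (A_int k X D y) 0 1.
Proof.
  intros Hc Ho. apply ex_RInt_bigO with 1; [lra| |].
  - assert (Hw := cont_pos_weight k). unfold A_int. cont_pos_tac.
  - unfold A_int. apply bigO_mult with 0 1; [apply bigO_cos| |ring].
    apply bigO_mult with (- 1) 2; [apply bigO_weight|exact Ho|lra].
Qed.

Lemma is_derive_A_int_y (k : nat) (X : R -> R -> R) (D y t : R) :
  is_derive (fun y => A_int k X D y t) y (A_int (S k) X D y t).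
Proof.
  unfold A_int. auto_derive; [exact I|].
  replace (y * ln t + INR (S k) * (PI / 2)) with (y * ln t + INR k * (PI / 2) + PI / 2)
    by (rewrite S_INR; ring).
  rewrite (cos_plus _ (PI / 2)), cos_PI2, sin_PI2. unfold weight. simpl pow.
  replace (PI * / 2) with (PI / 2) by reflexivity. ring.
Qed.

Lemma A_int_abs_le (k : nat) (X : R -> R -> R) (D y t : R) :
  Rabs (A_int k X D y t) <= Rabs (weight k t * X D t).
Proof.
  unfold A_int. rewrite Rabs_mult. rewrite <- (Rmult_1_l (Rabs (weight k t * X D t))) at 2.
  apply Rmult_le_compat_r; [apply Rabs_pos|]. apply Rabs_le, COS_bound.
Qed.

Lemma compact_around (D0 : R) : 0 < D0 -> exists m, 0 < m /\
  forall D, Rabs (D - D0) < D0 / 2 -> 0 < D /\ m <= D <= / m.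
Proof.
  intros H. exists (Rmin (D0 / 2) (/ (2 * D0))).
  assert (Hi : 0 < / (2 * D0)) by (apply Rinv_0_lt_compat; lra).
  assert (Hm : 0 < Rmin (D0 / 2) (/ (2 * D0))) by (apply Rmin_pos; lra).
  split; [exact Hm|]. intros D HD. apply Rabs_def2 in HD. split; [lra|]. split.
  - eapply Rle_trans; [apply Rmin_l|lra].
  - apply Rle_trans with (2 * D0); [lra|]. rewrite <- (Rinv_inv (2 * D0)) at 1.
    apply Rinv_le_contravar; [exact Hm|apply Rmin_r].
Qed.

Lemma bigO_Kern1 (D p : R) : 0 < D -> bigO p (Kern1 D).
Proof.
  intros HD. destruct (nat_ge p) as [n Hn]. apply bigO_weaken with (INR n); [exact Hn|].
  destruct (compact_around D HD) as [m [Hm H]].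
  apply unif_bound_bigO with m; [apply unif_bound_Kern1, Hm|].
  apply H. rewrite Rminus_diag, Rabs_R0. lra.
Qed.

Lemma ex_RInt_A_int_Kern (k : nat) (D y : R) : 0 < D -> ex_RInt (A_int k Kern D y) 0 1.
Proof. intros HD. apply ex_RInt_A_int; [apply cont_pos_Kern, HD|apply bigO_Kern, HD]. Qed.

Lemma ex_RInt_A_int_Kern1 (k : nat) (D y : R) : 0 < D -> ex_RInt (A_int k Kern1 D y) 0 1.
Proof. intros HD. apply ex_RInt_A_int; [apply cont_pos_Kern1, HD|apply bigO_Kern1, HD]. Qed.

Lemma is_derive_A_der_y (k : nat) (D y : R) : 0 < D ->
  is_derive (fun y => A_der Kern k D y) y (A_der Kern (S k) D y).
Proof.
  intros HD. destruct (compact_around D HD) as [m [Hm Hc]].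
  destruct (unif_bound_weight m 1 (weight (S (S k))) Kern) as [M [HM H]].
  { apply bigO_weight. } { apply unif_bound_Kern, Hm. }
  unfold A_der.
  apply (is_derive_RInt_01 (fun y => A_int k Kern D y) (fun y => A_int (S k) Kern D y)
    (fun y => A_int (S (S k)) Kern D y) y 1 M).
  - lra.
  - intros. apply ex_RInt_A_int_Kern, HD.
  - apply ex_RInt_A_int_Kern, HD.
  - intros. apply is_derive_A_int_y.
  - intros. apply is_derive_A_int_y.
  - intros x t _ Ht. eapply Rle_trans; [apply A_int_abs_le|]. apply H; [|lra].
    apply Hc. rewrite Rminus_diag, Rabs_R0. lra.
Qed.

Lemma is_derive_A_der_D (k : nat) (D0 y : R) : 0 < D0 ->
  is_derive (fun D => A_der Kern k D y) D0 (A_der Kern1 k D0 y).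
Proof.
  intros HD. destruct (compact_around D0 HD) as [m [Hm Hc]].
  destruct (unif_bound_weight m 1 (weight k) Kern2) as [M [HM H]].
  { apply bigO_weight. } { apply unif_bound_Kern2, Hm. }
  unfold A_der.
  apply (is_derive_RInt_01 (fun D => A_int k Kern D y) (fun D => A_int k Kern1 D y)
    (fun D => A_int k Kern2 D y) D0 (D0 / 2) M).
  - lra.
  - intros. apply ex_RInt_A_int_Kern. apply Hc. assumption.
  - apply ex_RInt_A_int_Kern1, HD.
  - intros D t HD' Ht. unfold A_int. apply is_derive_Rscal, is_derive_Rscal, is_derive_Kern; [|lra].
    apply Hc, HD'.
  - intros D t HD' Ht. unfold A_int. apply is_derive_Rscal, is_derive_Rscal, is_derive_Kern1; [|lra].
    apply Hc, HD'.
  - intros D t HD' Ht. eapply Rle_trans; [apply A_int_abs_le|]. apply H; [|lra]. apply Hc, HD'.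
Qed.

Lemma Kern_diff_abs_le (D0 : R) (w : R -> R) : 0 < D0 -> bigO (- 1) w -> exists M, 0 <= M /\
  forall D t, Rabs (D - D0) < D0 / 2 -> 0 < t <= 1 ->
  Rabs (w t * (Kern D t - Kern D0 t)) <= M * Rabs (D - D0).
Proof.
  intros HD Hw. destruct (compact_around D0 HD) as [m [Hm Hc]].
  destruct (unif_bound_weight m 1 w Kern1 Hw (unif_bound_Kern1 m 1 Hm)) as [M [HM H]].
  exists M. split; [exact HM|]. intros D t HDD Ht.
  assert (Hb : forall z, Rmin D0 D <= z <= Rmax D0 D -> Rabs (z - D0) < D0 / 2).
  { intros z. revert HDD. unfold Rmin, Rmax. destruct Rle_dec; intros HDD [? ?];
      apply Rabs_def2 in HDD; apply Rabs_def1; lra. }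
  destruct (MVT_gen (fun D => Kern D t) D0 D (fun D => Kern1 D t)) as [c [Hc1 Ec]].
  - intros z Hz. apply is_derive_Kern; [|lra]. apply Hc, Hb. lra.
  - intros z Hz. apply continuity_pt_filterlim, (ex_derive_continuous (fun D => Kern D t)).
    exists (Kern1 z t). apply is_derive_Kern; [|lra]. apply Hc, Hb, Hz.
  - cbv beta in Ec. rewrite Ec, <- Rmult_assoc, Rabs_mult.
    apply Rmult_le_compat_r; [apply Rabs_pos|]. apply H; [|exact Ht]. apply Hc, Hb, Hc1.
Qed.

Lemma A_der_lipschitz (k : nat) (D0 : R) : 0 < D0 -> exists M, 0 <= M /\ forall D y y0,
  Rabs (D - D0) < D0 / 2 ->
  Rabs (A_der Kern k D y - A_der Kern k D0 y0) <= M * (Rabs (D - D0) + Rabs (y - y0)).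
Proof.
  intros HD.
  destruct (Kern_diff_abs_le D0 (weight k) HD (bigO_weight k)) as [M1 [HM1 H1]].
  destruct (oscillating_lipschitz 1 (INR k * (PI / 2)) 1 (fun t => weight k t * Kern D0 t)) as [M2 [HM2 H2]].
  - lra.
  - apply cont_pos_mult; [apply cont_pos_weight|apply cont_pos_Kern, HD].
  - apply bigO_mult with (- 1) 2; [apply bigO_weight|apply bigO_Kern, HD|lra].
  - exists (M1 + M2). split; [lra|]. intros D y y0 HDD.
    assert (HDp : 0 < D) by (apply Rabs_def2 in HDD; lra).
    replace (A_der Kern k D y - A_der Kern k D0 y0) with
      ((A_der Kern k D y - A_der Kern k D0 y) + (A_der Kern k D0 y - A_der Kern k D0 y0)) by ring.
    eapply Rle_trans; [apply Rabs_triang|].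
    assert (P1 : Rabs (A_der Kern k D y - A_der Kern k D0 y) <= M1 * Rabs (D - D0)).
    { unfold A_der. rewrite <- RInt_Rminus by (apply ex_RInt_A_int_Kern; assumption).
      apply RInt_01_bound; [apply ex_RInt_Rminus; apply ex_RInt_A_int_Kern; assumption|].
      intros t Ht. unfold A_int.
      rewrite <- Rmult_minus_distr_l, <- Rmult_minus_distr_l, Rabs_mult.
      rewrite <- (Rmult_1_l (M1 * _)).
      apply Rmult_le_compat; try apply Rabs_pos; [apply Rabs_le, COS_bound|].
      apply H1; [exact HDD|lra]. }
    assert (P2 : Rabs (A_der Kern k D0 y - A_der Kern k D0 y0) <= M2 * Rabs (y - y0)).
    { assert (E : forall y, A_der Kern k D0 y =
        RInt (fun t => cos (1 * y * ln t + INR k * (PI / 2)) * (weight k t * Kern D0 t)) 0 1).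
      { intros z. apply RInt_01_ext. intros t _. unfold A_int. rewrite Rmult_1_l. reflexivity. }
      rewrite !E. apply H2. }
    assert (Q1 := Rabs_pos (D - D0)). assert (Q2 := Rabs_pos (y - y0)). nra.
Qed.

(** * Expansion of G off the critical line *)

(** The Taylor remainders of order 3 at [v] and [- v] are averaged, so the odd terms cancel;
    [sinh_remainder] takes half the difference at order 4. *)
Lemma cosh_remainder (v : R) :
  Rabs ((exp v + exp (- v)) / 2 - 1 - v ^ 2 / 2) <= v ^ 4 * exp (Rabs v).
Proof.
  assert (H1 := exp_remainder 3 v). assert (H2 := exp_remainder 3 (- v)).
  rewrite Rabs_Ropp in H2.
  replace (v ^ 4) with (Rabs v ^ 4).
  2: { rewrite RPow_abs, Rabs_pos_eq; [reflexivity|]. replace (v ^ 4) with ((v ^ 2) ^ 2) by ring. apply pow2_ge_0. }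
  unfold exp_taylor in *. rewrite !sum_n_RS, !sum_O in *. simpl fact in *. simpl INR in *.
  apply Rabs_le_between in H1. apply Rabs_le_between in H2.
  apply Rabs_le. simpl pow in *. lra.
Qed.

Lemma sinh_remainder (v : R) :
  Rabs ((exp v - exp (- v)) / 2 - v - v ^ 3 / 6) <= Rabs v ^ 5 * exp (Rabs v).
Proof.
  assert (H1 := exp_remainder 4 v). assert (H2 := exp_remainder 4 (- v)).
  rewrite Rabs_Ropp in H2.
  unfold exp_taylor in *. rewrite !sum_n_RS, !sum_O in *. simpl fact in *. simpl INR in *.
  apply Rabs_le_between in H1. apply Rabs_le_between in H2.
  apply Rabs_le. simpl pow in *. lra.
Qed.

Lemma cos_add_PI (x : R) : cos (x + INR 2 * (PI / 2)) = - cos x.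
Proof. replace (x + INR 2 * (PI / 2)) with (x + PI) by (simpl; field). apply neg_cos. Qed.

Lemma cos_add_PI2 (x : R) : cos (x + INR 1 * (PI / 2)) = - sin x.
Proof. simpl INR. rewrite Rmult_1_l, cos_plus, cos_PI2, sin_PI2. ring. Qed.

Lemma cos_add_3PI2 (x : R) : cos (x + INR 3 * (PI / 2)) = sin x.
Proof.
  replace (x + INR 3 * (PI / 2)) with (x + PI / 2 + PI) by (simpl; field).
  rewrite neg_cos, cos_plus, cos_PI2, sin_PI2. ring.
Qed.

(** Around the critical line the two exponents are [- 1/2 + (x + i y)] and [- 1/2 - (x + i y)]; this
    symmetry produces hyperbolic functions of [x ln t]. *)
Lemma J_int_half (D x y al t : R) : J_int D (1 / 2 + x) y al t =
  exp (- (1 / 2) * ln t) * (exp (x * ln t) * cos (y * ln t + al) +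
    exp (- (x * ln t)) * cos (- (y * ln t) + al)) * Kern D t.
Proof.
  unfold J_int, cpow.
  replace ((1 / 2 + x - 1) * ln t) with (- (1 / 2) * ln t + x * ln t) by field.
  replace (- (1 / 2 + x) * ln t) with (- (1 / 2) * ln t + - (x * ln t)) by field.
  replace (- y * ln t) with (- (y * ln t)) by ring.
  rewrite !exp_plus. ring.
Qed.

Lemma exp_abs_ln_le (x t : R) : Rabs x <= 1 -> 0 < t <= 1 -> exp (Rabs (x * ln t)) <= exp (- (1) * ln t).
Proof.
  intros Hx Ht. assert (Hl := ln_le_0 t Ht). apply exp_le.
  rewrite Rabs_mult, (Rabs_left1 (ln t)) by exact Hl. nra.
Qed.

Lemma unif_bound_Kern_weight (D0 : R) (k : nat) : 0 < D0 -> exists M, 0 <= M /\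
  forall D t, Rabs (D - D0) < D0 / 2 -> 0 < t <= 1 ->
  Rabs (weight k t * exp (- (1) * ln t) * Kern D t) <= M.
Proof.
  intros HD. destruct (compact_around D0 HD) as [m [Hm Hc]].
  destruct (unif_bound_weight m 2 (fun t => weight k t * exp (- (1) * ln t)) Kern) as [M [HM H]].
  - apply bigO_mult with (- 1) (- (1)); [apply bigO_weight|apply bigO_pow|simpl; ring].
  - apply unif_bound_Kern, Hm.
  - exists M. split; [exact HM|]. intros D t HDD Ht. apply H; [apply Hc, HDD|exact Ht].
Qed.

(** Half the real part integrates [cosh (x ln t) cos (y ln t)] against [Kern / sqrt t]. The
    quadratic term of [cosh] gives [- x^2 / 2] times [A_der Kern 2], since two derivatives of the
    cosine change its sign. *)
Lemma J_ph_even (D0 : R) : 0 < D0 -> exists M, 0 <= M /\ forall D x y,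
  Rabs (D - D0) < D0 / 2 -> Rabs x <= 1 ->
  Rabs (J_ph D (1 / 2 + x) y 0 / 2 - (A_der Kern 0 D y - x ^ 2 / 2 * A_der Kern 2 D y)) <= M * x ^ 4.
Proof.
  intros HD0. destruct (unif_bound_Kern_weight D0 4 HD0) as [M [HM H]].
  exists M. split; [exact HM|]. intros D x y HDD Hx.
  assert (HD : 0 < D) by (apply Rabs_def2 in HDD; lra).
  assert (E0 := ex_RInt_J_int D (1 / 2 + x) y 0 HD).
  assert (E1 := ex_RInt_A_int_Kern 0 D y HD). assert (E2 := ex_RInt_A_int_Kern 2 D y HD).
  assert (E0' := ex_RInt_Rscal (/ 2) _ _ _ E0).
  assert (E2' := ex_RInt_Rscal (x ^ 2 / 2) _ _ _ E2).
  assert (E12 := ex_RInt_Rminus _ _ _ _ E1 E2').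
  unfold J_ph, A_der, Rdiv at 1. rewrite Rmult_comm.
  rewrite <- (RInt_Rscal (/ 2) (J_int D (1 / 2 + x) y 0)), <- (RInt_Rscal (x ^ 2 / 2) (A_int 2 Kern D y)),
    <- (RInt_Rminus (A_int 0 Kern D y) (fun t => x ^ 2 / 2 * A_int 2 Kern D y t)),
    <- (RInt_Rminus (fun t => / 2 * J_int D (1 / 2 + x) y 0 t)
         (fun t => A_int 0 Kern D y t - x ^ 2 / 2 * A_int 2 Kern D y t)) by assumption.
  apply RInt_01_bound; [apply ex_RInt_Rminus; assumption|].
  intros t Ht. specialize (H D t HDD ltac:(lra)).
  rewrite J_int_half. unfold A_int. rewrite cos_add_PI.
  replace (y * ln t + INR 0 * (PI / 2)) with (y * ln t) by (simpl; ring).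
  rewrite !Rplus_0_r, cos_neg.
  match goal with |- Rabs ?e <= _ => replace e with
    (cos (y * ln t) * (((exp (x * ln t) + exp (- (x * ln t))) / 2 - 1 - (x * ln t) ^ 2 / 2) *
      (exp (- (1 / 2) * ln t) * Kern D t))) by (unfold weight; simpl pow; field) end.
  rewrite Rabs_mult. rewrite <- (Rmult_1_l (M * x ^ 4)).
  apply Rmult_le_compat; try apply Rabs_pos; [apply Rabs_le, COS_bound|].
  rewrite Rabs_mult.
  assert (Hexp := exp_pos (Rabs (x * ln t))). assert (Hexp1 := exp_pos (- (1) * ln t)).
  assert (Hp4 : 0 <= (x * ln t) ^ 4).
  { replace ((x * ln t) ^ 4) with (((x * ln t) ^ 2) ^ 2) by ring. apply pow2_ge_0. }
  assert (Hx4 : 0 <= x ^ 4) by (replace (x ^ 4) with ((x ^ 2) ^ 2) by ring; apply pow2_ge_0).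
  eapply Rle_trans.
  { apply Rmult_le_compat_r; [apply Rabs_pos|].
    eapply Rle_trans; [apply cosh_remainder|].
    apply Rmult_le_compat_l; [exact Hp4|]. apply exp_abs_ln_le; [exact Hx|lra]. }
  rewrite (Rmult_comm M). eapply Rle_trans; [|apply Rmult_le_compat_l; [exact Hx4|exact H]].
  apply Req_le. rewrite Rpow_mult_distr. unfold weight.
  rewrite !Rabs_mult, (Rabs_pos_eq (exp (- (1) * ln t))) by lra.
  rewrite <- RPow_abs. replace (ln t ^ 4) with (Rabs (ln t) ^ 4); [ring|].
  rewrite RPow_abs. apply Rabs_pos_eq.
  replace (ln t ^ 4) with ((ln t ^ 2) ^ 2) by ring. apply pow2_ge_0.
Qed.

(** Half the imaginary part integrates [sinh (x ln t) sin (y ln t)]; the first and third derivatives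
    of the cosine are [- sin] and [sin], whence the signs. *)
Lemma J_ph_odd (D0 : R) : 0 < D0 -> exists M, 0 <= M /\ forall D x y,
  Rabs (D - D0) < D0 / 2 -> Rabs x <= 1 ->
  Rabs (J_ph D (1 / 2 + x) y (- (PI / 2)) / 2 -
    (x ^ 3 / 6 * A_der Kern 3 D y - x * A_der Kern 1 D y)) <= M * Rabs x ^ 5.
Proof.
  intros HD0. destruct (unif_bound_Kern_weight D0 5 HD0) as [M [HM H]].
  exists M. split; [exact HM|]. intros D x y HDD Hx.
  assert (HD : 0 < D) by (apply Rabs_def2 in HDD; lra).
  assert (E0 := ex_RInt_J_int D (1 / 2 + x) y (- (PI / 2)) HD).
  assert (E1 := ex_RInt_A_int_Kern 1 D y HD). assert (E3 := ex_RInt_A_int_Kern 3 D y HD).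
  assert (E0' := ex_RInt_Rscal (/ 2) _ _ _ E0).
  assert (E3' := ex_RInt_Rscal (x ^ 3 / 6) _ _ _ E3).
  assert (E1' := ex_RInt_Rscal x _ _ _ E1).
  assert (E31 := ex_RInt_Rminus _ _ _ _ E3' E1').
  unfold J_ph, A_der, Rdiv at 1. rewrite Rmult_comm.
  rewrite <- (RInt_Rscal (/ 2) (J_int D (1 / 2 + x) y (- (PI / 2)))), <- (RInt_Rscal (x ^ 3 / 6) (A_int 3 Kern D y)),
    <- (RInt_Rscal x (A_int 1 Kern D y)),
    <- (RInt_Rminus (fun t => x ^ 3 / 6 * A_int 3 Kern D y t) (fun t => x * A_int 1 Kern D y t)),
    <- (RInt_Rminus (fun t => / 2 * J_int D (1 / 2 + x) y (- (PI / 2)) t)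
         (fun t => x ^ 3 / 6 * A_int 3 Kern D y t - x * A_int 1 Kern D y t)) by assumption.
  apply RInt_01_bound; [apply ex_RInt_Rminus; assumption|].
  intros t Ht. specialize (H D t HDD ltac:(lra)).
  rewrite J_int_half. unfold A_int. rewrite cos_add_PI2, cos_add_3PI2.
  replace (cos (y * ln t + - (PI / 2))) with (sin (y * ln t))
    by (rewrite cos_plus, cos_neg, sin_neg, cos_PI2, sin_PI2; ring).
  replace (cos (- (y * ln t) + - (PI / 2))) with (- sin (y * ln t))
    by (rewrite cos_plus, !cos_neg, !sin_neg, cos_PI2, sin_PI2; ring).
  match goal with |- Rabs ?e <= _ => replace e with
    (sin (y * ln t) * (((exp (x * ln t) - exp (- (x * ln t))) / 2 - x * ln t - (x * ln t) ^ 3 / 6) *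
      (exp (- (1 / 2) * ln t) * Kern D t))) by (unfold weight; simpl pow; field) end.
  rewrite Rabs_mult. rewrite <- (Rmult_1_l (M * Rabs x ^ 5)).
  apply Rmult_le_compat; try apply Rabs_pos; [apply Rabs_le, SIN_bound|].
  rewrite Rabs_mult.
  assert (Hexp := exp_pos (Rabs (x * ln t))). assert (Hexp1 := exp_pos (- (1) * ln t)).
  assert (Hx5 : 0 <= Rabs x ^ 5) by (apply pow_le, Rabs_pos).
  eapply Rle_trans.
  { apply Rmult_le_compat_r; [apply Rabs_pos|].
    eapply Rle_trans; [apply sinh_remainder|].
    apply Rmult_le_compat_l; [apply pow_le, Rabs_pos|]. apply exp_abs_ln_le; [exact Hx|lra]. }
  rewrite (Rmult_comm M). eapply Rle_trans; [|apply Rmult_le_compat_l; [exact Hx5|exact H]].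
  apply Req_le. rewrite Rabs_mult, Rpow_mult_distr. unfold weight.
  rewrite !Rabs_mult, (Rabs_pos_eq (exp (- (1) * ln t))) by lra.
  rewrite <- RPow_abs. ring.
Qed.

(* [p_der 0 y] is [1 / (2 s (s - 1))] at [s = 1/2 + i y], and [p_der k] is its
   [k]-th derivative for [k <= 3]. *)
Definition p_der (k : nat) (y : R) : R :=
  let w := 1 + 4 * y ^ 2 in
  match k with
  | 0%nat => - 2 / w
  | 1%nat => 16 * y / w ^ 2
  | 2%nat => 16 * (1 - 12 * y ^ 2) / w ^ 3
  | _ => - 768 * y * (1 - 4 * y ^ 2) / w ^ 4
  end.

Lemma is_derive_p_der (k : nat) (y : R) : (k < 3)%nat -> is_derive (p_der k) y (p_der (S k) y).
Proof.
  intros Hk. assert (Hw : 1 + 4 * y ^ 2 <> 0) by nra.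
  destruct k as [|[|[|k]]]; [| | |lia]; unfold p_der; auto_derive;
    try (repeat split; simpl in Hw; nra); field; exact Hw.
Qed.

Lemma continuous_p_der (k : nat) (y : R) : continuous (p_der k) y.
Proof.
  assert (Hw : 1 + 4 * y ^ 2 <> 0) by nra.
  apply (ex_derive_continuous (p_der k)).
  destruct k as [|[|[|k]]]; unfold p_der; auto_derive;
    repeat split; simpl in *; repeat (apply Rmult_integral_contrapositive_currified; try lra); nra.
Qed.

Definition G_der (k : nat) (D y : R) : R := p_der k y + A_der Kern k D y.

(* In terms of [X = 4 x^2] and [w = 1 + 4 y^2], the squared modulus of
   [4 s (s - 1)] is [(X - w)^2 + 4 X (w - 1)]. *)
Lemma modulus_lower (X w : R) : 0 <= X <= 1 / 4 -> 1 <= w ->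
  w ^ 2 / 2 <= (X - w) ^ 2 + 4 * X * (w - 1).
Proof. intros. nra. Qed.

Lemma Rabs_div_le (p q B C : R) : 0 < B <= q -> Rabs p <= C * B -> Rabs (p / q) <= C.
Proof.
  intros [HB Hq] Hp. unfold Rdiv. rewrite Rabs_mult, Rabs_inv, (Rabs_pos_eq q) by lra.
  apply Rle_div_l; [lra|]. eapply Rle_trans; [exact Hp|].
  assert (0 <= C). { assert (0 <= C * B) by (eapply Rle_trans; [apply Rabs_pos|exact Hp]). nra. }
  nra.
Qed.

(** At [s = 1/2 + x + i y] one has [s (s - 1) = u + i v], and the last fraction is the real part of
    [1 / (2 s (s - 1))]. The error is an exact multiple of [X^2], with a quotient that
    [modulus_lower] bounds uniformly in [y]. *)
Lemma p_der_even (x y : R) : Rabs x <= 1 / 4 ->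
  let u := x ^ 2 - y ^ 2 - 1 / 4 in let v := 2 * x * y in
  Rabs (p_der 0 y - x ^ 2 / 2 * p_der 2 y - u / (2 * (u ^ 2 + v ^ 2))) <= 3200 * x ^ 4.
Proof.
  intros Hx u v. apply Rabs_le_between in Hx.
  set (X := 4 * x ^ 2). set (w := 1 + 4 * y ^ 2).
  assert (HX : 0 <= X <= 1 / 4) by (unfold X; nra).
  assert (Hw : 1 <= w) by (unfold w; nra).
  assert (HN := modulus_lower X w HX Hw).
  set (N := (X - w) ^ 2 + 4 * X * (w - 1)) in *.
  assert (HN0 : 0 < N) by nra.
  assert (EN : u ^ 2 + v ^ 2 = N / 16) by (unfold u, v, N, X, w; field).
  (* What remains of the numerator after the terms of order 0 and 1 in [X] have cancelled. *)
  set (P := w ^ 2 + (4 - 3 * w) * (2 * w - 4) + X * (4 - 3 * w)).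
  replace (p_der 0 y - x ^ 2 / 2 * p_der 2 y - u / (2 * (u ^ 2 + v ^ 2))) with
    (X ^ 2 * (-2 * P / (N * w ^ 3))).
  2: { rewrite EN. unfold p_der. cbv zeta. fold w.
       replace (1 - 12 * y ^ 2) with (4 - 3 * w) by (unfold w; ring).
       replace u with ((X - w) / 4) by (unfold u, X, w; field).
       replace (x ^ 2) with (X / 4) by (unfold X; field).
       replace N with ((X - w) ^ 2 + 4 * X * (w - 1)) in * by reflexivity.
       unfold P. field. split; lra. }
  replace (3200 * x ^ 4) with (X ^ 2 * 200) by (unfold X; ring).
  assert (HX2 : 0 <= X ^ 2) by apply pow2_ge_0.
  rewrite Rabs_mult, (Rabs_pos_eq (X ^ 2)) by exact HX2.
  apply Rmult_le_compat_l; [exact HX2|].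
  assert (Hw3 : 1 <= w ^ 3) by (apply pow_R1_Rle, Hw).
  apply Rabs_div_le with (w ^ 2 / 2).
  - split; [nra|]. apply Rle_trans with (N * 1); [lra|]. apply Rmult_le_compat_l; lra.
  - unfold P. apply Rabs_le. split; nra.
Qed.

Lemma p_der_odd (x y : R) : Rabs x <= 1 / 4 ->
  let u := x ^ 2 - y ^ 2 - 1 / 4 in let v := 2 * x * y in
  Rabs (x ^ 3 / 6 * p_der 3 y - x * p_der 1 y + v / (2 * (u ^ 2 + v ^ 2))) <= 32000 * Rabs x ^ 5.
Proof.
  intros Hx u v. assert (Hx' := Hx). apply Rabs_le_between in Hx'.
  set (X := 4 * x ^ 2). set (w := 1 + 4 * y ^ 2).
  assert (HX : 0 <= X <= 1 / 4) by (unfold X; nra).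
  assert (Hw : 1 <= w) by (unfold w; nra).
  assert (HN := modulus_lower X w HX Hw).
  set (N := (X - w) ^ 2 + 4 * X * (w - 1)) in *.
  assert (HN0 : 0 < N) by nra.
  assert (EN : u ^ 2 + v ^ 2 = N / 16) by (unfold u, v, N, X, w; field).
  set (P := - w ^ 2 + 4 * (w - 2) ^ 2 + 2 * X * (w - 2)).
  replace (x ^ 3 / 6 * p_der 3 y - x * p_der 1 y + v / (2 * (u ^ 2 + v ^ 2))) with
    (x * X ^ 2 * (16 * y * P / (N * w ^ 4))).
  2: { rewrite EN. unfold p_der. cbv zeta. fold w.
       replace (1 - 4 * y ^ 2) with (2 - w) by (unfold w; ring).
       replace (x ^ 3) with (x * (X / 4)) by (unfold X; field).
       replace v with (2 * x * y) by reflexivity.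
       replace N with ((X - w) ^ 2 + 4 * X * (w - 1)) in * by reflexivity.
       unfold P. field. split; lra. }
  assert (HX2 : 0 <= X ^ 2) by apply pow2_ge_0.
  replace (32000 * Rabs x ^ 5) with (Rabs x * X ^ 2 * 2000).
  2: { unfold X. rewrite <- (pow2_abs x). ring. }
  rewrite !Rabs_mult, (Rabs_pos_eq (X ^ 2)) by exact HX2.
  apply Rmult_le_compat_l; [apply Rmult_le_pos; [apply Rabs_pos|exact HX2]|].
  assert (Hw3 : 1 <= w ^ 3) by (apply pow_R1_Rle, Hw).
  assert (Hyw : Rabs y <= w) by (unfold w; apply Rabs_le; nra).
  apply Rabs_div_le with (w ^ 3 / 2).
  - split; [nra|]. apply Rle_trans with (w ^ 2 / 2 * w ^ 4).
    + replace (w ^ 2 / 2 * w ^ 4) with (w ^ 3 / 2 * w ^ 3) by field. nra.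
    + apply Rmult_le_compat_r; [|exact HN]. replace (w ^ 4) with ((w ^ 2) ^ 2) by ring. apply pow2_ge_0.
  - rewrite !Rabs_mult, (Rabs_pos_eq 16) by lra.
    assert (HP : Rabs P <= 40 * w ^ 2) by (unfold P; apply Rabs_le; split; nra).
    apply Rle_trans with (16 * w * (40 * w ^ 2)).
    + apply Rmult_le_compat; try apply Rabs_pos; [|apply Rmult_le_compat_l; lra|exact HP].
      apply Rmult_le_pos; [lra|apply Rabs_pos].
    + replace (16 * w * (40 * w ^ 2)) with (640 * w ^ 3) by ring. nra.
Qed.

(** The real and imaginary parts of the zero equation divided by [2 s (s - 1) = 2 (u + i v)]. *)
Lemma zero_real_equations (D : R) (f : C -> C) (x y : R) : 0 < D -> is_zeta2 D f ->
  Rabs x <= 1 / 4 -> f (1 / 2 + x, y) = RtoC 0 ->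
  let u := x ^ 2 - y ^ 2 - 1 / 4 in let v := 2 * x * y in
  J_ph D (1 / 2 + x) y 0 / 2 + u / (2 * (u ^ 2 + v ^ 2)) = 0 /\
  J_ph D (1 / 2 + x) y (- (PI / 2)) / 2 - v / (2 * (u ^ 2 + v ^ 2)) = 0.
Proof.
  intros HD Hf Hx H0 u v. apply Rabs_le_between in Hx.
  assert (E := zero_equation D f (1 / 2 + x, y) HD Hf).
  unfold Re in E; simpl fst in E. specialize (E ltac:(lra)).
  assert (Hs1 : (1 / 2 + x, y) <> RtoC 1) by (intros E1; injection E1; lra).
  specialize (E Hs1 H0). unfold J_c, Re, Im in E; simpl fst in E; simpl snd in E.
  set (Jr := J_ph D (1 / 2 + x) y 0) in *. set (Ji := J_ph D (1 / 2 + x) y (- (PI / 2))) in *.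
  assert (E1 : 1 + u * Jr - v * Ji = 0).
  { assert (E1 := f_equal fst E). unfold Cplus, Cmult, Cminus, Copp, RtoC in E1; simpl in E1.
    unfold u, v. rewrite <- E1. field. }
  assert (E2 : u * Ji + v * Jr = 0).
  { assert (E2 := f_equal snd E). unfold Cplus, Cmult, Cminus, Copp, RtoC in E2; simpl in E2.
    unfold u, v. rewrite <- E2. field. }
  (* If [s (s - 1)] vanished, the zero equation would read [1 = 0]. *)
  assert (Hn : u ^ 2 + v ^ 2 <> 0).
  { intros Hn. assert (u = 0) by nra. assert (v = 0) by nra. rewrite H, H1 in E1. lra. }
  split.
  - apply (Rmult_eq_reg_l (2 * (u ^ 2 + v ^ 2))); [|lra]. rewrite Rmult_0_r.
    transitivity (u * (1 + u * Jr - v * Ji) + v * (u * Ji + v * Jr)); [field; lra|].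
    rewrite E1, E2. ring.
  - apply (Rmult_eq_reg_l (2 * (u ^ 2 + v ^ 2))); [|lra]. rewrite Rmult_0_r.
    transitivity (- v * (1 + u * Jr - v * Ji) + u * (u * Ji + v * Jr)); [field; lra|].
    rewrite E1, E2. ring.
Qed.

(** The expansions of the integral and of the rational part are added; their sum vanishes exactly at
    a zero. The factor [x] is left in the second line, so that [x = 0] covers critical zeros too. *)
Lemma zero_expansion (D0 : R) : 0 < D0 -> exists M, 0 <= M /\ forall D f x y,
  Rabs (D - D0) < D0 / 2 -> Rabs x <= 1 / 4 -> is_zeta2 D f -> f (1 / 2 + x, y) = RtoC 0 ->
  Rabs (G_der 0 D y - x ^ 2 / 2 * G_der 2 D y) <= M * x ^ 4 /\
  Rabs (x ^ 3 / 6 * G_der 3 D y - x * G_der 1 D y) <= M * Rabs x ^ 5.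
Proof.
  intros HD0.
  destruct (J_ph_even D0 HD0) as [M1 [HM1 H1]]. destruct (J_ph_odd D0 HD0) as [M2 [HM2 H2]].
  exists (M1 + M2 + 32000). split; [lra|]. intros D f x y HDD Hx Hf H0.
  assert (HD : 0 < D) by (apply Rabs_def2 in HDD; lra).
  destruct (zero_real_equations D f x y HD Hf Hx H0) as [Z1 Z2].
  assert (P1 := p_der_even x y Hx). assert (P2 := p_der_odd x y Hx). cbv zeta in P1, P2.
  specialize (H1 D x y HDD ltac:(lra)). specialize (H2 D x y HDD ltac:(lra)).
  assert (Hx4 : 0 <= x ^ 4) by (replace (x ^ 4) with ((x ^ 2) ^ 2) by ring; apply pow2_ge_0).
  assert (Hx5 : 0 <= Rabs x ^ 5) by (apply pow_le, Rabs_pos).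
  unfold G_der. split.
  - match type of P1 with Rabs ?p <= _ => match type of H1 with Rabs ?q <= _ =>
      replace (p_der 0 y + A_der Kern 0 D y - x ^ 2 / 2 * (p_der 2 y + A_der Kern 2 D y)) with (p - q) by lra end end.
    eapply Rle_trans; [apply Rabs_triang|]. rewrite Rabs_Ropp. nra.
  - match type of P2 with Rabs ?p <= _ => match type of H2 with Rabs ?q <= _ =>
      replace (x ^ 3 / 6 * (p_der 3 y + A_der Kern 3 D y) - x * (p_der 1 y + A_der Kern 1 D y)) with (p - q) by lra end end.
    eapply Rle_trans; [apply Rabs_triang|]. rewrite Rabs_Ropp. nra.
Qed.

(** * The coefficients as derivatives of G, and the local behaviour of G *)

Lemma exp_half_ln (t : R) : 0 < t -> exp (- (1 / 2) * ln t) = / sqrt t.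
Proof.
  intros Ht. rewrite <- Rpower_sqrt by exact Ht. unfold Rpower. rewrite <- exp_Ropp. f_equal. field.
Qed.

(** Since [sqrt t = t / sqrt t], the weight contains the factor [t] that turns [PI * bracket_ab]
    into [Kern1]. *)
Lemma coef_a_A_der (y D : R) : 0 < D -> coef_a y D = A_der Kern1 0 D y.
Proof.
  intros HD. unfold coef_a, A_der. assert (HPI := PI_RGT_0).
  assert (E := ex_RInt_A_int_Kern1 0 D y HD).
  assert (H : forall t, 0 < t -> / PI * A_int 0 Kern1 D y t = sqrt t * cos (y * ln t) * bracket_ab D t).
  { intros t Ht. unfold A_int, weight. rewrite <- (Kern1_bracket D t HD Ht), exp_half_ln by exact Ht.
    replace (y * ln t + INR 0 * (PI / 2)) with (y * ln t) by (simpl; ring).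
    replace (PI * t * bracket_ab D t) with (PI * (sqrt t * sqrt t) * bracket_ab D t)
      by (rewrite sqrt_sqrt by lra; reflexivity).
    rewrite pow_O. field.
    split; [apply Rgt_not_eq, sqrt_lt_R0, Ht|lra]. }
  rewrite (RInt_01_ext _ (fun t => / PI * A_int 0 Kern1 D y t)) by (intros t Ht; symmetry; apply H; lra).
  rewrite RInt_Rscal by exact E. field. lra.
Qed.

Lemma coef_b_A_der (y D : R) : 0 < D -> coef_b y D = - A_der Kern1 1 D y.
Proof.
  intros HD. unfold coef_b, A_der. assert (HPI := PI_RGT_0).
  assert (E := ex_RInt_A_int_Kern1 1 D y HD).
  assert (H : forall t, 0 < t -> - / PI * A_int 1 Kern1 D y t = sqrt t * sin (y * ln t) * ln t * bracket_ab D t).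
  { intros t Ht. unfold A_int, weight. rewrite <- (Kern1_bracket D t HD Ht), exp_half_ln by exact Ht.
    rewrite cos_add_PI2.
    replace (PI * t * bracket_ab D t) with (PI * (sqrt t * sqrt t) * bracket_ab D t)
      by (rewrite sqrt_sqrt by lra; reflexivity).
    field. split; [apply Rgt_not_eq, sqrt_lt_R0, Ht|lra]. }
  rewrite (RInt_01_ext _ (fun t => - / PI * A_int 1 Kern1 D y t)) by (intros t Ht; symmetry; apply H; lra).
  rewrite RInt_Rscal by exact E. field. lra.
Qed.

Lemma coef_c_G_der (y D : R) : 0 < D -> coef_c y D = G_der 2 D y / 2.
Proof.
  intros HD. unfold coef_c, G_der, A_der.
  assert (E := ex_RInt_A_int_Kern 2 D y HD).
  rewrite (RInt_01_ext _ (fun t => -1 * A_int 2 Kern D y t)).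
  2: { intros t Ht. unfold A_int, weight. rewrite Kern_bracket, cos_add_PI, exp_half_ln by lra.
       real_eq.
       field. apply Rgt_not_eq, sqrt_lt_R0. lra. }
  rewrite RInt_Rscal by exact E. unfold p_der. field. nra.
Qed.

Lemma coef_d_G_der (y D : R) : 0 < D -> coef_d y D = - G_der 3 D y / 6.
Proof.
  intros HD. unfold coef_d, G_der, A_der.
  assert (E := ex_RInt_A_int_Kern 3 D y HD).
  rewrite (RInt_01_ext _ (fun t => 1 * A_int 3 Kern D y t)).
  2: { intros t Ht. unfold A_int, weight. rewrite Kern_bracket, cos_add_3PI2, exp_half_ln by lra.
       real_eq.
       field. apply Rgt_not_eq, sqrt_lt_R0. lra. }
  rewrite RInt_Rscal by exact E. unfold p_der. field. nra.
Qed.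

Lemma is_derive_G_der_y (k : nat) (D y : R) : 0 < D -> (k < 3)%nat ->
  is_derive (fun y => G_der k D y) y (G_der (S k) D y).
Proof.
  intros HD Hk. unfold G_der. apply (is_derive_Rplus (p_der k) (fun y => A_der Kern k D y)).
  - apply is_derive_p_der, Hk.
  - apply is_derive_A_der_y, HD.
Qed.

Lemma G_der_mvt (k : nat) (D y z : R) : 0 < D -> (k < 3)%nat ->
  exists c, Rabs (c - y) <= Rabs (z - y) /\ G_der k D z - G_der k D y = (z - y) * G_der (S k) D c.
Proof.
  intros HD Hk.
  destruct (MVT_gen (fun y => G_der k D y) y z (fun y => G_der (S k) D y)) as [c [Hc E]].
  - intros x _. apply is_derive_G_der_y; assumption.
  - intros x _. apply continuity_pt_filterlim, (ex_derive_continuous (fun y => G_der k D y)).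
    exists (G_der (S k) D x). apply is_derive_G_der_y; assumption.
  - exists c. split; [|rewrite E; ring]. revert Hc. unfold Rmin, Rmax, Rabs.
    repeat destruct Rle_dec; repeat destruct Rcase_abs; lra.
Qed.

Lemma G_der_continuous (k : nat) (D0 y0 eps : R) : 0 < D0 -> 0 < eps ->
  exists r, 0 < r <= D0 / 2 /\ forall D y, Rabs (D - D0) < r -> Rabs (y - y0) < r ->
  Rabs (G_der k D y - G_der k D0 y0) < eps.
Proof.
  intros HD0 He. destruct (A_der_lipschitz k D0 HD0) as [M [HM H]].
  assert (Hc := continuous_p_der k y0). apply continuity_pt_filterlim in Hc.
  destruct (Hc (eps / 2)) as [d [Hd Hp]]; [lra|].
  set (r := Rmin (Rmin d (D0 / 2)) (eps / (4 * (M + 1)))).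
  assert (Hr1 : r <= d) by (eapply Rle_trans; apply Rmin_l).
  assert (Hr2 : r <= D0 / 2) by (eapply Rle_trans; [apply Rmin_l|apply Rmin_r]).
  assert (Hr3 : r <= eps / (4 * (M + 1))) by apply Rmin_r.
  assert (Hr : 0 < r).
  { apply Rmin_pos; [apply Rmin_pos; lra|apply Rdiv_lt_0_compat; lra]. }
  exists r. split; [lra|]. intros D y HD Hy. unfold G_der.
  replace (p_der k y + A_der Kern k D y - (p_der k y0 + A_der Kern k D0 y0)) with
    ((p_der k y - p_der k y0) + (A_der Kern k D y - A_der Kern k D0 y0)) by ring.
  eapply Rle_lt_trans; [apply Rabs_triang|].
  assert (B1 : Rabs (p_der k y - p_der k y0) < eps / 2).
  { destruct (Req_dec y y0) as [->|Hn]; [rewrite Rminus_diag, Rabs_R0; lra|].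
    apply (Hp y). split; [split; [exact I|auto]|]. simpl. unfold R_dist. lra. }
  assert (B2 := H D y y0 ltac:(lra)).
  assert (B3 : M * (Rabs (D - D0) + Rabs (y - y0)) <= eps / 2).
  { apply Rle_trans with ((M + 1) * (2 * (eps / (4 * (M + 1))))); [|apply Req_le; field; lra].
    apply Rmult_le_compat; try lra.
    generalize (Rabs_pos (D - D0)) (Rabs_pos (y - y0)); lra. }
  lra.
Qed.

Lemma G_der_D_expansion (k : nat) (D0 y eps : R) : 0 < D0 -> 0 < eps ->
  exists r, 0 < r /\ forall D, Rabs (D - D0) < r ->
  Rabs (G_der k D y - G_der k D0 y - (D - D0) * A_der Kern1 k D0 y) <= eps * Rabs (D - D0).
Proof.
  intros HD0 He. assert (H := is_derive_A_der_D k D0 y HD0). apply is_derive_Reals in H.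
  destruct (H eps He) as [d Hd]. exists d. split; [apply cond_pos|]. intros D HD.
  unfold G_der.
  replace (p_der k y + A_der Kern k D y - (p_der k y + A_der Kern k D0 y)) with (A_der Kern k D y - A_der Kern k D0 y) by ring.
  destruct (Req_dec D D0) as [->|Hn].
  - rewrite !Rminus_diag, Rmult_0_l, Rminus_0_r, Rabs_R0. lra.
  - assert (Hn' : D - D0 <> 0) by lra. specialize (Hd (D - D0) Hn' HD).
    replace (D0 + (D - D0)) with D in Hd by ring.
    replace (A_der Kern k D y - A_der Kern k D0 y - (D - D0) * A_der Kern1 k D0 y) with
      (((A_der Kern k D y - A_der Kern k D0 y) / (D - D0) - A_der Kern1 k D0 y) * (D - D0)) by (field; exact Hn').
    rewrite Rabs_mult. apply Rmult_le_compat_r; [apply Rabs_pos|lra].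
Qed.

(** * Edge zeros *)

(** The case [x = 0] of [zero_expansion], where the error bound is 0. *)
Lemma critical_zero_Gk0 (zeta2 : R -> C -> C)
  (zeta2_spec : forall Delta : R, 0 < Delta -> is_zeta2 Delta (zeta2 Delta)) (D y : R) :
  critical_zero zeta2 D y -> G_der 0 D y = 0.
Proof.
  intros [HD H0]. destruct (zero_expansion D HD) as [M [HM H]].
  destruct (H D (zeta2 D) 0 y) as [H1 _].
  - rewrite Rminus_diag, Rabs_R0. lra.
  - rewrite Rabs_R0. lra.
  - apply zeta2_spec, HD.
  - rewrite Rplus_0_r. exact H0.
  - assert (H2 : Rabs (G_der 0 D y) <= 0).
    { replace (G_der 0 D y) with (G_der 0 D y - 0 ^ 2 / 2 * G_der 2 D y) by field. lra. }
    destruct (Req_dec (G_der 0 D y) 0) as [E|E]; [exact E|].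
    generalize (Rabs_pos_lt _ E). lra.
Qed.

(** [G] vanishes at [(D0, y0)] and at [(D (y0 + h), y0 + h)]. As [D' = 0], the change of [D] is
    [o(h)], and with it the change of [G] due to [D]; so [h] times a nearby value of [G_y] is [o(h)]
    as well. *)
Lemma edge_Gk1 (zeta2 : R -> C -> C)
  (zeta2_spec : forall Delta : R, 0 < Delta -> is_zeta2 Delta (zeta2 Delta)) (D0 y0 : R) :
  left_edge_zero zeta2 D0 y0 -> G_der 1 D0 y0 = 0.
Proof.
  intros [[HD0 Hz0] [D [[HDy Hloc] [Hder _]]]].
  destruct (Req_dec (G_der 1 D0 y0) 0) as [E|E]; [exact E|exfalso].
  set (e := Rabs (G_der 1 D0 y0)). assert (He : 0 < e) by (apply Rabs_pos_lt, E).
  assert (Hd : is_derive D y0 0).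
  { rewrite <- Hder. apply Derive_correct.
    exact (proj1 (locally_singleton _ _ Hloc) 1%nat). }
  apply is_derive_Reals in Hd.
  destruct (G_der_continuous 1 D0 y0 (e / 3) HD0 ltac:(lra)) as [r [[Hr Hr2] Hc]].
  destruct (A_der_lipschitz 0 D0 HD0) as [L [HL HLip]].
  (* Then [L * e1 <= e / 3], while [G_y] varies by less than [e / 3], contradicting [e = |G_y|];
     [e1 <= 1] keeps [D (y0 + h)] within [r] of [D0]. *)
  set (e1 := Rmin 1 (e / (3 * (L + 1)))).
  assert (He1 : 0 < e1) by (apply Rmin_pos; [lra|apply Rdiv_lt_0_compat; lra]).
  destruct (Hd e1 He1) as [d1 Hd1]. destruct Hloc as [d2 Hd2].
  set (h := Rmin (r / 2) (Rmin (d1 / 2) (d2 / 2))).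
  assert (P1 := cond_pos d1). assert (P2 := cond_pos d2).
  assert (Hh : 0 < h) by (repeat apply Rmin_pos; lra).
  assert (Hh1 : h <= r / 2) by apply Rmin_l.
  assert (Hh2 : h <= d1 / 2) by (eapply Rle_trans; [apply Rmin_r|apply Rmin_l]).
  assert (Hh3 : h <= d2 / 2) by (eapply Rle_trans; [apply Rmin_r|apply Rmin_r]).
  assert (Hh0 : h <> 0) by lra.
  specialize (Hd1 h Hh0). rewrite Rabs_pos_eq in Hd1 by lra. specialize (Hd1 ltac:(lra)).
  rewrite HDy, Rminus_0_r in Hd1.
  assert (HDh : Rabs (D (y0 + h) - D0) <= e1 * h).
  { unfold Rdiv in Hd1. rewrite Rabs_mult, Rabs_inv, (Rabs_pos_eq h) in Hd1 by lra.
    apply Rlt_le. apply (Rmult_lt_compat_r h) in Hd1; [|exact Hh].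
    rewrite Rmult_assoc, Rinv_l, Rmult_1_r in Hd1 by exact Hh0. exact Hd1. }
  assert (He11 : e1 <= 1) by apply Rmin_l.
  assert (He12 : e1 <= e / (3 * (L + 1))) by apply Rmin_r.
  assert (HDr : Rabs (D (y0 + h) - D0) < r).
  { eapply Rle_lt_trans; [exact HDh|]. nra. }
  destruct (Hd2 (y0 + h)) as [_ Hcz].
  { change (Rabs (y0 + h - y0) < d2). replace (y0 + h - y0) with h by ring.
    rewrite Rabs_pos_eq; lra. }
  assert (Z1 := critical_zero_Gk0 zeta2 zeta2_spec _ _ Hcz).
  assert (Z0 := critical_zero_Gk0 zeta2 zeta2_spec D0 y0 (conj HD0 Hz0)).
  destruct (G_der_mvt 0 (D (y0 + h)) y0 (y0 + h) (proj1 Hcz) ltac:(lia)) as [c [Hcc Ec]].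
  replace (y0 + h - y0) with h in * by ring. rewrite (Rabs_pos_eq h) in Hcc by lra.
  assert (Hcl := Hc (D (y0 + h)) c HDr ltac:(lra)).
  assert (Hlip := HLip (D (y0 + h)) y0 y0 ltac:(lra)).
  rewrite Rminus_diag, Rabs_R0, Rplus_0_r in Hlip.
  assert (EA : G_der 0 (D (y0 + h)) y0 = A_der Kern 0 (D (y0 + h)) y0 - A_der Kern 0 D0 y0).
  { unfold G_der in Z0 |- *. lra. }
  rewrite Z1, EA in Ec.
  assert (B : Rabs (h * G_der 1 (D (y0 + h)) c) <= L * (e1 * h)).
  { replace (h * G_der 1 (D (y0 + h)) c) with (- (A_der Kern 0 (D (y0 + h)) y0 - A_der Kern 0 D0 y0)) by lra.
    rewrite Rabs_Ropp. eapply Rle_trans; [exact Hlip|]. apply Rmult_le_compat_l; assumption. }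
  rewrite Rabs_mult, (Rabs_pos_eq h) in B by lra.
  assert (B2 : Rabs (G_der 1 (D (y0 + h)) c) <= L * e1) by nra.
  assert (B3 : L * e1 <= e / 3).
  { apply Rle_trans with ((L + 1) * (e / (3 * (L + 1)))); [|apply Req_le; field; lra].
    apply Rmult_le_compat; lra. }
  assert (B4 : e <= Rabs (G_der 1 (D (y0 + h)) c) + Rabs (G_der 1 (D (y0 + h)) c - G_der 1 D0 y0)).
  { unfold e. replace (G_der 1 D0 y0) with (G_der 1 (D (y0 + h)) c - (G_der 1 (D (y0 + h)) c - G_der 1 D0 y0)) at 1 by ring.
    eapply Rle_trans; [apply Rabs_triang|]. rewrite Rabs_Ropp. lra. }
  lra.
Qed.

(* The Newton polygon of [a D + c eta^2 - b D eta - d eta^3] at [0], split into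
   real and imaginary parts: [h = - D], [q = x^2] and [eta = dl - i x]. *)
Lemma edge_algebra (a b c d eps : R) : c <> 0 -> 0 < - a / c -> 0 < eps ->
  exists e, 0 < e /\ forall h q dl, 0 < h -> 0 <= q ->
  Rabs (a * h + c * q) <= e * (h + Rabs dl + q) ->
  Rabs (b * h + 2 * c * dl + d * q) <= e * (h + Rabs dl + q) ->
  Rabs (q - - a / c * h) <= eps * h /\
  Rabs (dl - - (1 / (2 * c)) * (b - a * d / c) * h) <= eps * h.
Proof.
  intros Hc Hk He. set (k := - a / c) in *.
  assert (Hac : 0 < Rabs c) by (apply Rabs_pos_lt, Hc).
  assert (Hb := Rabs_pos b). assert (Hd := Rabs_pos d).
  (* [K0] will bound [|dl|] by [h + q], [K1] bounds the total [h + |dl| + q] by [h], and [K2]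
     transfers the errors of both equations to [dl]. The four bounds on [e] are used in this
     order. *)
  set (K0 := (Rabs b + Rabs d + Rabs c) / Rabs c).
  assert (HK0 : 0 < K0) by (apply Rdiv_lt_0_compat; lra).
  set (K1 := (K0 + 1) * (2 * k + 2)).
  assert (HK1 : 0 < K1) by (apply Rmult_lt_0_compat; lra).
  set (K2 := (1 + Rabs d / Rabs c) / (2 * Rabs c)).
  assert (Hdc : 0 <= Rabs d / Rabs c) by (apply Rdiv_le_0_compat; lra).
  assert (HK2 : 0 < K2) by (apply Rdiv_lt_0_compat; lra).
  set (e := Rmin (Rmin (Rabs c) (Rabs c / (2 * (K0 + 1)))) (Rmin (eps * Rabs c / K1) (eps / (K1 * K2)))).
  assert (He0 : 0 < e).
  { repeat apply Rmin_pos; try lra; apply Rdiv_lt_0_compat; nra. }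
  assert (He1 : e <= Rabs c) by (eapply Rle_trans; [apply Rmin_l|apply Rmin_l]).
  assert (He2 : e * (K0 + 1) <= Rabs c / 2).
  { apply Rle_trans with (Rabs c / (2 * (K0 + 1)) * (K0 + 1)); [|apply Req_le; field; lra].
    apply Rmult_le_compat_r; [lra|]. eapply Rle_trans; [apply Rmin_l|apply Rmin_r]. }
  assert (He3 : e * K1 <= eps * Rabs c).
  { apply Rle_trans with (eps * Rabs c / K1 * K1); [|apply Req_le; field; lra].
    apply Rmult_le_compat_r; [lra|]. eapply Rle_trans; [apply Rmin_r|apply Rmin_l]. }
  assert (He4 : e * K1 * K2 <= eps).
  { apply Rle_trans with (eps / (K1 * K2) * K1 * K2); [|apply Req_le; field; lra].
    apply Rmult_le_compat_r; [lra|]. apply Rmult_le_compat_r; [lra|].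
    eapply Rle_trans; [apply Rmin_r|apply Rmin_r]. }
  exists e. split; [exact He0|]. clearbody e.
  intros h q dl Hh Hq H0 H1.
  assert (Hdl := Rabs_pos dl).
  (* As [e <= Rabs c], the error absorbs at most half of [2 c dl], and the second equation can be
     solved for [dl]. *)
  assert (B1 : Rabs dl <= K0 * (h + q)).
  { assert (T : Rabs (2 * c * dl) <= e * (h + Rabs dl + q) + Rabs b * h + Rabs d * q).
    { replace (2 * c * dl) with ((b * h + 2 * c * dl + d * q) - b * h - d * q) by ring.
      unfold Rminus. eapply Rle_trans; [apply Rabs_triang|].
      eapply Rle_trans; [apply Rplus_le_compat_r, Rabs_triang|].
      rewrite !Rabs_Ropp, !Rabs_mult, (Rabs_pos_eq h), (Rabs_pos_eq q) by lra. lra. }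
    rewrite !Rabs_mult, (Rabs_pos_eq 2) in T by lra.
    apply (Rmult_le_reg_l (Rabs c)); [exact Hac|].
    replace (Rabs c * (K0 * (h + q))) with ((Rabs b + Rabs d + Rabs c) * (h + q))
      by (unfold K0; field; lra).
    assert (e * (h + Rabs dl + q) <= Rabs c * (h + Rabs dl + q)) by (apply Rmult_le_compat_r; lra).
    nra. }
  assert (B2 : h + Rabs dl + q <= (K0 + 1) * (h + q)) by lra.
  assert (B3 : Rabs (q - k * h) * Rabs c <= e * (h + Rabs dl + q)).
  { rewrite <- Rabs_mult. replace ((q - k * h) * c) with (a * h + c * q); [exact H0|].
    unfold k. field. exact Hc. }
  (* The first equation now has error at most [Rabs c * (h + q) / 2], which bounds [q] by [h]; from
     here all errors are multiples of [h] alone. *)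
  assert (B4 : q <= (2 * k + 1) * h).
  { assert (T : Rabs (q - k * h) * Rabs c <= Rabs c / 2 * (h + q)).
    { eapply Rle_trans; [exact B3|].
      apply Rle_trans with (e * ((K0 + 1) * (h + q))); [apply Rmult_le_compat_l; lra|].
      rewrite <- Rmult_assoc. apply Rmult_le_compat_r; lra. }
    assert (T2 : Rabs (q - k * h) <= (h + q) / 2).
    { apply (Rmult_le_reg_r (Rabs c)); [exact Hac|]. lra. }
    apply Rabs_le_between in T2. lra. }
  assert (B5 : e * (h + Rabs dl + q) <= e * K1 * h).
  { rewrite Rmult_assoc. apply Rmult_le_compat_l; [lra|]. unfold K1.
    eapply Rle_trans; [exact B2|]. rewrite Rmult_assoc. apply Rmult_le_compat_l; lra. }
  assert (B6 : Rabs (q - k * h) <= e * K1 / Rabs c * h).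
  { apply (Rmult_le_reg_r (Rabs c)); [exact Hac|].
    replace (e * K1 / Rabs c * h * Rabs c) with (e * K1 * h) by (field; lra). lra. }
  split.
  - eapply Rle_trans; [exact B6|]. apply Rmult_le_compat_r; [lra|]. apply Rle_div_l; lra.
  - apply Rle_trans with (e * K1 * K2 * h); [|apply Rmult_le_compat_r; lra].
    assert (T : Rabs ((dl - - (1 / (2 * c)) * (b - a * d / c) * h) * (2 * c)) <=
      e * K1 * h * (1 + Rabs d / Rabs c)).
    { replace ((dl - - (1 / (2 * c)) * (b - a * d / c) * h) * (2 * c)) with
        ((b * h + 2 * c * dl + d * q) - d * (q - k * h)) by (unfold k; field; exact Hc).
      unfold Rminus at 1. eapply Rle_trans; [apply Rabs_triang|]. rewrite Rabs_Ropp, Rabs_mult.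
      assert (T1 : Rabs d * Rabs (q - k * h) <= Rabs d * (e * K1 / Rabs c * h))
        by (apply Rmult_le_compat_l; [exact Hd|exact B6]).
      replace (e * K1 * h * (1 + Rabs d / Rabs c)) with
        (e * K1 * h + Rabs d * (e * K1 / Rabs c * h)) by (field; lra). lra. }
    rewrite Rabs_mult in T. rewrite (Rabs_mult 2), (Rabs_pos_eq 2) in T by lra.
    apply (Rmult_le_reg_r (2 * Rabs c)); [lra|].
    replace (e * K1 * K2 * h * (2 * Rabs c)) with (e * K1 * h * (1 + Rabs d / Rabs c))
      by (unfold K2; field; lra). exact T.
Qed.

(* [|x| - sqrt (k h) = (x^2 - k h) / (|x| + sqrt (k h))]. *)
Lemma sqrt_asymptotics (k h x eps : R) : 0 < k -> 0 < h -> 0 < eps -> x <> 0 ->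
  Rabs (x ^ 2 - k * h) <= eps * sqrt k * h ->
  Rabs (x - sign x * (sqrt k * sqrt h)) <= eps * sqrt h.
Proof.
  intros Hk Hh He Hx H.
  assert (Hsk := sqrt_lt_R0 k Hk). assert (Hsh := sqrt_lt_R0 h Hh).
  assert (Ek : sqrt k * sqrt k = k) by (apply sqrt_sqrt; lra).
  assert (Eh : sqrt h * sqrt h = h) by (apply sqrt_sqrt; lra).
  assert (Hax := Rabs_pos_lt x Hx).
  assert (E1 : Rabs (x - sign x * (sqrt k * sqrt h)) = Rabs (Rabs x - sqrt k * sqrt h)).
  { destruct (Rlt_le_dec 0 x) as [Hp|Hn].
    - rewrite sign_eq_1 by exact Hp. rewrite (Rabs_pos_eq x) by lra. f_equal. ring.
    - rewrite sign_eq_m1 by lra. rewrite (Rabs_left1 x) by lra.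
      rewrite <- Rabs_Ropp. f_equal. ring. }
  rewrite E1.
  apply (Rmult_le_reg_r (Rabs x + sqrt k * sqrt h)); [nra|].
  rewrite <- (Rabs_pos_eq (Rabs x + sqrt k * sqrt h)) at 1 by nra. rewrite <- Rabs_mult.
  replace ((Rabs x - sqrt k * sqrt h) * (Rabs x + sqrt k * sqrt h)) with (x ^ 2 - k * h).
  2: { rewrite <- (pow2_abs x), <- Ek at 1. rewrite <- Eh at 1. ring. }
  eapply Rle_trans; [exact H|].
  replace (eps * sqrt k * h) with (eps * sqrt h * (sqrt k * sqrt h)).
  - apply Rmult_le_compat_l; nra.
  - rewrite <- Eh at 3. ring.
Qed.

(** Put [h = D0 - D] and [q = x^2]. Expanding in [D] at [y0] and then in [y] by the mean value
    theorem, [G] is [- a h] plus [dl] times a value of [G_y], which is small near the edge; and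
    [G_y] is [b h + 2 c dl] up to small terms. Inserting [G_yy] near [2 c] and [G_yyy] near [- 6 d]
    in [zero_expansion] gives the two relations. *)
Lemma off_critical_equations (D0 y0 a b c d e : R) : 0 < D0 -> 0 < e ->
  G_der 0 D0 y0 = 0 -> G_der 1 D0 y0 = 0 ->
  a = coef_a y0 D0 -> b = coef_b y0 D0 -> c = coef_c y0 D0 -> d = coef_d y0 D0 ->
  exists r, 0 < r /\ forall D f x dl, 0 < D0 - D < r -> Rabs x < r -> Rabs dl < r -> x <> 0 ->
  is_zeta2 D f -> f (1 / 2 + x, y0 + dl) = RtoC 0 ->
  Rabs (a * (D0 - D) + c * x ^ 2) <= e * (D0 - D + Rabs dl + x ^ 2) /\
  Rabs (b * (D0 - D) + 2 * c * dl + d * x ^ 2) <= e * (D0 - D + Rabs dl + x ^ 2).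
Proof.
  intros HD0 He G0 G1 Ha Hb Hc Hd.
  rewrite coef_a_A_der in Ha by exact HD0. rewrite coef_b_A_der in Hb by exact HD0.
  rewrite coef_c_G_der in Hc by exact HD0. rewrite coef_d_G_der in Hd by exact HD0.
  assert (He2 : 0 < e / 2) by lra.
  destruct (G_der_continuous 1 D0 y0 (e / 2) HD0 He2) as [r1 [[Hr1 Hr1'] C1]].
  destruct (G_der_continuous 2 D0 y0 (e / 2) HD0 He2) as [r2 [[Hr2 _] C2]].
  destruct (G_der_continuous 3 D0 y0 (e / 2) HD0 He2) as [r3 [[Hr3 _] C3]].
  destruct (G_der_D_expansion 0 D0 y0 (e / 2) HD0 He2) as [r4 [Hr4 D4]].
  destruct (G_der_D_expansion 1 D0 y0 (e / 2) HD0 He2) as [r5 [Hr5 D5]].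
  destruct (zero_expansion D0 HD0) as [M [HM Hz]].
  (* [1 / 4] is the range of [zero_expansion]; the other bound makes [M x^4] at most
     [(e / 2) x^2]. *)
  set (r6 := Rmin (1 / 4) (e / (2 * (M + 1)))).
  assert (Hr6 : 0 < r6) by (apply Rmin_pos; [lra|apply Rdiv_lt_0_compat; lra]).
  set (r := Rmin (Rmin r1 r2) (Rmin (Rmin r3 r4) (Rmin r5 r6))).
  assert (Hr : 0 < r) by (repeat first [assumption | apply Rmin_pos]).
  assert (L1 : r <= r1) by (eapply Rle_trans; apply Rmin_l).
  assert (L2 : r <= r2) by (eapply Rle_trans; [apply Rmin_l|apply Rmin_r]).
  assert (L3 : r <= r3) by (eapply Rle_trans; [apply Rmin_r|eapply Rle_trans; apply Rmin_l]).
  assert (L4 : r <= r4)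
    by (eapply Rle_trans; [apply Rmin_r|eapply Rle_trans; [apply Rmin_l|apply Rmin_r]]).
  assert (L5 : r <= r5)
    by (eapply Rle_trans; [apply Rmin_r|eapply Rle_trans; [apply Rmin_r|apply Rmin_l]]).
  assert (L6 : r <= r6)
    by (eapply Rle_trans; [apply Rmin_r|eapply Rle_trans; [apply Rmin_r|apply Rmin_r]]).
  assert (L7 : r6 <= 1 / 4) by apply Rmin_l.
  assert (L8 : r6 <= e / (2 * (M + 1))) by apply Rmin_r.
  clearbody r r6.
  exists r. split; [exact Hr|]. intros D f x dl Hh Hx Hdl Hx0 Hf Hfz.
  set (h := D0 - D) in *.
  assert (HDh : D - D0 = - h) by (unfold h; ring).
  assert (HDa : Rabs (D - D0) = h) by (rewrite HDh, Rabs_Ropp; apply Rabs_pos_eq; lra).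
  assert (HD : 0 < D) by (unfold h in Hh; lra).
  set (y := y0 + dl) in *.
  assert (Hy : y - y0 = dl) by (unfold y; ring).
  destruct (Hz D f x y ltac:(lra) ltac:(lra) Hf Hfz) as [Z0 Z1].
  destruct (G_der_mvt 0 D y0 y HD ltac:(lia)) as [xi0 [X0 M0]].
  destruct (G_der_mvt 1 D y0 y HD ltac:(lia)) as [xi1 [X1 M1]].
  rewrite Hy in *.
  specialize (C1 D xi0 ltac:(lra) ltac:(lra)). rewrite G1, Rminus_0_r in C1.
  assert (C2y := C2 D y ltac:(lra) ltac:(rewrite Hy; lra)).
  assert (C2x := C2 D xi1 ltac:(lra) ltac:(lra)).
  specialize (C3 D y ltac:(lra) ltac:(rewrite Hy; lra)).
  specialize (D4 D ltac:(lra)). specialize (D5 D ltac:(lra)).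
  rewrite HDa, HDh in D4, D5. rewrite G0, <- Ha in D4. rewrite G1 in D5.
  replace (A_der Kern1 1 D0 y0) with (- b) in D5 by lra.
  replace (G_der 2 D0 y0) with (2 * c) in C2y, C2x by lra.
  replace (G_der 3 D0 y0) with (- 6 * d) in C3 by lra.
  set (q := x ^ 2) in *.
  assert (Hax := Rabs_pos_lt x Hx0). assert (Hdl0 := Rabs_pos dl).
  assert (Hq : 0 <= q) by apply pow2_ge_0.
  assert (Hq2 : M * x ^ 4 <= e / 2 * q).
  { replace (x ^ 4) with (q * q) by (unfold q; ring). rewrite <- Rmult_assoc.
    apply Rmult_le_compat_r; [exact Hq|].
    assert (q <= r6) by (unfold q; rewrite <- (pow2_abs x); nra).
    apply Rle_trans with ((M + 1) * (e / (2 * (M + 1)))); [|apply Req_le; field; lra].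
    apply Rmult_le_compat; lra. }
  (* Being off the critical line enters here: the imaginary equation is divided by [x <> 0]. *)
  assert (Z1' : Rabs (G_der 1 D y - q / 6 * G_der 3 D y) <= M * x ^ 4).
  { apply (Rmult_le_reg_l (Rabs x)); [exact Hax|]. rewrite <- Rabs_mult, <- Rabs_Ropp.
    replace (- (x * (G_der 1 D y - q / 6 * G_der 3 D y))) with (x ^ 3 / 6 * G_der 3 D y - x * G_der 1 D y)
      by (unfold q; field).
    eapply Rle_trans; [exact Z1|]. apply Req_le.
    replace (x ^ 4) with (Rabs x ^ 4); [ring|].
    replace (Rabs x ^ 4) with ((Rabs x ^ 2) ^ 2) by ring. rewrite pow2_abs. ring. }
  assert (T : forall p s z, 0 <= s -> Rabs p <= z -> Rabs (s * p) <= z * s).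
  { intros p s z Hs Hp. rewrite Rabs_mult, (Rabs_pos_eq s), Rmult_comm by exact Hs.
    apply Rmult_le_compat_r; assumption. }
  assert (T' : forall p s z, Rabs p < z -> Rabs (s * p) <= z * Rabs s).
  { intros p s z Hp. rewrite Rabs_mult, Rmult_comm. apply Rmult_le_compat_r; [apply Rabs_pos|lra]. }
  split.
  - replace (a * h + c * q) with ((G_der 0 D y0 - 0 - - h * a) + dl * G_der 1 D xi0
      + - (G_der 0 D y - q / 2 * G_der 2 D y) + - (q / 2 * (G_der 2 D y - 2 * c))) by lra.
    assert (B1 := T' _ dl _ C1). assert (B2 := T _ (q / 2) _ ltac:(lra) (Rlt_le _ _ C2y)).
    eapply Rle_trans; [apply Rabs_triang|].
    eapply Rle_trans; [apply Rplus_le_compat_r, Rabs_triang|].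
    eapply Rle_trans; [apply Rplus_le_compat_r, Rplus_le_compat_r, Rabs_triang|].
    rewrite !Rabs_Ropp. nra.
  - replace (b * h + 2 * c * dl + d * q) with (- (G_der 1 D y0 - 0 - - h * - b)
      + - (dl * (G_der 2 D xi1 - 2 * c)) + (G_der 1 D y - q / 6 * G_der 3 D y)
      + q / 6 * (G_der 3 D y - - 6 * d)) by lra.
    assert (B1 := T' _ dl _ C2x). assert (B2 := T _ (q / 6) _ ltac:(lra) (Rlt_le _ _ C3)).
    eapply Rle_trans; [apply Rabs_triang|].
    eapply Rle_trans; [apply Rplus_le_compat_r, Rabs_triang|].
    eapply Rle_trans; [apply Rplus_le_compat_r, Rplus_le_compat_r, Rabs_triang|].
    rewrite !Rabs_Ropp. nra.
Qed.

(* The sign [+/-] in the expansion of [drho_x] is that of [drho_x] itself;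
   [is_domin F f g] reads "[g = o(f)] along the filter [F]". *)
Theorem lemma4p2 (zeta2 : R -> C -> C)
  (zeta2_spec : forall Delta : R, 0 < Delta -> is_zeta2 Delta (zeta2 Delta))
  (Delta_star y_star : R)
  (edge : left_edge_zero zeta2 Delta_star y_star)
  (c_neq0 : coef_c y_star Delta_star <> 0)
  (ac_pos : - coef_a y_star Delta_star / coef_c y_star Delta_star > 0)
  (drho_x drho_y : R -> R)
  (off_zero : at_left Delta_star (fun Delta : R =>
     drho_x Delta <> 0 /\
     off_critical_zero zeta2 Delta
       (1 / 2 + drho_x Delta) (y_star + drho_y Delta)))
  (drho_x_cvg : filterlim drho_x (at_left Delta_star) (locally 0))
  (drho_y_cvg : filterlim drho_y (at_left Delta_star) (locally 0)) :
  let a := coef_a y_star Delta_star in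
  let b := coef_b y_star Delta_star in
  let c := coef_c y_star Delta_star in
  let d := coef_d y_star Delta_star in
  is_domin (at_left Delta_star)
    (fun Delta : R => sqrt (Delta_star - Delta))
    (fun Delta : R =>
       drho_x Delta -
       sign (drho_x Delta) * (sqrt (- a / c) * sqrt (Delta_star - Delta))) /\
  is_domin (at_left Delta_star)
    (fun Delta : R => Delta_star - Delta)
    (fun Delta : R =>
       drho_y Delta -
       - (1 / (2 * c)) * (b - a * d / c) * (Delta_star - Delta)).
Proof.
  intros a b c d.
  assert (HD0 : 0 < Delta_star) by apply edge.
  assert (G0 := critical_zero_Gk0 zeta2 zeta2_spec _ _ (proj1 edge)).
  assert (G1 := edge_Gk1 zeta2 zeta2_spec _ _ edge).
  assert (Hk : 0 < - a / c) by exact ac_pos.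
  assert (Key : forall eps, 0 < eps -> at_left Delta_star (fun Delta =>
    0 < Delta_star - Delta /\ drho_x Delta <> 0 /\
    Rabs (drho_x Delta ^ 2 - - a / c * (Delta_star - Delta)) <= eps * (Delta_star - Delta) /\
    Rabs (drho_y Delta - - (1 / (2 * c)) * (b - a * d / c) * (Delta_star - Delta)) <=
      eps * (Delta_star - Delta))).
  { intros eps Heps.
    destruct (edge_algebra a b c d eps c_neq0 Hk Heps) as [e [He HE]].
    destruct (off_critical_equations Delta_star y_star a b c d e HD0 He G0 G1
      eq_refl eq_refl eq_refl eq_refl) as [r [Hr HR]].
    assert (Fx : at_left Delta_star (fun Delta => Rabs (drho_x Delta) < r)).
    { apply (drho_x_cvg (fun z => Rabs z < r)). exists (mkposreal r Hr). intros z Hz.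
      change (Rabs (z - 0) < r) in Hz. rewrite Rminus_0_r in Hz. exact Hz. }
    assert (Fy : at_left Delta_star (fun Delta => Rabs (drho_y Delta) < r)).
    { apply (drho_y_cvg (fun z => Rabs z < r)). exists (mkposreal r Hr). intros z Hz.
      change (Rabs (z - 0) < r) in Hz. rewrite Rminus_0_r in Hz. exact Hz. }
    assert (Fd : at_left Delta_star (fun Delta => 0 < Delta_star - Delta < r)).
    { exists (mkposreal r Hr). intros z Hz Hlt.
      change (Rabs (z - Delta_star) < r) in Hz. apply Rabs_def2 in Hz. lra. }
    generalize (filter_and _ _ (filter_and _ _ Fx Fy) (filter_and _ _ Fd off_zero)).
    apply filter_imp. intros Delta [[Hx Hy] [Hd [Hx0 [HD [_ [_ Hz]]]]]].
    destruct (HR Delta (zeta2 Delta) (drho_x Delta) (drho_y Delta) Hd Hx Hy Hx0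
      (zeta2_spec Delta HD) Hz) as [R0 R1].
    destruct (HE (Delta_star - Delta) (drho_x Delta ^ 2) (drho_y Delta) (proj1 Hd)
      (pow2_ge_0 _) R0 R1) as [S0 S1].
    repeat split; try assumption. apply Hd. }
  split; intros eps.
  - assert (Hsk := sqrt_lt_R0 _ Hk).
    (* The error in [x^2] gets divided by [|x| + sqrt (k h) >= sqrt (k h)], with [k = - a / c] and
       [h = Delta_star - Delta], so the tolerance is scaled by [sqrt k]. *)
    generalize (Key (eps * sqrt (- a / c)) (Rmult_lt_0_compat _ _ (cond_pos eps) Hsk)).
    apply filter_imp. intros Delta [Hh [Hx0 [H _]]].
    change (Rabs (drho_x Delta - sign (drho_x Delta) * (sqrt (- a / c) * sqrt (Delta_star - Delta)))
      <= eps * Rabs (sqrt (Delta_star - Delta))).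
    rewrite (Rabs_pos_eq (sqrt _)) by apply sqrt_pos.
    apply sqrt_asymptotics; try assumption. apply cond_pos.
  - generalize (Key eps (cond_pos eps)). apply filter_imp. intros Delta [Hh [_ [_ H]]].
    change (Rabs (drho_y Delta - - (1 / (2 * c)) * (b - a * d / c) * (Delta_star - Delta))
      <= eps * Rabs (Delta_star - Delta)).
    rewrite (Rabs_pos_eq (Delta_star - Delta)) by lra. exact H.
Qed.
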